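(* Let $z\in\mathbb{C}\setminus[0,1]$. For any integers $k,r$ satisfying $k\ge 2$ and $k\ge r\ge 1$, we have $$(-1)^{r}\sum_{\substack{k_{1}+\cdots+k_{r}=k\\ k_{i}\ge1,\ k_{r}\ge2}} L\bigl(e_{z}e_{0}^{k_{1}-1}e_{1}e_{0}^{k_{2}-1}\cdots e_{1}e_{0}^{k_{r}-1}\bigr) = -L\bigl(e_{1}e_{0}^{k-1}\bigr)+L\bigl((e_{1}-e_{z})(e_{0}-e_{z})^{r-1}e_{0}^{k-r}\bigr),$$ where the sum is over all tuples of integers $(k_1,\dots,k_r)$ with $k_i\geq 1$ for all $i$, $k_r\ge 2$ and $k_1+\cdots+k_r=k$ (an empty sum is $0$).
   Context: Let $z\in\mathbb{C}\setminus[0,1]$. For $a_1,\dots,a_n\in\{0,1,z\}$ with $a_1\neq 0$ and $a_n\neq 1$, define the (absolutely convergent) iterated integral $$I(0;a_1,\dots,a_n;1)=\int_{0<t_1<t_2<\cdots<t_n<1}\ \prod_{i=1}^n\frac{dt_i}{t_i-a_i}.$$ $\mathcal{A}=\mathbb{Q}\langle e_0,e_1,e_z\rangle$ is the non-commutative polynomial algebra over $\mathbb{Q}$ in three formal letters $e_0,e_1,e_z$, and $$\mathcal{A}^0=\mathbb{Q}+\mathbb{Q}e_z+e_z\mathcal{A}e_z+e_z\mathcal{A}e_0+e_1\mathcal{A}e_z+e_1\mathcal{A}e_0$$ is the linear subspace spanned by convergent words, i.e. the empty word and the words $e_{a_1}\cdots e_{a_n}$ with $a_1\ne 0$, $a_n\neq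 1$. The $\mathbb{Q}$-linear map $L$ on $\mathcal{A}^0$ is defined by $L(1)=1$ and $L(e_{a_1}e_{a_2}\cdots e_{a_n})=I(0;a_1,a_2,\dots,a_n;1)$ for words in $\mathcal{A}^0$. In the word $e_{z}e_{0}^{k_{1}-1}e_{1}e_{0}^{k_{2}-1}\cdots e_{1}e_{0}^{k_{r}-1}$ the first block is $e_ze_0^{k_1-1}$ and the $i$-th block for $2\le i\le r$ is $e_1e_0^{k_i-1}$ (so for $r=1$ the word is $e_ze_0^{k-1}$). *)

(* Defs.v *)
From HB Require Import structures.
From mathcomp Require Import all_boot all_order all_algebra.
From mathcomp Require Import all_classical all_reals all_analysis.
From mathcomp Require Import complex.
(* The notations of monalg are incompatible with those of mathcomp-analysis. *)
From mathcomp Require Import (canonicals, coercions, hints) monalg.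

Set Implicit Arguments.
Unset Strict Implicit.
Unset Printing Implicit Defensive.

Import Order.TTheory GRing.Theory Num.Theory.
Import numFieldNormedType.Exports.

Local Open Scope classical_set_scope.
Local Open Scope ring_scope.

(* The subscripts 0, 1, z of the formal letters e_0, e_1, e_z; their values
   in C are given by letter_val below. *)
Inductive letter := l0 | l1 | lz.

Definition option_of_letter (a : letter) : option bool :=
  match a with l0 => Some false | l1 => Some true | lz => None end.

Definition letter_of_option (o : option bool) : letter :=
  match o with Some false => l0 | Some true => l1 | None => lz end.

Lemma option_of_letterK : cancel option_of_letter letter_of_option.
Proof. by case. Qed.

HB.instance Definition _ := Choice.copy letter (can_type option_of_letterK).

(* Q<e_0, e_1, e_z>: the algebra of the free monoid on the letters. *)
Notation ncpoly := (monalg.malg (monalg.fmonom letter) rat).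

Definition e_ (a : letter) : ncpoly :=
  monalg.mkmalgU (monalg.fmu a) (1 : rat).

(* The words e_{a_1} ... e_{a_n} spanning A^0: n = 0, or a_1 <> 0 and
   a_n <> 1. *)
Definition convergent (w : seq letter) : bool :=
  match w with
  | [::] => true
  | a :: s => (a != l0) && (last a s != l1)
  end.

Section iterated_integral.
Variable R : realType.
Implicit Types (z : R[i]) (x t : R) (a : letter) (w : seq letter).

Definition Cintegral (D : set R) (f : R -> R[i]) : R[i] :=
  Complex (\int[lebesgue_measure]_(t in D) complex.Re (f t))
          (\int[lebesgue_measure]_(t in D) complex.Im (f t)).

Definition letter_val z a : R[i] :=
  match a with l0 => 0 | l1 => 1 | lz => z end.

(* iterint z [:: a_1; ...; a_n] x is the integral of
     dt_1 / (t_1 - a_1) ... dt_n / (t_n - a_n)   over 0 < t_1 < ... < t_n < x,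
   the last variable t_n being the outermost one:
     I(0; a_1, ..., a_n; x)
       = \int_0^x I(0; a_1, ..., a_(n-1); t) dt / (t - a_n). *)
Definition iterint z w : R -> R[i] :=
  foldl (fun (F : R -> R[i]) a x =>
           Cintegral `]0, x[ (fun t => F t / (t%:C%C - letter_val z a)))
        (fun=> 1) w.

Definition I01 z w : R[i] := iterint z w 1.

(* The linear map on A^0, extended by 0 to the span of the other words. *)
Definition L z : ncpoly -> R[i] :=
  monalg.mmap (fun q : rat => ratr q)
    (fun w : monalg.fmonom letter => if convergent w then I01 z w else 0).

End iterated_integral.

(* Parts of a composition of k are at most k, hence the type of k_.
   zword is e_z e_0^(k_1 - 1) e_1 e_0^(k_2 - 1) ... e_1 e_0^(k_r - 1) *)
Definition zword (k r : nat) (k_ : {ffun 'I_r -> 'I_k.+1}) : ncpoly :=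
  \prod_(i < r) (e_ (if i == 0 :> nat then lz else l1) * e_ l0 ^+ (k_ i - 1)).

(* The last condition says k_r >= 2, the indices of k_ being 0, ..., r - 1. *)
Definition admissible (k r : nat) (k_ : {ffun 'I_r -> 'I_k.+1}) : bool :=
  [&& (\sum_(i < r) k_ i == k)%N,
      [forall i : 'I_r, (1 <= k_ i)%N]
    & [forall i : 'I_r, (i.+1 == r) ==> (2 <= k_ i)%N]].

(* Main.v *)
Require Import Defs.
From mathcomp Require Import all_boot all_order all_algebra.
From mathcomp Require Import all_classical all_reals all_analysis.
From mathcomp Require Import complex measurable_realfun ring lra.
From mathcomp Require Import (canonicals, coercions, hints) monalg.

(** Put w = 1/z, r = b + 1 and, when r < k, a = k - 2 - b.

    Left-hand side. An admissible composition is the same thing as a word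
    e_z W e_0 where W is an arbitrary word with a letters e_0 and b letters e_1
    ([sum_zword]). Adding up the iterated integrals of all such W between s and t
    removes every constraint on the order of the letters: up to the sign (-1)^b
    the sum is the product of (ln (t/s))^a / a! and
    (ln ((1-s)/(1-t)))^b / b! ([logkernel], [kernel_int_rec],
    [realizes_sum_words]). The left-hand side is therefore, up to sign, the
    integral over 0 < s < t < 1 of this kernel times ds/(s - z) dt/t
    ([L_sum_words]).

    The substitutions s = beta t and t = (1 - alpha)/(1 - alpha beta) turn the two
    logarithms into - ln beta and - ln alpha, and the domain into the unit square
    ([kernel_int_square]). Up to powers of these logarithms, what remains to be
    integrated is (1 - w)/Delta_w(alpha, beta) - 1/(1 - alpha beta) with
    Delta_w = 1 - beta w - alpha beta (1 - w) ([square_inner_polylog]): one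
    term depends on z, and the other is its value at w = 0.

    Right-hand side. Let [polylog w n] be the integral over 0 < alpha < 1 of
    (- ln alpha)^n / n! against beta (1 - w)/Delta_w; for w = 0 it is the
    polylogarithm Li_(n+1)(beta). It satisfies the recursion of iterated integrals
    with first form - (dt/(t - 1) - dt/(t - z)) and next forms
    dt/t - dt/(t - z) ([polylog0E], [polylogSE]), so that
    (e_1 - e_z) (e_0 - e_z)^n stands for - [polylog w n], and e_1 e_0^n for
    - [polylog 0 n] ([realizes_polylog]). A final factor e_0^(a+1) integrates
    against (- ln beta)^a / a! dbeta/beta ([iter_primitive0]). So the two terms on
    the right are exactly the two parts of the integral over the square.

    If r = k there is no admissible composition, and the right-hand side
    vanishes because the value of [polylog w n] at 1 does not depend on w, for n > 0
    ([polylogS_at1]).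

    All exchanges of integrals come from one Fubini theorem on the unit square:
    every integrand is dominated there by a multiple of rho(s) rho(t), where
    rho(x) = (x (1 - x))^(-3/4) is integrable ([fubini_int01]). *)

Set Implicit Arguments.
Unset Strict Implicit.
Unset Printing Implicit Defensive.

Import Order.TTheory GRing.Theory Num.Theory numFieldNormedType.Exports.
Local Open Scope classical_set_scope.
Local Open Scope ring_scope.

(** * The fundamental theorem of calculus and substitution on open intervals *)

Section real_integrals.
Variable R : realType.
Local Notation mu := (@lebesgue_measure R).
Implicit Types (f F phi : R -> R) (a b : R).

Lemma integrable_oo_cc f a b : mu.-integrable `]a, b[ (EFin \o f) ->
  mu.-integrable `[a, b] (EFin \o f).
Proof.
move=> /integrableP[mf If]; apply/integrableP; split.
  exact: emeasurable_fun_itv_cc mf.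
by rewrite integral_itv_bndoo//; exact: measurableT_comp.
Qed.

Lemma Rintegral_oo_cc f a b : mu.-integrable `]a, b[ (EFin \o f) ->
  \int[mu]_(x in `]a, b[) f x = \int[mu]_(x in `[a, b]) f x.
Proof.
by move=> /integrableP[mf _]; rewrite /Rintegral [in RHS]integral_itv_bndoo.
Qed.

Lemma is_derive_continuous f (x df : R) : is_derive x 1 f df -> {for x, continuous f}.
Proof. by move=> [df1 _]; exact/differentiable_continuous/derivable1_diffP. Qed.

Lemma indef_integralP f a b : a <= b -> mu.-integrable `]a, b[ (EFin \o f) ->
  {in `]a, b[, continuous f} ->
  let P := fun x => \int[mu]_(t in `[a, x]) f t in
  [/\ {within `[a, b], continuous P},
      forall x, x \in `]a, b[ -> is_derive x 1 P (f x),
      P a = 0 & P b = \int[mu]_(x in `]a, b[) f x].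
Proof.
move=> ab If cf P; have If' := integrable_oo_cc If.
split; last by rewrite Rintegral_oo_cc.
- exact: parameterized_integral_continuous.
- move=> x /[dup] xab; rewrite in_itv/= => /andP[ax xb].
  have [dP PE] := continuous_FTC1_closed xb If' ax (cf x xab).
  apply: DeriveDef; first exact: dP.
  by rewrite -[RHS]PE derive1E.
- by rewrite /P set_itv1 Rintegral_set1.
Qed.

(** Integrability of f replaces its continuity at the endpoints, where f may be
    unbounded: F and the indefinite integral of f are continuous up to the endpoints and
    have the same derivative inside, so they differ by a constant. *)
Lemma FTC_oo f F a b : a <= b -> mu.-integrable `]a, b[ (EFin \o f) ->
  {in `]a, b[, continuous f} -> {within `[a, b], continuous F} ->
  (forall x : R, x \in `]a, b[ -> is_derive x 1 F (f x)) ->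
  \int[mu]_(x in `]a, b[) f x = F b - F a.
Proof.
move=> ab If cf cF dF; have [cP dP Pa <-] := indef_integralP ab If cf.
set P := (fun x : R => \int[mu]_(t in `[a, x]) f t) in cP dP Pa *.
have dH x : x \in `]a, b[ -> is_derive x 1 (P - F) (cst 0 x).
  by move=> xab; apply: is_derive_eq; [apply: is_deriveB;
     [exact: dP|exact: dF]|rewrite subrr].
have [|c _ /eqP] := MVT_segment ab dH.
  by move=> x; apply: continuousB; [exact: cP|exact: cF].
move: Pa; rewrite -/(P a) /= mul0r subr_eq0 !fctE => -> /eqP.
by rewrite -/(P b); lra.
Qed.

Lemma continuous_comp_itv f phi a b c d :
  {within `[a, b], continuous phi} -> {within `[c, d], continuous f} ->
  (forall x : R, x \in `[a, b] -> phi x \in `[c, d]) ->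
  {within `[a, b], continuous (f \o phi)}.
Proof.
move=> cphi cf im.
apply/subspace_continuousP => x xab.
move/subspace_continuousP : cphi => /(_ x xab) cphi.
move/subspace_continuousP : cf => /(_ (phi x) (im x xab)) cf.
apply: (@cvg_comp _ _ _ _ _ _ _ _ _ cf) => U /= cU0.
have cU : nbhs x (fun y => y \in `[a, b] -> phi y \in `[c, d] -> U (phi y)).
  exact: cphi cU0.
by apply: (filterS _ cU) => y H yab; apply: H => //; exact: im.
Qed.

(** The classical substitution theorem asks f to be continuous up to the boundary.
    Here f may blow up at a and b, so [FTC_oo] is applied to the composition of phi
    with the indefinite integral of f. *)
Lemma substitution_oo f phi (dphi : R -> R) a b : a <= b ->
  mu.-integrable `]a, b[ (EFin \o f) -> {in `]a, b[, continuous f} ->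
  {within `[0, 1], continuous phi} ->
  (forall x : R, x \in `[0, 1] -> phi x \in `[a, b]) ->
  (forall x : R, x \in `]0, 1[ -> phi x \in `]a, b[) ->
  (forall x : R, x \in `]0, 1[ -> is_derive x 1 phi (dphi x)) ->
  {in `]0, 1[, continuous dphi} ->
  mu.-integrable `]0, 1[ (EFin \o (fun x => f (phi x) * dphi x)) ->
  \int[mu]_(x in `]0, 1[) (f (phi x) * dphi x) =
    \int[mu]_(t in `[a, phi 1]) f t - \int[mu]_(t in `[a, phi 0]) f t.
Proof.
move=> ab If cf cphi imc imo dphiP cdphi Ifphi.
have [cP dP _ _] := indef_integralP ab If cf.
set P := (fun x : R => \int[mu]_(t in `[a, x]) f t) in cP dP *.
have cf' : {in `]0, 1[, continuous (fun x => f (phi x) * dphi x)}.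
  move=> x x01. apply: continuousM; last exact: cdphi.
  apply: continuous_comp. exact: is_derive_continuous (dphiP x x01).
  by apply: cf; exact: imo.
have cPphi := continuous_comp_itv cphi cP imc.
have dPphi (x : R) : x \in `]0, 1[ -> is_derive x 1 (P \o phi) (f (phi x) * dphi x).
  move=> x01; apply: is_derive1_comp. apply: dP; exact: imo. exact: dphiP.
have := @FTC_oo (fun x => f (phi x) * dphi x) (P \o phi) 0 1 ler01 Ifphi cf' cPphi dPphi.
by [].
Qed.
End real_integrals.

(** * An integrable weight with algebraic singularities at 0 and 1 *)

Section weight.
Variable R : realType.
Local Notation mu := (@lebesgue_measure R).
Local Notation I := (`]0, 1[%classic : set R).
Implicit Types (f F phi : R -> R) (x : R).

(** Integrability of a nonnegative function without computing an improper integral: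
    its integrals from 1/(n+3) to 1 - 1/(n+3) are increments of F, hence
    bounded by 2 M, and monotone convergence concludes. *)
Lemma integrable_bounded_primitive f F (M : R) :
  (forall x : R, x \in `]0, 1[ -> 0 <= f x) ->
  (forall x : R, x \in `]0, 1[ -> is_derive x 1 F (f x)) ->
  {in `]0, 1[, continuous f} ->
  (forall x : R, x \in `]0, 1[ -> `|F x| <= M) ->
  mu.-integrable I (EFin \o f).
Proof.
move=> f0 dF cf FM.
(* The shift by 3 makes 1/(n+3) < 1/2, so that every segment is nonempty. *)
pose d (n : nat) : R := (n.+3%:R)^-1.
have d0 n : 0 < d n by rewrite invr_gt0 ltr0n.
have d12 n : d n < 2^-1 by rewrite ltf_pV2 ?posrE ?ltr0n// ltr_nat.
have dS n m : (n <= m)%N -> d m <= d n.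
  by move=> nm; rewrite lef_pV2 ?posrE ?ltr0n// ler_nat.
pose D n : set R := `[d n, 1 - d n]%classic.
have DI n x : D n x -> x \in `]0, 1[.
  by rewrite /D/= !in_itv/= => /andP[? ?]; have := d0 n; have := d12 n; lra.
have UD : \bigcup_n D n = I.
  apply/seteqP; split=> [x [n _ /DI]//|x /=]; rewrite in_itv/= => /andP[x0 x1].
  have : \forall n \near \oo, d n < Num.min x (1 - x).
    have := @cvg_harmonic R => /cvgrPdist_lt/(_ (Num.min x (1 - x))).
    rewrite lt_min x0 subr_gt0 x1 => /(_ isT)[N _ NH]; exists N => // n /= Nn.
    have := NH _ (leq_trans Nn (leq_trans (leqnSn n) (leqnSn _))).
    by rewrite /= sub0r normrN ger0_norm// invr_ge0.
  move=> [N _ /(_ N (leqnn _))]; rewrite lt_min => /andP[? ?].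
  by exists N => //; rewrite /D/= in_itv/=; apply/andP; lra.
have ndD : nondecreasing_seq D.
  apply/nondecreasing_seqP => n; apply/subsetPset => x; rewrite /D/= !in_itv/=.
  by have dn := dS n n.+1 (leqnSn n); move=> /andP[? ?]; apply/andP; lra.
have mf : measurable_fun I f by apply: open_continuous_measurable_fun => // x /[!inE]; exact: cf.
have mD n : measurable_fun (D n) (EFin \o f).
  apply/measurable_EFinP; apply: measurable_funS mf => // x /DI//.
have IM n : (\int[mu]_(x in D n) (f x)%:E <= (M + M)%:E)%E.
  have ddn : d n < 1 - d n by have := d12 n; lra.
  rewrite (@continuous_FTC2 _ f F)//.
  - have dI : d n \in `]0, 1[ by apply: (DI n); rewrite /D /= in_itv/= lexx/= ltW.
    have dI' : 1 - d n \in `]0, 1[ by apply: (DI n); rewrite /D/= in_itv/= lexx/= ltW.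
    rewrite -EFinD lee_fin lerD//.
      by rewrite (le_trans (ler_norm _))// FM.
    by rewrite (le_trans (ler_norm _))// normrN FM.
  - by apply: continuous_in_subspaceT => x /[!inE] /DI; exact: cf.
  - have cF x : D n x -> {for x, continuous F}.
      by move=> /DI xI; exact: is_derive_continuous (dF x xI).
    split.
    + by move=> x /subset_itv_oo_cc /DI/dF[].
    + by apply: cvg_at_right_filter; apply: cF; rewrite /D/= in_itv/= lexx/= ltW.
    + by apply: cvg_at_left_filter; apply: cF; rewrite /D/= in_itv/= lexx/= ltW.
  - by move=> x /subset_itv_oo_cc /DI/dF dx; rewrite derive1E derive_val.
apply/integrableP; split; first exact/measurable_EFinP.
apply: (@le_lt_trans _ _ (M + M)%:E); last exact: ltry.
rewrite (_ : (\int[mu]_(x in I) _)%E = (\int[mu]_(x in I) (f x)%:E)%E); last first.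
  by apply: eq_integral => x /[!inE] /f0 fx0; rewrite /= ger0_norm.
rewrite -UD.
have cv : (\int[mu]_(x in D n) (f x)%:E @[n --> \oo] -->
    \int[mu]_(x in \bigcup_n D n) (f x)%:E)%E.
  apply: ge0_nondecreasing_set_cvg_integral.
  - exact: ndD.
  - by move=> n; exact: measurable_itv.
  - exact: mD.
  - by move=> n x /DI/f0; rewrite lee_fin.
rewrite -(cvg_lim _ cv)//; apply: lime_le; first exact: cvgP cv.
by apply: nearW => n; exact: IM.
Qed.

(** The common majorant of all integrands. An exponent strictly between 1/2 and 1
    keeps it integrable and still leaves room to bound logarithms by x^(-1/4)
    and to share a pole 1/t, on s < t, as t^(-1/2) s^(-1/2). *)
Definition rho x : R := x `^ (- (3 / 4)) * (1 - x) `^ (- (3 / 4)).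

Lemma integrable_rho : mu.-integrable I (EFin \o rho).
Proof.
pose q : R := - (3 / 4).
have Ip : mu.-integrable I (EFin \o (@powR R ^~ q)).
  apply: (@integrable_bounded_primitive (@powR R ^~ q) (fun x => 4 * x `^ (1 / 4)) 4).
  - by move=> x _; exact: powR_ge0.
  - move=> x; rewrite in_itv/= => /andP[x0 _].
    apply: is_derive_eq; first exact: is_deriveZ (is_derive1_powR (1 / 4) x0).
    rewrite -[_ *: _]/(4 * _) mulrA (_ : 1 / 4 - 1 = q); last by rewrite /q; lra.
    by rewrite (_ : 4 * (1 / 4) = 1) ?mul1r//; lra.
  - move=> x; rewrite in_itv/= => /andP[x0 _].
    exact: is_derive_continuous (is_derive1_powR q x0).
  - move=> x; rewrite in_itv/= => /andP[x0 x1].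
    rewrite ger0_norm ?mulr_ge0 ?powR_ge0// ger_pMr//.
    by rewrite -[leRHS](powRr0 x); apply: ger_powR; [rewrite x0 ltW|lra].
have Iq : mu.-integrable I (EFin \o (fun x => (1 - x) `^ q)).
  apply: (@integrable_bounded_primitive (fun x => (1 - x) `^ q) (fun x => - 4 * (1 - x) `^ (1 / 4)) 4).
  - by move=> x _; exact: powR_ge0.
  - move=> x; rewrite in_itv/= => /andP[_ x1].
    have x1' : 0 < 1 - x by rewrite subr_gt0.
    have d1 : is_derive x 1 (fun x => 1 - x) (-1 : R).
      by apply: is_derive_eq; ring.
    have H := is_deriveZ (- 4) (@is_derive1_comp _ (@powR R ^~ (1 / 4))
      (fun x => 1 - x) x _ _ (is_derive1_powR (1 / 4) x1') d1).
    apply: is_derive_eq.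
    rewrite -[_ *: _]/(- 4 * _) (_ : 1 / 4 - 1 = q); last by rewrite /q; lra.
    by lra.
  - move=> x; rewrite in_itv/= => /andP[_ x1].
    have x1' : 0 < 1 - x by rewrite subr_gt0.
    apply: (@continuous_comp _ _ _ (fun x => 1 - x) (@powR R ^~ q)).
      by apply: continuousB => //; exact: cst_continuous.
    exact: is_derive_continuous (is_derive1_powR q x1').
  - move=> x; rewrite in_itv/= => /andP[x0 x1].
    rewrite normrM normrN !ger0_norm ?powR_ge0// ger_pMr//.
    by rewrite -[leRHS](powRr0 (1 - x)); apply: ger_powR; [apply/andP; lra|lra].
apply: (@le_integrable _ _ _ mu I _ _
   (EFin \o (fun x => 2 * x `^ q + 2 * (1 - x) `^ q))) => //.
- apply/measurable_EFinP; apply: measurable_funM.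
    by apply: measurable_funTS; exact: measurable_powR.
  apply: measurable_funTS; apply: (measurableT_comp (measurable_powR q)).
  exact: measurable_funB.
- move=> x /=; rewrite in_itv/= => /andP[x0 x1].
  rewrite lee_fin !ger0_norm ?addr_ge0 ?mulr_ge0 ?powR_ge0//.
  (* On the half of the interval away from its singularity, each power is at most 2. *)
  have half y : 1 / 2 <= y <= 1 -> y `^ q <= 2.
    move=> y12; have y0 : 0 < y by lra.
    rewrite /q powRN invf_ple ?posrE ?powR_gt0//.
    apply: (@le_trans _ _ y); first by lra.
    by rewrite -[leLHS](powRr1 (ltW y0)); apply: ger_powR; [apply/andP; lra|lra].
  have := powR_ge0 x q; have := powR_ge0 (1 - x) q; rewrite /rho -/q.
  have [x12|x12] := lerP x (1 / 2).
  + by have := half (1 - x); nra.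
  + by have := half x; nra.
- have := integrableD _ (integrableZl _ 2 Ip) (integrableZl _ 2 Iq).
  by move=> H; exact: H.
Qed.

End weight.

(** * Complex integrals over the unit interval *)

Section complex_integrals.
Variable R : realType.
Local Notation C := R[i].
Local Notation mu := (@lebesgue_measure R).
Local Notation I := (`]0, 1[%classic : set R).
Local Notation normc := (@ComplexField.Normc.normc R).
Local Notation Re := (@complex.Re R).
Local Notation Im := (@complex.Im R).

Lemma cReD (x y : C) : Re (x + y) = Re x + Re y. Proof. by case: x y => ? ? []. Qed.
Lemma cImD (x y : C) : Im (x + y) = Im x + Im y. Proof. by case: x y => ? ? []. Qed.
Lemma cReN (x : C) : Re (- x) = - Re x. Proof. by case: x. Qed.
Lemma cImN (x : C) : Im (- x) = - Im x. Proof. by case: x. Qed.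
Lemma cReM (x y : C) : Re (x * y) = Re x * Re y - Im x * Im y.
Proof. by case: x y => ? ? []. Qed.
Lemma cImM (x y : C) : Im (x * y) = Re x * Im y + Im x * Re y.
Proof. by case: x y => ? ? []. Qed.
Lemma cReV (x : C) : Re x^-1 = Re x / (Re x ^+ 2 + Im x ^+ 2).
Proof. by case: x. Qed.
Lemma cImV (x : C) : Im x^-1 = - (Im x / (Re x ^+ 2 + Im x ^+ 2)).
Proof. by case: x. Qed.
Lemma complex_eq (x y : C) : Re x = Re y -> Im x = Im y -> x = y.
Proof. by case: x y => ? ? [] ? ? /= -> ->. Qed.

Lemma normc_real (x : R) : normc x%:C%C = `|x|.
Proof. by rewrite /real_complex_def /ComplexField.Normc.normc expr0n addr0 sqrtr_sqr. Qed.

Lemma normc_ge0 (x : C) : 0 <= normc x.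
Proof. by case: x => a b; exact: sqrtr_ge0. Qed.

Lemma normc_gt0 (x : C) : (0 < normc x) = (x != 0).
Proof.
rewrite lt_def normc_ge0 andbT; congr (~~ _).
by apply/eqP/eqP => [/ComplexField.Normc.eq0_normc//|->]; exact: ComplexField.Normc.normc0.
Qed.

Lemma normRe (x : C) : `|Re x| <= normc x.
Proof.
by case: x => a b /=; rewrite -sqrtr_sqr ler_sqrt ?lerDl ?sqr_ge0// addr_ge0 ?sqr_ge0.
Qed.

Lemma normIm (x : C) : `|Im x| <= normc x.
Proof.
by case: x => a b /=; rewrite -sqrtr_sqr ler_sqrt ?lerDr ?sqr_ge0// addr_ge0 ?sqr_ge0.
Qed.

Lemma normc_le (x : C) : normc x <= `|Re x| + `|Im x|.
Proof.
case: x => a b /=; rewrite -[leRHS]ger0_norm ?addr_ge0// -sqrtr_sqr ler_sqrt ?sqr_ge0//.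
rewrite sqrrD !real_normK ?num_real//.
by rewrite addrAC lerDl mulrn_wge0// mulr_ge0.
Qed.

Lemma measurable_invr : measurable_fun [set: R] (@GRing.inv R).
Proof.
have : measurable_fun ([set 0] `|` ~` [set (0 : R)]) (@GRing.inv R).
  apply/measurable_funU => //.
    by apply: measurableC; exact: measurable_set1.
  split; first exact: measurable_fun_set1.
  apply: open_continuous_measurable_fun; first by apply: closed_openC; exact: closed_eq.
  by move=> x; rewrite inE/= => /eqP x0; apply: inv_continuous.
by rewrite setUv.
Qed.

Definition cmeas d (T : measurableType d) (D : set T) (f : T -> C) :=
  measurable_fun D (Re \o f) /\ measurable_fun D (Im \o f).

Section cmeas.
Context d (T : measurableType d).
Implicit Types (D : set T) (f g : T -> C).

Lemma cmeas_cst D (c : C) : cmeas D (cst c).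
Proof. by split; exact: measurable_cst. Qed.

Lemma cmeas_real D (f : T -> R) : measurable_fun D f -> cmeas D (fun x => (f x)%:C%C).
Proof. by split => //=; exact: measurable_cst. Qed.

Lemma cmeasD D f g : cmeas D f -> cmeas D g -> cmeas D (fun x => f x + g x).
Proof.
move=> [f1 f2] [g1 g2]; split.
  rewrite (_ : _ \o _ = (Re \o f) \+ (Re \o g)); first exact: measurable_funD.
  by apply/funext => x /=; rewrite cReD.
rewrite (_ : _ \o _ = (Im \o f) \+ (Im \o g)); first exact: measurable_funD.
by apply/funext => x /=; rewrite cImD.
Qed.

Lemma cmeasM D f g : cmeas D f -> cmeas D g -> cmeas D (fun x => f x * g x).
Proof.
move=> [f1 f2] [g1 g2]; split.
  rewrite (_ : _ \o _ = (fun x => Re (f x) * Re (g x) - Im (f x) * Im (g x))).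
    by apply: measurable_funB; exact: measurable_funM.
  by apply/funext => x /=; rewrite cReM.
rewrite (_ : _ \o _ = (fun x => Re (f x) * Im (g x) + Im (f x) * Re (g x))).
  by apply: measurable_funD; exact: measurable_funM.
by apply/funext => x /=; rewrite cImM.
Qed.

Lemma cmeasN D f : cmeas D f -> cmeas D (fun x => - f x).
Proof.
move=> mf; rewrite (_ : (fun _ => _) = (fun x => (-1) * f x)).
  by apply: cmeasM => //; exact: cmeas_cst.
by apply/funext => x; rewrite mulN1r.
Qed.

Lemma cmeasB D f g : cmeas D f -> cmeas D g -> cmeas D (fun x => f x - g x).
Proof. by move=> mf mg; apply: cmeasD => //; exact: cmeasN. Qed.

Lemma cmeasV D f : cmeas D f -> cmeas D (fun x => (f x)^-1).
Proof.
move=> [f1 f2].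
have m2 : measurable_fun D (fun x => (Re (f x) ^+ 2 + Im (f x) ^+ 2)^-1).
  apply: (measurableT_comp measurable_invr).
  by apply: measurable_funD; exact: measurable_funX.
split.
  rewrite (_ : _ \o _ = (fun x => Re (f x) / (Re (f x) ^+ 2 + Im (f x) ^+ 2))).
    exact: measurable_funM.
  by apply/funext => x /=; rewrite cReV.
rewrite (_ : _ \o _ = (fun x => - (Im (f x) / (Re (f x) ^+ 2 + Im (f x) ^+ 2)))).
  by apply: measurableT_comp => //; exact: measurable_funM.
by apply/funext => x /=; rewrite cImV.
Qed.

Lemma cmeas_if D f g (P : T -> bool) : measurable D -> measurable_fun D P ->
  cmeas D f -> cmeas D g -> cmeas D (fun x => if P x then f x else g x).
Proof.
move=> mD mP [f1 f2] [g1 g2]; split.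
  rewrite (_ : _ \o _ = (fun x => if P x then Re (f x) else Re (g x))).
    by apply: measurable_fun_if => //; [move: f1|move: g1]; apply: measurable_funS => // x [].
  by apply/funext => x /=; case: ifP.
rewrite (_ : _ \o _ = (fun x => if P x then Im (f x) else Im (g x))).
  by apply: measurable_fun_if => //; [move: f2|move: g2]; apply: measurable_funS => // x [].
by apply/funext => x /=; case: ifP.
Qed.

End cmeas.

Lemma cmeas_comp d1 d2 (T1 : measurableType d1) (T2 : measurableType d2)
    (D : set T1) (E : set T2) (f : T2 -> C) (g : T1 -> T2) :
  measurable E -> g @` D `<=` E -> cmeas E f -> measurable_fun D g -> cmeas D (f \o g).
Proof.
move=> mE DE [f1 f2] mg; split.
  apply: (@measurable_comp _ _ _ _ _ _ E (Re \o f) _ g); [exact: mE|exact: DE|exact: f1|exact: mg].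
apply: (@measurable_comp _ _ _ _ _ _ E (Im \o f) _ g); [exact: mE|exact: DE|exact: f2|exact: mg].
Qed.

(** Unlike integrability, domination by a multiple of rho is checked pointwise, and in
    two variables it yields Fubini as soon as the majorant has the form
    rho s * rho t. *)
Definition dominated (f : R -> C) :=
  cmeas I f /\ exists c : R, forall x : R, x \in `]0, 1[ -> normc (f x) <= c * rho x.

Lemma rho_ge0 (x : R) : 0 <= rho x.
Proof. by rewrite mulr_ge0 ?powR_ge0. Qed.

Lemma dominated_integrable f (h : C -> R) : dominated f ->
  measurable_fun I (h \o f) -> (forall x, `|h x| <= normc x) ->
  mu.-integrable I (EFin \o (h \o f)).
Proof.
move=> [_ [c cf]] mh hle.
have [c0 ci] : exists2 c' : R, 0 <= c' & forall x : R, x \in `]0, 1[ -> normc (f x) <= c' * rho x.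
  exists `|c| => // x /cf /le_trans; apply.
  by rewrite ler_wpM2r ?rho_ge0 ?ler_norm.
move=> cH.
apply: (@le_integrable _ _ _ mu I _ _ (EFin \o (fun x => c0 * rho x))) => //.
- exact/measurable_EFinP.
- move=> x /=xI; rewrite lee_fin (le_trans (hle _))// (le_trans (cH x xI))//.
  exact: ler_norm.
- have := integrableZl _ c0 (integrable_rho R).
  by move=> H; exact: H.
Qed.

Lemma dominated_Re f : dominated f -> mu.-integrable I (EFin \o (Re \o f)).
Proof. by move=> df; apply: dominated_integrable => //; [case: df => -[]|exact: normRe]. Qed.

Lemma dominated_Im f : dominated f -> mu.-integrable I (EFin \o (Im \o f)).
Proof. by move=> df; apply: dominated_integrable => //; [case: df => -[]|exact: normIm]. Qed.

Lemma dominatedD f g : dominated f -> dominated g -> dominated (fun x => f x + g x).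
Proof.
move=> [mf [c cf]] [mg [e eg]]; split; first exact: cmeasD.
exists (c + e) => x xI; rewrite mulrDl (le_trans (le_normcD _ _))//.
by rewrite lerD ?cf ?eg.
Qed.

Lemma dominatedZ (k : C) f : dominated f -> dominated (fun x => k * f x).
Proof.
move=> [mf [c cf]]; split; first by apply: cmeasM => //; exact: cmeas_cst.
exists (normc k * c) => x xI; rewrite ComplexField.Normc.normcM -mulrA.
by rewrite ler_wpM2l ?normc_ge0 ?cf.
Qed.

Lemma dominatedB f g : dominated f -> dominated g -> dominated (fun x => f x - g x).
Proof.
move=> df dg; rewrite (_ : (fun _ => _) = (fun x => f x + (-1) * g x)).
  by apply: dominatedD => //; exact: dominatedZ.
by apply/funext => x; rewrite mulN1r.
Qed.

Definition int01 (f : R -> C) : C := Cintegral I f.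

Lemma eq_int01 f g : (forall x : R, x \in `]0, 1[ -> f x = g x) -> int01 f = int01 g.
Proof.
move=> fg; rewrite /int01 /Cintegral; congr Complex;
  by apply: eq_Rintegral => x; rewrite inE/= => /fg ->.
Qed.

Lemma int01D f g : dominated f -> dominated g -> int01 (fun x => f x + g x) = int01 f + int01 g.
Proof.
move=> df dg; apply: complex_eq; rewrite ?cReD ?cImD /=.
  rewrite -RintegralD//; [|exact: dominated_Re..].
  by apply: eq_Rintegral => x _; rewrite cReD.
rewrite -RintegralD//; [|exact: dominated_Im..].
by apply: eq_Rintegral => x _; rewrite cImD.
Qed.

Lemma integrableZ (k : R) (f : R -> R) : mu.-integrable I (EFin \o f) ->
  mu.-integrable I (EFin \o (fun x => k * f x)).
Proof. by move=> If; have := integrableZl _ k If; move=> H; exact: H. Qed.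

Lemma int01Z (k : C) f : dominated f -> int01 (fun x => k * f x) = k * int01 f.
Proof.
move=> df; have If := dominated_Re df; have Jf := dominated_Im df.
apply: complex_eq; rewrite ?cReM ?cImM /=.
  rewrite -!RintegralZl//.
  rewrite -RintegralB//; first by apply: eq_Rintegral => x _; rewrite cReM.
    exact: integrableZ.
  exact: integrableZ.
rewrite -!RintegralZl//.
rewrite -RintegralD//; first by apply: eq_Rintegral => x _; rewrite cImM.
  exact: integrableZ.
exact: integrableZ.
Qed.

Lemma int01B f g : dominated f -> dominated g -> int01 (fun x => f x - g x) = int01 f - int01 g.
Proof.
move=> df dg; rewrite -mulN1r -int01Z// -int01D//; last exact: dominatedZ.
by congr int01; apply/funext => x; rewrite mulN1r.
Qed.

(** Integrals over ]0, x[ are treated as integrals over ]0, 1[ of truncated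
    functions, so that exchanging an inner integral with variable bounds is again an
    exchange on the unit square. *)
Definition trunc (x : R) (f : R -> C) := fun t => if t < x then f t else 0.

Lemma Cintegral_trunc x f : 0 <= x <= 1 -> Cintegral `]0, x[ f = int01 (trunc x f).
Proof.
move=> /andP[x0 x1]; rewrite /int01 /Cintegral.
have E (h : C -> R) : h 0 = 0 -> \int[mu]_(t in `]0, x[) h (f t) =
    \int[mu]_(t in I) h (trunc x f t).
  move=> h0.
  have -> : `]0, x[%classic = I `&` [set t | t < x].
    apply/seteqP; split => t /=; rewrite !in_itv/=.
      by move=> /andP[-> tx]; split => //; exact: lt_le_trans x1.
    by case=> /andP[-> _].
  rewrite Rintegral_mkcondr; apply: eq_Rintegral => t _.
  rewrite patchE /trunc; have [tx|xt] := ltP t x; first by rewrite mem_set.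
  by rewrite memNset //= ltNge xt.
by rewrite !E.
Qed.

End complex_integrals.

(** * Exchange of integrals on the unit square *)

Section fubini.
Variable R : realType.
Local Notation C := R[i].
Local Notation mu := (@lebesgue_measure R).
Local Notation I := (`]0, 1[%classic : set R).
Local Notation normc := (@ComplexField.Normc.normc R).
Local Notation Re := (@complex.Re R).
Local Notation Im := (@complex.Im R).

Lemma measurable_square : measurable (I `*` I).
Proof. by apply: measurableX. Qed.

Section real.
Variables (F : R -> R -> R) (c : R).
Hypothesis mF : measurable_fun (I `*` I) (fun p : R * R => F p.1 p.2).
Hypothesis Fc : forall s t : R, s \in `]0, 1[ -> t \in `]0, 1[ ->
  `|F s t| <= c * (rho s * rho t).

Let f (p : R * R) : \bar R := ((fun p => (F p.1 p.2)%:E) \_ (I `*` I)) p.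

Let mf : measurable_fun setT f.
Proof.
apply/(measurable_restrictT _ measurable_square).
exact/measurable_EFinP.
Qed.

Let r (s : R) : R := (@rho R \_ I) s.

Let r_ge0 s : 0 <= r s.
Proof. by rewrite /r patchE; case: ifP => // _; exact: rho_ge0. Qed.

Let mr : measurable_fun setT r.
Proof.
apply/(measurable_restrictT _ (measurable_itv _)).
by have /measurable_int/measurable_EFinP := integrable_rho R.
Qed.

Let Ir : (\int[mu]_t (r t)%:E < +oo)%E.
Proof.
have /integrableP[_] := integrable_rho R.
rewrite integral_mkcond/=; apply: le_lt_trans.
rewrite le_eqVlt; apply/orP; left; apply/eqP; apply: eq_integral => t _.
rewrite /r !patchE; case: ifP => //= _; by rewrite ger0_norm ?rho_ge0.
Qed.

Let fr s t : (`|f (s, t)| <= (`|c| * r s)%:E * (r t)%:E)%E.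
Proof.
rewrite /f /r !patchE in_setX /=.
have [sI|_] := boolP (s \in I); last by rewrite /= normr0 mulr0 mul0e.
have [tI|_] := boolP (t \in I); last by rewrite /= normr0 mule0.
rewrite /= -EFinM lee_fin -mulrA (le_trans (Fc _ _))//; [exact: set_mem sI|exact: set_mem tI|].
by rewrite ler_wpM2r ?ler_norm// mulr_ge0 ?rho_ge0.
Qed.

Let intr : (0 <= \int[mu]_t (r t)%:E)%E.
Proof. by apply: integral_ge0 => t _; rewrite lee_fin. Qed.

Let intf : (mu \x mu)%E.-integrable setT f.
Proof.
apply/(integrable12ltyP mu mu mf).
apply: (@le_lt_trans _ _ (\int[mu]_s ((`|c| * r s)%:E * \int[mu]_t (r t)%:E))%E).
  apply: ge0_le_integral => //.
  - by move=> s _; exact: integral_ge0.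
  - apply: (@measurable_fun_fubini_tonelli_F _ _ _ _ _ mu (fun p => `|f p|%E)) => //.
    exact: measurableT_comp.
  - apply: emeasurable_funM => //.
    by apply/measurable_EFinP; exact: measurable_funM.
  - move=> s _; rewrite -ge0_integralZl//.
    + apply: ge0_le_integral => //.
      * apply: measurableT_comp => //.
        exact: (measurableT_comp mf (pair1_measurable s)).
      * by apply: emeasurable_funM => //; exact/measurable_EFinP.
    + exact/measurable_EFinP.
    + by move=> t _; rewrite lee_fin.
    + by rewrite lee_fin mulr_ge0.
rewrite ge0_integralZr//.
- under eq_integral do rewrite EFinM.
  rewrite ge0_integralZl//; [|exact/measurable_EFinP|by move=> t _; rewrite lee_fin].
  by rewrite lte_mul_pinfty//; [rewrite mule_ge0// lee_fin|
    rewrite fin_numM// ge0_fin_numE].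
- by apply/measurable_EFinP; exact: measurable_funM.
- by move=> t _; rewrite lee_fin mulr_ge0.
Qed.

(** The square of rho is integrable on the unit square by Tonelli, hence so is F
    extended by zero. *)
Lemma fubini_real : \int[mu]_(s in I) \int[mu]_(t in I) F s t =
  \int[mu]_(t in I) \int[mu]_(s in I) F s t.
Proof.
have fin_inner (g : R -> R) (k : R) : measurable_fun I g ->
    (forall t, t \in `]0, 1[ -> `|g t| <= k * rho t) ->
    (\int[mu]_(t in I) (g t)%:E = (\int[mu]_(t in I) g t)%:E)%E.
  move=> mg gk; rewrite fineK//; apply: integrable_fin_num => //.
  apply: (@le_integrable _ _ _ mu I _ _ (EFin \o (fun x => k * rho x))) => //.
  - exact/measurable_EFinP.
  - by move=> t /= tI; rewrite lee_fin (le_trans (gk _ tI))// ler_norm.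
  - by apply: integrableZ; exact: integrable_rho.
have E1 : (\int[mu]_s \int[mu]_t f (s, t) =
   \int[mu]_(s in I) (\int[mu]_(t in I) F s t)%:E)%E.
  rewrite [RHS]integral_mkcond; apply: eq_integral => s _.
  rewrite patchE; case: ifPn => sI.
    rewrite -(@fin_inner _ (c * rho s)).
    - rewrite [RHS]integral_mkcond; apply: eq_integral => t _.
      by rewrite /f !patchE in_setX /= sI.
    - have := @measurable_comp _ _ _ _ _ _ _ _ I (pair s) measurable_square _ mF.
      apply; last by apply: measurable_funTS; exact: pair1_measurable.
      by move=> _ [t tI <-]; split => //; exact: set_mem sI.
    - move=> t tI; rewrite -mulrA; apply: Fc => //; exact: set_mem sI.
  rewrite integral0_eq// => t _.
  by rewrite /f patchE in_setX /= (negbTE sI).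
have E2 : (\int[mu]_t \int[mu]_s f (s, t) =
   \int[mu]_(t in I) (\int[mu]_(s in I) F s t)%:E)%E.
  rewrite [RHS]integral_mkcond; apply: eq_integral => t _.
  rewrite patchE; case: ifPn => tI.
    rewrite -(@fin_inner _ (c * rho t)).
    - rewrite [RHS]integral_mkcond; apply: eq_integral => s _.
      by rewrite /f !patchE in_setX /= tI andbT.
    - have := @measurable_comp _ _ _ _ _ _ _ _ I (pair^~ t) measurable_square _ mF.
      apply; last by apply: measurable_funTS; exact: pair2_measurable.
      by move=> _ [s sI <-]; split => //; exact: set_mem tI.
    - move=> s sI; rewrite -mulrA [rho t * _]mulrC; apply: Fc => //; exact: set_mem tI.
  rewrite integral0_eq// => s _.
  by rewrite /f patchE in_setX /= (negbTE tI) andbF.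
by rewrite /Rintegral -E1 -E2; congr fine; exact: Fubini.
Qed.
End real.

Lemma fubini_int01 (F : R -> R -> C) (c : R) :
  cmeas (I `*` I) (fun p : R * R => F p.1 p.2) ->
  (forall s t : R, s \in `]0, 1[ -> t \in `]0, 1[ ->
    normc (F s t) <= c * (rho s * rho t)) ->
  int01 (fun s => int01 (F s)) = int01 (fun t => int01 (F ^~ t)).
Proof.
move=> [mF1 mF2] Fc; apply: complex_eq.
  rewrite /int01 /Cintegral /=; apply: (fubini_real (c := c)) => // s t sI tI.
  by rewrite (le_trans (normRe _))// Fc.
rewrite /int01 /Cintegral /=; apply: (fubini_real (c := c)) => // s t sI tI.
by rewrite (le_trans (normIm _))// Fc.
Qed.

End fubini.

(** * Calculus of complex functions of a real variable *)

Section complex_calculus.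
Variable R : realType.
Local Notation C := R[i].
Local Notation mu := (@lebesgue_measure R).
Local Notation I := (`]0, 1[%classic : set R).
Local Notation normc := (@ComplexField.Normc.normc R).
Local Notation Re := (@complex.Re R).
Local Notation Im := (@complex.Im R).

(** Componentwise, so that the real theorems on integrals apply to each component. *)
Definition cder (F : R -> C) (f : C) (x : R) :=
  is_derive x 1 (Re \o F) (Re f) /\ is_derive x 1 (Im \o F) (Im f).

Definition ccont (f : R -> C) (x : R) :=
  {for x, continuous (Re \o f)} /\ {for x, continuous (Im \o f)}.

Lemma cder_cont F f x : cder F f x -> ccont F x.
Proof. by move=> [d1 d2]; split; [exact: is_derive_continuous d1|exact: is_derive_continuous d2]. Qed.

Lemma cder_cst (c : C) x : cder (fun=> c) 0 x.
Proof. by split; exact: is_derive_cst. Qed.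

Lemma cder_real (g : R -> R) (g' x : R) : is_derive x 1 g g' ->
  cder (fun x => (g x)%:C%C) (g'%:C%C) x.
Proof. by move=> dg; split => //; exact: is_derive_cst. Qed.

Lemma cderD F f G g x : cder F f x -> cder G g x -> cder (fun x => F x + G x) (f + g) x.
Proof.
move=> [f1 f2] [g1 g2]; split.
  rewrite (_ : _ \o _ = (Re \o F) + (Re \o G)) ?cReD; first exact: is_deriveD.
  by apply/funext => y /=; rewrite cReD.
rewrite (_ : _ \o _ = (Im \o F) + (Im \o G)) ?cImD; first exact: is_deriveD.
by apply/funext => y /=; rewrite cImD.
Qed.

Lemma cderM F f G g x : cder F f x -> cder G g x ->
  cder (fun x => F x * G x) (f * G x + F x * g) x.
Proof.
move=> [f1 f2] [g1 g2]; split.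
  rewrite (_ : _ \o _ = (Re \o F) * (Re \o G) - (Im \o F) * (Im \o G)); last first.
    by apply/funext => y /=; rewrite cReM.
  apply: (@is_derive_eq _ _ _ _ _ _ _ _
    (is_deriveB (is_deriveM f1 g1) (is_deriveM f2 g2))).
  by rewrite cReD !cReM /= /GRing.scale/=; ring.
rewrite (_ : _ \o _ = (Re \o F) * (Im \o G) + (Im \o F) * (Re \o G)); last first.
  by apply/funext => y /=; rewrite cImM.
apply: (@is_derive_eq _ _ _ _ _ _ _ _
  (is_deriveD (is_deriveM f1 g2) (is_deriveM f2 g1))).
by rewrite cImD !cImM /= /GRing.scale/=; ring.
Qed.

Lemma sqnorm_neq0 (z : C) : z != 0 -> Re z ^+ 2 + Im z ^+ 2 != 0.
Proof.
case: z => a b /=; apply: contra_neq => /eqP.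
by rewrite paddr_eq0 ?sqr_ge0// !sqrf_eq0 => /andP[/eqP -> /eqP ->].
Qed.

Lemma cderV F f x : F x != 0 -> cder F f x -> cder (fun x => (F x)^-1) (- f / F x ^+ 2) x.
Proof.
move=> Fx0 [f1 f2].
have n0 : ((Re \o F) * (Re \o F) + (Im \o F) * (Im \o F)) x != 0.
  by rewrite !fctE -!expr2 sqnorm_neq0.
have dn := is_deriveV n0 (is_deriveD (is_deriveM f1 f1) (is_deriveM f2 f2)).
have n1 := sqnorm_neq0 Fx0.
have n2 : (F x ^+ 2) != 0 by rewrite expf_neq0.
have n3 := sqnorm_neq0 n2; rewrite expr2 cReM cImM in n3.
split.
  rewrite (_ : _ \o _ = (Re \o F) * (fun y => (((Re \o F) * (Re \o F) + (Im \o F) * (Im \o F)) y)^-1)); last first.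
    by apply/funext => y /=; rewrite cReV !fctE !expr2.
  apply: (@is_derive_eq _ _ _ _ _ _ _ _ (is_deriveM f1 dn)).
  rewrite !fctE/= /GRing.scale/= cReM cReV cImV !cReN !cImN [F x ^+ 2]expr2 cReM cImM.
  by field; rewrite -?expr2; apply/andP; split.
rewrite (_ : _ \o _ = - ((Im \o F) * (fun y => (((Re \o F) * (Re \o F) + (Im \o F) * (Im \o F)) y)^-1))); last first.
  by apply/funext => y /=; rewrite cImV !fctE !expr2.
apply: (@is_derive_eq _ _ _ _ _ _ _ _ (is_deriveN (is_deriveM f2 dn))).
rewrite !fctE/= /GRing.scale/= cImM cReV cImV !cReN !cImN [F x ^+ 2]expr2 cReM cImM.
by field; rewrite -?expr2; apply/andP; split.
Qed.

Lemma cder_eq F f g x : f = g -> cder F f x -> cder F g x.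
Proof. by move=> ->. Qed.

Lemma ccontM f g x : ccont f x -> ccont g x -> ccont (fun x => f x * g x) x.
Proof.
move=> [f1 f2] [g1 g2]; split.
  rewrite /comp (_ : (fun _ => _) = (fun x => Re (f x) * Re (g x) - Im (f x) * Im (g x))).
    by apply: continuousB; exact: continuousM.
  by apply/funext => y /=; rewrite cReM.
rewrite /comp (_ : (fun _ => _) = (fun x => Re (f x) * Im (g x) + Im (f x) * Re (g x))).
  by apply: continuousD; exact: continuousM.
by apply/funext => y /=; rewrite cImM.
Qed.

Lemma ccont_real (f : R -> R) x : {for x, continuous f} -> ccont (fun x => (f x)%:C%C) x.
Proof. by move=> cf; split => //; exact: cst_continuous. Qed.

Lemma cmeas_ccont (D : set R) f : open D -> (forall x, D x -> ccont f x) -> cmeas D f.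
Proof.
move=> oD cf; split; apply: open_continuous_measurable_fun => // x /[!inE];
  by move=> /cf[].
Qed.

Definition window (a b : R) (f : R -> C) := fun t => if a < t < b then f t else 0.

Lemma Rintegral_window a b (f : R -> C) (h : C -> R) : h 0 = 0 -> 0 <= a -> b <= 1 ->
  \int[mu]_(t in I) h (window a b f t) = \int[mu]_(t in `]a, b[) h (f t).
Proof.
move=> h0 a0 b1.
have -> : `]a, b[%classic = I `&` [set t : R | a < t < b].
  apply/seteqP; split => t /=; rewrite !in_itv/=; last by case.
  move=> /andP[ta tb]; split; last by rewrite ta.
  by rewrite (le_lt_trans a0)//= (lt_le_trans tb).
rewrite Rintegral_mkcondr; apply: eq_Rintegral => t _.
rewrite patchE /window; case: ifPn => atb; first by rewrite mem_set.
by rewrite memNset //=; exact/negP.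
Qed.

Lemma ftc_int01 (F f : R -> C) a b : 0 <= a -> a <= b -> b <= 1 ->
  (forall x : R, a <= x <= b -> cder F (f x) x) ->
  (forall x : R, a <= x <= b -> ccont f x) ->
  int01 (window a b f) = F b - F a.
Proof.
move=> a0 ab b1 dF cf; rewrite /int01 /Cintegral.
have E (h : C -> R) : h 0 = 0 ->
    (forall x : R, a <= x <= b -> is_derive x 1 (h \o F) (h (f x))) ->
    (forall x : R, a <= x <= b -> {for x, continuous (h \o f)}) ->
    \int[mu]_(t in I) h (window a b f t) = h (F b) - h (F a).
  move=> h0 dh ch; rewrite Rintegral_window//.
  rewrite -[RHS]/((h \o F) b - (h \o F) a).
  have ih : mu.-integrable `[a, b] (EFin \o (h \o f)).
    apply: continuous_compact_integrable; first exact: segment_compact.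
    by apply: continuous_in_subspaceT => x /[!inE]/=; rewrite in_itv/= => /ch.
  have ih' : mu.-integrable `]a, b[ (EFin \o (h \o f)).
    by apply: integrableS ih => //; exact: subset_itv_oo_cc.
  have := @FTC_oo _ (h \o f) (h \o F) a b ab ih'; apply.
  - by move=> x /subset_itv_oo_cc; rewrite in_itv/=; exact: ch.
  - apply: continuous_in_subspaceT => x /[!inE]/=; rewrite in_itv/= => /dh.
    exact: is_derive_continuous.
  - by move=> x /subset_itv_oo_cc; rewrite in_itv/=; exact: dh.
apply: complex_eq => /=; rewrite ?cReD ?cImD ?cReN ?cImN.
  by apply: E => // x /[dup] /dF[? ?] /cf[].
by apply: E => // x /[dup] /dF[? ?] /cf[].
Qed.

Lemma Rintegral_trunc t (f : R -> C) (h : C -> R) : h 0 = 0 -> 0 <= t <= 1 ->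
  \int[mu]_(x in I) h (trunc t f x) = \int[mu]_(x in `]0, t[) h (f x).
Proof.
move=> h0 /andP[t0 t1]; rewrite -(@Rintegral_window 0 t f h)//.
apply: eq_Rintegral => x; rewrite inE/= in_itv/= => /andP[x0 _].
by rewrite /trunc /window x0.
Qed.

Section substitution.
Variables (f : R -> C) (phi dphi : R -> R) (t : R).
Hypotheses (t01 : 0 < t <= 1) (df : dominated (trunc t f)).
Hypothesis cf : forall x : R, 0 < x < t -> ccont f x.
Hypothesis phic : forall x : R, 0 <= x <= 1 -> 0 <= phi x <= t.
Hypothesis phio : forall x : R, 0 < x < 1 -> 0 < phi x < t.
Hypothesis dphiP : forall x : R, 0 <= x <= 1 -> is_derive x 1 phi (dphi x).
Hypothesis cdphi : forall x : R, 0 < x < 1 -> {for x, continuous dphi}.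
Hypothesis dfphi : dominated (fun x => f (phi x) * (dphi x)%:C%C).

Let subst (h : C -> R) : h 0 = 0 -> (forall x, `|h x| <= normc x) ->
  (forall (z : C) (x : R), h (z * x%:C%C) = h z * x) ->
  (measurable_fun I (h \o trunc t f)) ->
  (measurable_fun I (h \o (fun x => f (phi x) * (dphi x)%:C%C))) ->
  (forall x : R, 0 < x < t -> {for x, continuous (h \o f)}) ->
  \int[mu]_(x in I) h (f (phi x) * (dphi x)%:C%C) =
    \int[mu]_(x in `[0, phi 1]) h (f x) - \int[mu]_(x in `[0, phi 0]) h (f x).
Proof.
move=> h0 hle hM mh mh' ch.
move: t01 => /andP[t0 t1].
under eq_Rintegral do rewrite hM.
have ih : mu.-integrable I (EFin \o (h \o trunc t f)) by exact: dominated_integrable.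
have ih' : mu.-integrable I (EFin \o (h \o (fun x => f (phi x) * (dphi x)%:C%C))).
  exact: dominated_integrable.
apply: (@substitution_oo _ (h \o f) phi dphi 0 t (ltW t0)).
- have : mu.-integrable `]0, t[ (EFin \o (h \o trunc t f)).
    apply: integrableS ih => // x /=; rewrite !in_itv/= => /andP[-> xt].
    exact: lt_le_trans t1.
  apply: eq_integrable => // x /[!inE]/=; rewrite in_itv/= => /andP[_ xt].
  by rewrite /trunc xt.
- by move=> x; rewrite in_itv/=; exact: ch.
- apply: continuous_in_subspaceT => x /[!inE]/=; rewrite in_itv/= => /dphiP.
  exact: is_derive_continuous.
- by move=> x; rewrite !in_itv/=; exact: phic.
- by move=> x; rewrite !in_itv/=; exact: phio.
- move=> x /subset_itv_oo_cc; rewrite in_itv/=; exact: dphiP.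
- by move=> x; rewrite in_itv/=; exact: cdphi.
- by move: ih'; apply: eq_integrable => // x _ /=; rewrite hM.
Qed.

Let h0_itv (h : C -> R) : \int[mu]_(x in `[0, 0]) h (f x) = 0.
Proof. by rewrite set_itv1 Rintegral_set1. Qed.

Let ht_itv (h : C -> R) : h 0 = 0 -> measurable_fun I (h \o trunc t f) ->
  \int[mu]_(x in `[0, t]) h (f x) = \int[mu]_(x in I) h (trunc t f x).
Proof.
move=> h0 mh; move: t01 => /andP[t0 t1].
rewrite Rintegral_trunc ?(ltW t0)//.
rewrite /Rintegral integral_itv_bndoo//; apply/measurable_EFinP.
have : measurable_fun `]0, t[ (h \o trunc t f).
  apply: measurable_funS mh => // x /=; rewrite !in_itv/= => /andP[-> xt].
  exact: lt_le_trans t1.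
by apply: eq_measurable_fun => x /[!inE]/=; rewrite in_itv/= /trunc => /andP[_ ->].
Qed.

Let ReMr (z : C) (x : R) : Re (z * x%:C%C) = Re z * x.
Proof. by rewrite cReM /= mulr0 subr0. Qed.
Let ImMr (z : C) (x : R) : Im (z * x%:C%C) = Im z * x.
Proof. by rewrite cImM /= mulr0 add0r. Qed.

Lemma substitution_increasing : phi 0 = 0 -> phi 1 = t ->
  int01 (fun x => f (phi x) * (dphi x)%:C%C) = int01 (trunc t f).
Proof.
move=> phi0 phi1; have [[m1 m2] _] := df; have [[m1' m2'] _] := dfphi.
apply: complex_eq; rewrite /int01 /Cintegral /=.
  rewrite subst// ?phi0 ?phi1 ?h0_itv ?ht_itv ?subr0//; first exact: normRe.
  by move=> x /cf[].
rewrite subst// ?phi0 ?phi1 ?h0_itv ?ht_itv ?subr0//; first exact: normIm.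
by move=> x /cf[].
Qed.

(** Here phi reverses the orientation, whence the sign. *)
Lemma substitution_decreasing : phi 0 = t -> phi 1 = 0 ->
  int01 (fun x => f (phi x) * (dphi x)%:C%C) = - int01 (trunc t f).
Proof.
move=> phi0 phi1; have [[m1 m2] _] := df; have [[m1' m2'] _] := dfphi.
apply: complex_eq; rewrite /int01 /Cintegral /=.
  rewrite subst// ?phi0 ?phi1 ?h0_itv ?ht_itv ?sub0r//; first exact: normRe.
  by move=> x /cf[].
rewrite subst// ?phi0 ?phi1 ?h0_itv ?ht_itv ?sub0r//; first exact: normIm.
by move=> x /cf[].
Qed.

End substitution.

End complex_calculus.

(** * Powers of the logarithm compared with the weight *)

Section bounds.
Variable R : realType.
Local Notation rho := (@rho R).
Implicit Types (x y p q : R).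

Lemma powRN_anti p x y : 0 <= p -> 0 < x -> x <= y -> y `^ (- p) <= x `^ (- p).
Proof.
move=> p0 x0 xy; have y0 := lt_le_trans x0 xy.
rewrite !powRN lef_pV2 ?posrE ?powR_gt0//.
by apply: ge0_ler_powR; rewrite // nnegrE ltW.
Qed.

Lemma powRN_ge1 p x : 0 <= p -> 0 < x <= 1 -> 1 <= x `^ (- p).
Proof.
move=> p0 /andP[x0 x1].
have := powRN_anti p0 x0 x1; by rewrite powR1.
Qed.

Lemma powRN_le p q x : p <= q -> 0 < x <= 1 -> x `^ (- p) <= x `^ (- q).
Proof. by move=> pq x01; apply: ger_powR => //; rewrite lerN2. Qed.

Lemma rho_dom p q x : p <= 3 / 4 -> q <= 3 / 4 -> 0 < x < 1 ->
  x `^ (- p) * (1 - x) `^ (- q) <= rho x.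
Proof.
move=> p0 q0 /andP[x0 x1]; apply: ler_pM; rewrite ?powR_ge0//.
  by apply: powRN_le => //; rewrite x0 ltW.
by apply: powRN_le => //; apply/andP; lra.
Qed.

Lemma rho_doml p x : p <= 3 / 4 -> 0 < x < 1 -> x `^ (- p) <= rho x.
Proof.
move=> p0 x01; apply: le_trans (@rho_dom p 0 x p0 _ x01); last by lra.
by rewrite oppr0 powRr0 mulr1.
Qed.

Lemma rho_domr p x : p <= 3 / 4 -> 0 < x < 1 -> (1 - x) `^ (- p) <= rho x.
Proof.
move=> p0 x01; apply: le_trans (@rho_dom 0 p x _ p0 x01); last by lra.
by rewrite oppr0 powRr0 mul1r.
Qed.

Lemma rho_ge1 x : 0 < x < 1 -> 1 <= rho x.
Proof.
move=> x01; apply: le_trans (@rho_doml 0 x _ x01); last by lra.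
by rewrite oppr0 powRr0.
Qed.

(** The divided power y^n / n!, whose derivative is the previous one. *)
Definition divpow (n : nat) (y : R) : R := y ^+ n / n`!%:R.

Lemma oppr_ln_ge0 x : 0 < x <= 1 -> 0 <= - ln x.
Proof. by move=> /andP[x0 x1]; rewrite oppr_ge0 ln_le0. Qed.

(** This is 1 + y <= exp y at y = - p ln x, together with x^(1-p) <= 1. The factor
    1 - x keeps track of the zero of the logarithm at 1, needed to compensate poles
    there. *)
Lemma oppr_ln_le p x : 0 < p <= 1 -> 0 < x <= 1 ->
  - ln x <= p^-1 * ((1 - x) * x `^ (- p)).
Proof.
move=> /andP[p0 p1] /andP[x0 x1]; rewrite ler_pdivlMl//.
rewrite mulrBl mul1r.
have -> : x * x `^ (- p) = x `^ (1 - p).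
  by rewrite -{1}(powRr1 (ltW x0)) -powRD//; apply/implyP => _; rewrite gt_eqF.
have : x `^ (1 - p) <= 1.
  by rewrite -[leRHS](powRr0 x); apply: ger_powR; [rewrite x0|lra].
have : 1 + - p * ln x <= x `^ (- p).
  by rewrite /powR gt_eqF//; exact: expR_ge1Dx.
lra.
Qed.

Lemma divpow_ge0 n y : 0 <= y -> 0 <= divpow n y.
Proof. by move=> y0; rewrite /divpow divr_ge0 ?exprn_ge0. Qed.

(** The n-th power of [oppr_ln_le] for the exponent p = 1/(4n). *)
Lemma divpow_bound n : exists2 c : R, 0 <= c & forall x, 0 < x <= 1 ->
  divpow n (- ln x) <= c * ((1 - x) ^+ n * x `^ (- (1 / 4))).
Proof.
have [->|n0] := posnP n.
  exists 1 => // x x01; rewrite /divpow !expr0 fact0 invr1 !mul1r.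
  by apply: powRN_ge1 => //; lra.
have nR : 0 < n%:R :> R by rewrite ltr0n.
(* With this exponent the n-th power of x^(-p) is x^(-1/4). *)
pose p : R := (4 * n%:R)^-1.
have p0 : 0 < p by rewrite invr_gt0 mulr_gt0.
have p1 : p <= 1.
  rewrite invf_le1 ?mulr_gt0//.
  have : 1 <= n%:R :> R by rewrite ler1n.
  lra.
exists (p^-1 ^+ n); first by rewrite exprn_ge0// invr_ge0 ltW.
move=> x x01; have l0 := oppr_ln_ge0 x01.
have -> : x `^ (- (1 / 4)) = (x `^ (- p)) ^+ n.
  rewrite -powR_mulrn ?powR_ge0// -powRrM; congr (_ `^ _).
  by rewrite /p; field; rewrite gt_eqF.
rewrite -!exprMn; apply: (@le_trans _ _ ((- ln x) ^+ n)).
  rewrite /divpow ler_pdivrMr ?ltr0n ?fact_gt0//.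
  by rewrite ler_peMr ?exprn_ge0// ler1n fact_gt0.
by rewrite ler_pXn2r ?nnegrE// ?(oppr_ln_le _ x01) ?p0//
  mulr_ge0 ?invr_ge0 ?mulr_ge0 ?powR_ge0 ?(ltW p0)//; case/andP: x01; lra.
Qed.

Lemma divpow_bound0 n : exists2 c : R, 0 <= c & forall x, 0 < x <= 1 ->
  divpow n (- ln x) <= c * x `^ (- (1 / 4)).
Proof.
have [c c0 H] := divpow_bound n; exists c => // x /[dup] x01 /andP[x0 x1].
rewrite (le_trans (H x x01))// ler_wpM2l// ler_piMl ?powR_ge0//.
by rewrite exprn_ile1//; lra.
Qed.

Lemma divpow_boundS n : exists2 c : R, 0 <= c & forall x, 0 < x <= 1 ->
  divpow n.+1 (- ln x) <= c * ((1 - x) * x `^ (- (1 / 4))).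
Proof.
have [c c0 H] := divpow_bound n.+1; exists c => // x /[dup] x01 /andP[x0 x1].
rewrite (le_trans (H x x01))// ler_wpM2l// ler_wpM2r ?powR_ge0//.
by rewrite exprS ler_piMr ?exprn_ile1//; lra.
Qed.

Lemma is_derive_divpowS n y : is_derive y 1 (divpow n.+1) (divpow n y).
Proof.
have d := is_deriveZ (n.+1)`!%:R^-1 (is_deriveX n.+1 (@is_derive_id _ _ y 1)).
have -> : divpow n.+1 = (n.+1)`!%:R^-1 \*: (id ^+ n.+1).
  by apply/funext => x; rewrite /divpow mulrC /= exprfctE.
apply: (@is_derive_eq _ _ _ _ _ _ _ _ d).
rewrite /GRing.scale/= /divpow factS natrM mulr1.
have H : n.+1%:R != 0 :> R by rewrite pnatr_eq0.
have H' : n`!%:R != 0 :> R by rewrite pnatr_eq0 -lt0n fact_gt0.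
by field; rewrite -natr1 in H; apply/andP; split.
Qed.

Lemma is_derive_divpow_ln n x : 0 < x ->
  is_derive x 1 (fun x => divpow n.+1 (- ln x)) (- (divpow n (- ln x) / x)).
Proof.
move=> x0.
have dl := is_deriveN (is_derive1_ln x0).
have := @is_derive1_comp _ (divpow n.+1) (fun x => - ln x) x _ _ (is_derive_divpowS n _) dl.
by move=> H; apply: (@is_derive_eq _ _ _ _ _ _ _ _ H); rewrite mulrN.
Qed.

Lemma divpow_continuous n y : {for y, continuous (divpow n)}.
Proof.
case: n => [|n]; last exact: is_derive_continuous (is_derive_divpowS n y).
rewrite /divpow (_ : (fun _ => _) = cst (1 / 0`!%:R)) ; first exact: cst_continuous.
by apply/funext => x; rewrite expr0.
Qed.

Lemma measurable_divpow n : measurable_fun [set: R] (divpow n).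
Proof. by apply: continuous_measurable_fun => x; exact: divpow_continuous. Qed.

End bounds.

(** * Polylogarithmic integrals and their recursion *)

Section polylog.
Variable R : realType.
Local Notation C := R[i].
Local Notation I := (`]0, 1[%classic : set R).
Local Notation normc := (@ComplexField.Normc.normc R).
Local Notation "x %:c" := (real_complex_def (Phant R) x) (at level 1, format "x %:c").

Lemma realcM (x y : R) : (x * y)%:c = x%:c * y%:c. Proof. exact: rmorphM. Qed.
Lemma realcD (x y : R) : (x + y)%:c = x%:c + y%:c. Proof. exact: rmorphD. Qed.
Lemma realcB (x y : R) : (x - y)%:c = x%:c - y%:c. Proof. exact: rmorphB. Qed.
Lemma realcN (x : R) : (- x)%:c = - x%:c. Proof. exact: rmorphN. Qed.
Lemma realcV (x : R) : (x^-1)%:c = x%:c^-1. Proof. exact: fmorphV. Qed.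
Lemma realc0 : (0 : R)%:c = 0. Proof. by []. Qed.
Lemma realc1 : (1 : R)%:c = 1. Proof. by []. Qed.
Lemma realc_eq0 (x : R) : (x%:c == 0) = (x == 0).
Proof. by rewrite eq_complex /= eqxx andbT. Qed.
Definition realcE := (realcM, realcD, realcB, realcN, realcV, realc0, realc1).

Variables (w : C) (d : R).
Hypothesis d0 : 0 < d.
Hypothesis hd : forall t : R, 0 <= t <= 1 -> d <= normc (1 - t%:c * w).

Definition Delta (a b : R) : C := 1 - b%:c * w - a%:c * b%:c * (1 - w).

Lemma one_sub_neq0 (t : R) : 0 <= t <= 1 -> 1 - t%:c * w != 0.
Proof. by move=> /hd; rewrite -normc_gt0; apply: lt_le_trans. Qed.

Lemma one_sub_w_neq0 : 1 - w != 0.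
Proof. by have := @one_sub_neq0 1; rewrite realc1 mul1r; apply; rewrite ler01 lexx. Qed.

Lemma DeltaE (a b : R) : 1 - a * b != 0 ->
  Delta a b = (1 - a * b)%:c * (1 - (b * (1 - a) / (1 - a * b))%:c * w).
Proof.
move=> ab; rewrite /Delta !realcE; field.
by rewrite -realcM -realc1 -realcB realc_eq0.
Qed.

(** For alpha beta <> 1, Delta is 1 - alpha beta times 1 - s w, where
    s = beta (1 - alpha)/(1 - alpha beta) lies between 0 and 1 ([DeltaE]); the distance
    from 1/w to the segment bounds the second factor below. *)
Lemma Delta_ge (a b : R) : 0 <= a <= 1 -> 0 <= b <= 1 ->
  d * (1 - a * b) <= normc (Delta a b).
Proof.
move=> /andP[a0 a1] /andP[b0 b1].
have ab1 : a * b <= 1 by rewrite mulr_ile1.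
have [->|ab] := eqVneq (1 - a * b) 0; first by rewrite mulr0 normc_ge0.
have ab0 : 0 < 1 - a * b by rewrite lt_def ab subr_ge0.
rewrite DeltaE// ComplexField.Normc.normcM normc_real ger0_norm ?(ltW ab0)// mulrC.
rewrite ler_wpM2l ?(ltW ab0)// hd// divr_ge0 ?(ltW ab0) ?mulr_ge0 ?subr_ge0//=.
by rewrite ler_pdivrMr// mul1r; nra.
Qed.

Lemma Delta_neq0 (a b : R) : 0 <= a <= 1 -> 0 <= b <= 1 -> a * b < 1 -> Delta a b != 0.
Proof.
move=> ha hb ab; rewrite -normc_gt0; apply: lt_le_trans (Delta_ge ha hb).
by rewrite mulr_gt0// subr_gt0.
Qed.

Lemma cder_id (x : R) : cder (fun x : R => x%:c) 1 x.
Proof. exact: cder_real. Qed.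

Lemma cder_Delta_r a b : cder (Delta a) (- w - a%:c * (1 - w)) b.
Proof.
rewrite /Delta; apply: cder_eq; last first.
  apply: cderD.
    apply: cderD; first exact: cder_cst.
    rewrite (_ : (fun _ => _) = (fun b : R => b%:c * (- w))); last by apply/funext => x; rewrite mulrN.
    exact: cderM (cder_id b) (cder_cst _ _).
  rewrite (_ : (fun _ => _) = (fun b : R => b%:c * (- a%:c * (1 - w)))); last first.
    by apply/funext => x; ring.
  exact: cderM (cder_id b) (cder_cst _ _).
by rewrite /=; ring.
Qed.

Lemma cder_Delta_l a b : cder (Delta ^~ b) (- b%:c * (1 - w)) a.
Proof.
rewrite /Delta; apply: cder_eq; last first.
  apply: cderD; first exact: cder_cst.
  rewrite (_ : (fun _ => _) = (fun a : R => a%:c * (- b%:c * (1 - w)))); last first.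
    by apply/funext => x; ring.
  exact: cderM (cder_id a) (cder_cst _ _).
by rewrite /=; ring.
Qed.

Lemma cder_Delta_quot_r (a b : R) : Delta a b != 0 ->
  cder (fun b : R => b%:c * (1 - w) / Delta a b) ((1 - w) / Delta a b ^+ 2) b.
Proof.
move=> Dn0; apply: cder_eq; last first.
  apply: cderM (cderV Dn0 (cder_Delta_r a b)).
  exact: cderM (cder_id b) (cder_cst _ _).
have := Dn0; rewrite /Delta => ?; field.
by [].
Qed.

Lemma cder_Delta_quot_l (a b : R) : Delta a b != 0 ->
  cder (fun a : R => a%:c / Delta a b) ((1 - b%:c * w) / Delta a b ^+ 2) a.
Proof.
move=> Dn0; apply: cder_eq; last exact: cderM (cder_id a) (@cderV _ (Delta ^~ b) _ _ Dn0 (cder_Delta_l a b)).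
by have := Dn0; rewrite /Delta => ?; field.
Qed.

Lemma ccont_Delta2_r (k : C) a b : Delta a b != 0 -> ccont (fun b => k / Delta a b ^+ 2) b.
Proof.
move=> Dn0; have c1 := cderV Dn0 (cder_Delta_r a b).
rewrite (_ : (fun _ => _) = (fun b => k * ((Delta a b)^-1 * (Delta a b)^-1))).
  by apply: cder_cont (cderM (cder_cst k b) (cderM c1 c1)).
by apply/funext => x; rewrite -invfM expr2.
Qed.

Lemma ccont_Delta2_l (k : C) a b : Delta a b != 0 -> ccont (fun a => k / Delta a b ^+ 2) a.
Proof.
move=> Dn0; have c1 := @cderV _ (Delta ^~ b) _ _ Dn0 (cder_Delta_l a b).
rewrite (_ : (fun _ => _) = (fun a => k * ((Delta a b)^-1 * (Delta a b)^-1))).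
  by apply: cder_cont (cderM (cder_cst k a) (cderM c1 c1)).
by apply/funext => x; rewrite -invfM expr2.
Qed.

Definition logpow n (a : R) : R := divpow n (- ln a).
(** For w = 0 this is the polylogarithm Li_(n+1)(b). *)
Definition polylog n (b : R) : C := int01 (fun a => (logpow n a)%:c * (b%:c * (1 - w) / Delta a b)).

Lemma measurable_logpow n : measurable_fun [set: R] (logpow n).
Proof.
apply: (measurableT_comp (measurable_divpow (R:=R) n) _).
by apply: measurableT_comp => //; exact: measurable_ln.
Qed.

Lemma cmeas_Delta dd (T : measurableType dd) (D : set T) (f g : T -> R) :
  measurable_fun D f -> measurable_fun D g -> cmeas D (fun x => Delta (f x) (g x)).
Proof.
move=> mf mg; rewrite /Delta.
apply: cmeasB; first (apply: cmeasB; first exact: cmeas_cst).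
  by apply: cmeasM; [exact: cmeas_real|exact: cmeas_cst].
apply: cmeasM; last exact: cmeas_cst.
by apply: cmeasM; exact: cmeas_real.
Qed.

Lemma int01_window0 (b : R) f : int01 (window 0 b f) = int01 (trunc b f).
Proof.
apply: eq_int01 => x; rewrite in_itv/= => /andP[x0 _].
by rewrite /window /trunc x0.
Qed.

Lemma int01_trunc1 (f : R -> C) : int01 (trunc 1 f) = int01 f.
Proof. by apply: eq_int01 => x; rewrite in_itv/= => /andP[_ x1]; rewrite /trunc x1. Qed.

Lemma int01_0 : int01 (fun=> 0 : C) = 0.
Proof. by rewrite /int01 /Cintegral/= Rintegral_cst// mul0r. Qed.

Lemma logpow_ge0 n (a : R) : 0 < a < 1 -> 0 <= logpow n a.
Proof. by move=> /andP[a0 a1]; apply/divpow_ge0/oppr_ln_ge0; rewrite a0 ltW. Qed.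

(** Since 1 - a c is at least 1 - a and at least 1 - c, the exponent 2 may be shared
    between them. The share 5/4 of 1 - a is not integrable by itself; the zero of
    ln a at a = 1 makes up for it. *)
Lemma inv_sq_bound (a c : R) : 0 < a < 1 -> 0 < c < 1 ->
  (1 - a * c) ^- 2 <= (1 - a) `^ (- (5 / 4)) * (1 - c) `^ (- (3 / 4)).
Proof.
move=> /andP[a0 a1] /andP[c0 c1].
have ac : 0 < 1 - a * c by nra.
have -> : (1 - a * c) ^- 2 = (1 - a * c) `^ (- (5 / 4)) * (1 - a * c) `^ (- (3 / 4)).
  rewrite -powRD; last by apply/implyP => _; rewrite gt_eqF.
  by rewrite -powR_invn ?(ltW ac)//; congr (_ `^ _); lra.
by rewrite ler_pM ?powR_ge0// powRN_anti//; try lra; nra.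
Qed.

(** The integrand of [polylog] is the integral over 0 < c < b of its derivative in b,
    and the two integrals are exchanged. For n = 0 there is no logarithm to absorb the
    singularity at a = c = 1, hence the condition b < 1. *)
Lemma polylog_double n (b : R) : 0 <= b <= 1 -> (0 < n)%N || (b < 1) ->
  polylog n b = int01 (trunc b (fun c => int01 (fun a => (logpow n a)%:c * ((1 - w) / Delta a c ^+ 2)))).
Proof.
move=> /andP[b0 b1] nb.
pose F a := trunc b (fun c => (logpow n a)%:c * ((1 - w) / Delta a c ^+ 2)).
transitivity (int01 (fun a => int01 (F a))).
  apply: eq_int01 => a; rewrite in_itv/= => /andP[a0 a1].
  rewrite -int01_window0.
  have Dn0 x : 0 <= x <= b -> Delta a x != 0.
    move=> /andP[x0 xb]; apply: Delta_neq0; rewrite ?(ltW a0) ?(ltW a1) ?x0//.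
      exact: le_trans b1.
    by nra.
  rewrite (@ftc_int01 _ (fun c => (logpow n a)%:c * (c%:c * (1 - w) / Delta a c)))//.
  - by rewrite realc0 !mul0r mulr0 subr0.
  - move=> x /Dn0 Dx; apply: cder_eq; last exact: cderM (cder_cst _ x) (cder_Delta_quot_r Dx).
    by rewrite mul0r add0r.
  - move=> x /Dn0 Dx; apply: ccontM; first exact: cder_cont (cder_cst _ x).
    exact: ccont_Delta2_r.
(* If n = 0 then c < b < 1 bounds the denominator; otherwise the zero of the
     logarithm at a = 1 lowers the exponent 5/4 to 1/4. *)
have [K K0 HK] : exists2 K, 0 <= K & forall a c : R, 0 < a < 1 -> 0 < c < 1 -> c < b ->
    logpow n a * (1 - a * c) ^- 2 <= K * (rho a * rho c).
  case: n nb {F} => [b1'|n _].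
    exists ((1 - b) ^- 2); first by rewrite invr_ge0 exprn_ge0// subr_ge0.
    move=> a c a01 c01 cb; rewrite /logpow /divpow expr0 fact0 invr1 !mul1r.
    apply: (@le_trans _ _ ((1 - b) ^- 2)).
      move: a01 c01 => /andP[? ?] /andP[? ?].
      have bb : 0 < 1 - b by rewrite subr_gt0.
      have bac : 1 - b <= 1 - a * c by nra.
      have ac := lt_le_trans bb bac.
      by rewrite lef_pV2 ?posrE ?exprn_gt0// ler_pXn2r// nnegrE ltW.
    rewrite ler_peMr ?invr_ge0 ?exprn_ge0 ?subr_ge0//.
    by rewrite -[1]mulr1 ler_pM// rho_ge1.
  have [K K0 HK] := divpow_boundS R n.
  exists K => // a c /[dup] a01 /andP[a0 a1] c01 cb.
  apply: (@le_trans _ _ (K * ((1 - a) * a `^ (- (1 / 4))) *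
      ((1 - a) `^ (- (5 / 4)) * (1 - c) `^ (- (3 / 4))))).
    rewrite ler_pM ?logpow_ge0 ?inv_sq_bound ?HK ?a0 ?(ltW a1)//.
    move: a01 c01 => /andP[? ?] /andP[? ?].
    by rewrite invr_ge0 exprn_ge0//; nra.
  rewrite -[leLHS]mulrA ler_wpM2l//.
  rewrite [leLHS](_ : _ = a `^ (- (1 / 4)) * (1 - a) `^ (- (1 / 4)) * (1 - c) `^ (- (3 / 4))).
    apply: ler_pM; [by rewrite mulr_ge0 ?powR_ge0|exact: powR_ge0|
      by apply: rho_dom => //; lra|by apply: rho_domr => //; lra].
  have -> : (1 - a) `^ (- (1 / 4)) = (1 - a) * (1 - a) `^ (- (5 / 4)).
    rewrite -{2}(powRr1 (_ : 0 <= 1 - a)) ?subr_ge0 ?(ltW a1)// -powRD.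
      by congr (_ `^ _); lra.
    by apply/implyP => _; rewrite gt_eqF// subr_gt0.
  by ring.
rewrite (@fubini_int01 _ F (normc (1 - w) * d ^- 2 * K)).
- apply: eq_int01 => c; rewrite in_itv/= => c01; rewrite /F /trunc.
  by case: ifP => // _; exact: int01_0.
- rewrite /F /trunc; apply: cmeas_if; first exact: measurable_square.
  + by apply: measurable_fun_ltr => //; apply: measurable_funTS; exact: measurable_snd.
  + apply: cmeasM.
      apply: cmeas_real; apply: measurable_funTS.
      exact: (measurableT_comp (measurable_logpow n) measurable_fst).
    apply: cmeasM; first exact: cmeas_cst.
    rewrite /= (_ : (fun _ => _) = (fun p => (Delta p.1 p.2)^-1 * (Delta p.1 p.2)^-1)); last first.
      by apply/funext => p; rewrite -invfM expr2.
    by apply: cmeasM; apply: cmeasV; apply: cmeas_Delta; apply: measurable_funTS;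
      [exact: measurable_fst|exact: measurable_snd..|exact: measurable_fst|exact: measurable_snd].
  + exact: cmeas_cst.
- move=> a c; rewrite !in_itv/= => a01 c01; rewrite /F /trunc.
  have rr : 0 <= K * (rho a * rho c) by apply: mulr_ge0 => //; apply: mulr_ge0; exact: rho_ge0.
  case: ifPn => cb; last first.
    rewrite ComplexField.Normc.normc0 -[leRHS]mulrA mulr_ge0//.
    by rewrite mulr_ge0 ?normc_ge0// invr_ge0 exprn_ge0// ltW.
  rewrite !ComplexField.Normc.normcM ComplexField.Normc.normcV expr2 ComplexField.Normc.normcM.
  rewrite normc_real ger0_norm ?logpow_ge0//.
  rewrite [leLHS]mulrCA -[leRHS]mulrA -[leRHS]mulrA ler_wpM2l ?normc_ge0//.
  move: (a01) (c01) => /andP[a0 a1] /andP[c0 c1].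
  have ac : 0 < 1 - a * c by nra.
  apply: (@le_trans _ _ (d ^- 2 * (logpow n a * (1 - a * c) ^- 2))).
    rewrite [leRHS]mulrCA ler_wpM2l ?logpow_ge0// -invfM -exprMn -expr2.
    rewrite lef_pV2 ?posrE ?exprn_gt0 ?mulr_gt0//.
      rewrite ler_pXn2r ?nnegrE ?normc_ge0// ?mulr_ge0 ?(ltW d0) ?(ltW ac)//.
      by apply: Delta_ge; apply/andP; lra.
    by rewrite normc_gt0 Delta_neq0//; try (apply/andP; lra); nra.
  by rewrite ler_wpM2l ?invr_ge0 ?exprn_ge0 ?(ltW d0)// HK.
Qed.

Lemma Delta_inv_bound (a c : R) : 0 <= a <= 1 -> 0 <= c < 1 ->
  normc (Delta a c)^-1 <= (d * (1 - c))^-1.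
Proof.
move=> /andP[a0 a1] /andP[c0 c1].
have c1' : 0 < 1 - c by rewrite subr_gt0.
have h : d * (1 - c) <= normc (Delta a c).
  apply: le_trans (Delta_ge _ _); rewrite ?a0 ?a1 ?c0 ?(ltW c1)//.
  by rewrite ler_pM2l//; nra.
have dc : 0 < d * (1 - c) by rewrite mulr_gt0.
by rewrite ComplexField.Normc.normcV lef_pV2 ?posrE//; exact: lt_le_trans h.
Qed.

Lemma dominated_polylog n (b : R) : 0 <= b < 1 ->
  dominated (fun a => (logpow n a)%:c * (b%:c * (1 - w) / Delta a b)).
Proof.
move=> b01; split.
  apply: cmeasM.
    by apply: cmeas_real; apply: measurable_funTS; exact: measurable_logpow.
  apply: cmeasM; first exact: cmeas_cst.
  apply: cmeasV; apply: cmeas_Delta; first exact: measurable_id.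
  exact: measurable_cst.
have [K K0 HK] := divpow_bound0 R n.
exists (K * (normc (b%:c * (1 - w)) * (d * (1 - b))^-1)) => a.
rewrite in_itv/= => /[dup] a01 /andP[a0 a1].
rewrite !ComplexField.Normc.normcM normc_real ger0_norm ?logpow_ge0//.
rewrite [leRHS]mulrAC; apply: ler_pM.
- exact: logpow_ge0.
- by rewrite mulr_ge0 ?normc_ge0// mulr_ge0 ?normc_ge0.
- apply: (@le_trans _ _ (K * a `^ (- (1 / 4)))).
    by apply: HK; rewrite a0 ltW.
  by apply: ler_wpM2l => //; apply: rho_doml => //; lra.
- apply: ler_wpM2l; first by rewrite mulr_ge0 ?normc_ge0.
  by apply: Delta_inv_bound => //; rewrite (ltW a0) ltW.
Qed.

Lemma one_sub_neq0_in (c : R) : 0 < c < 1 -> 1 - c%:c * w != 0.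
Proof. by move=> /andP[/ltW c0 /ltW c1]; apply: one_sub_neq0; rewrite c0. Qed.

Lemma Delta_unit (a c x : R) : 0 < c < 1 -> 0 <= a <= x -> x <= 1 -> Delta a c != 0.
Proof.
move=> /andP[c0 c1] /andP[a0 ax] x1; apply: Delta_neq0; rewrite ?(ltW c0) ?(ltW c1) ?a0//=.
  exact: le_trans x1.
by nra.
Qed.

(** In a, a multiple of a/Delta is a primitive. *)
Lemma int_Delta2 (k : C) (c x : R) : 0 < c < 1 -> 0 <= x <= 1 ->
  int01 (trunc x (fun a => k * ((1 - w) / Delta a c ^+ 2))) =
    k * ((1 - w) / (1 - c%:c * w) * (x%:c / Delta x c)).
Proof.
move=> c01 /andP[x0 x1]; rewrite -int01_window0.
have cw := one_sub_neq0_in c01.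
rewrite (@ftc_int01 _ (fun a => k * ((1 - w) / (1 - c%:c * w)) * (a%:c / Delta a c)))//.
- by rewrite realc0 mul0r mulr0 subr0 -[LHS]mulrA.
- move=> a /Delta_unit -/(_ c c01 x1) Dn0.
  apply: cder_eq; last exact: cderM (cder_cst _ a) (cder_Delta_quot_l Dn0).
  by rewrite mul0r add0r; have := Dn0; rewrite /Delta => ?; field; apply/andP; split.
- move=> a /Delta_unit -/(_ c c01 x1) Dn0.
  apply: ccontM; first exact: cder_cont (cder_cst _ a).
  exact: ccont_Delta2_l.
Qed.

(** The first step of the recursion: (1 - w)/((1 - c w)(1 - c)) dc is minus the
    difference of the forms dc/(c - 1) and dc/(c - 1/w). *)
Lemma polylog0E (b : R) : 0 <= b < 1 ->
  polylog 0 b = int01 (trunc b (fun c => (1 - w) / ((1 - c%:c * w) * (1 - c%:c)))).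
Proof.
move=> /andP[b0 b1]; rewrite polylog_double ?b0 ?(ltW b1)//.
apply: eq_int01 => c; rewrite in_itv/= => /[dup] c01 /andP[c0 c1].
rewrite /trunc; case: ifP => // cb.
rewrite -int01_trunc1 /= [LHS](_ : _ = int01 (trunc 1 (fun a => 1 * ((1 - w) / Delta a c ^+ 2)))).
  rewrite int_Delta2 ?ler01 ?lexx//.
  rewrite (_ : Delta 1 c = 1 - c%:c); last by rewrite /Delta realc1; ring.
  by rewrite realc1 !mul1r invfM mulrA.
apply: eq_int01 => a _; rewrite /trunc; case: ifP => // _.
by rewrite /logpow /divpow expr0 fact0 divr1 realc1.
Qed.

Lemma logpowS_integral n (k : C) (a : R) : 0 < a < 1 ->
  (logpow n.+1 a)%:c * k = int01 (window a 1 (fun x => (logpow n x / x)%:c * k)).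
Proof.
move=> /andP[a0 a1].
rewrite (@ftc_int01 _ (fun x => (- logpow n.+1 x)%:c * k)) ?(ltW a0) ?(ltW a1)//.
- rewrite /logpow ln1 oppr0 /divpow expr0n mul0r oppr0 realc0 mul0r sub0r.
  by rewrite realcN mulNr opprK.
- move=> x /andP[ax x1]; have x0 := lt_le_trans a0 ax.
  have dk := is_deriveN (is_derive_divpow_ln n x0).
  apply: cder_eq; last exact: cderM (cder_real dk) (cder_cst k x).
  by rewrite /= mulr0 addr0 opprK.
- move=> x /andP[ax x1]; have x0 := lt_le_trans a0 ax.
  apply: ccontM; last exact: cder_cont (cder_cst k x).
  apply: ccont_real; apply: continuousM.
    apply: (@continuous_comp _ _ _ (fun x => - ln x) (divpow n)); last exact: divpow_continuous.
    exact: is_derive_continuous (is_deriveN (is_derive1_ln x0)).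
  by apply: inv_continuous; rewrite gt_eqF.
Qed.

(** Integration by parts, in the form of an exchange: the power n + 1 of the logarithm
    is written as an integral over a < x < 1 of the power n, and the inner integral
    over 0 < a < x is then explicit. *)
Lemma int01_logpowS_Delta n (c : R) : 0 < c < 1 ->
  int01 (fun a => (logpow n.+1 a)%:c * ((1 - w) / Delta a c ^+ 2)) =
  polylog n c / (c%:c * (1 - c%:c * w)).
Proof.
move=> /[dup] c01 /andP[c0 c1]; have cw := one_sub_neq0_in c01.
have c1' : 0 < 1 - c by rewrite subr_gt0.
have cn0 : c%:c != 0 by rewrite realc_eq0 gt_eqF.
pose G a := window a 1 (fun x => (logpow n x / x)%:c * ((1 - w) / Delta a c ^+ 2)).
transitivity (int01 (fun a => int01 (G a))).
  by apply: eq_int01 => a; rewrite in_itv/= => a01; exact: logpowS_integral.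
transitivity (int01 (fun x => int01 (G ^~ x))); last first.
  rewrite mulrC -int01Z; last by apply: dominated_polylog; rewrite (ltW c0).
  apply: eq_int01 => x; rewrite in_itv/= => /[dup] x01 /andP[x0 x1].
  rewrite [LHS](_ : _ = int01 (trunc x (fun a => (logpow n x / x)%:c * ((1 - w) / Delta a c ^+ 2)))).
    have Dn0 : Delta x c != 0 by rewrite (@Delta_unit x c x)// ?lexx ?(ltW x0) ?(ltW x1).
    rewrite int_Delta2 ?(ltW x0) ?(ltW x1)//; move: (logpow n x) => y; rewrite !realcE.
    have xn0 : x%:c != 0 by rewrite realc_eq0 gt_eqF.
    have := Dn0; rewrite /Delta => ?; field.
    by apply/and4P; split; first [exact: Dn0|exact: xn0|exact: cw|exact: cn0].
  by apply: eq_int01 => a _; rewrite /G /window /trunc x1 andbT.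
have [K K0 HK] := divpow_bound0 R n.
pose M := normc (1 - w) * ((d * (1 - c))^-1 * (d * (1 - c))^-1).
have M0 : 0 <= M.
  by rewrite mulr_ge0 ?normc_ge0// mulr_ge0// invr_ge0 mulr_ge0// ltW.
apply: (@fubini_int01 _ G (M * K)).
- rewrite /G /window; apply: cmeas_if; first exact: measurable_square.
  + apply: measurable_and; apply: measurable_fun_ltr => //; apply: measurable_funTS;
      first [exact: measurable_fst|exact: measurable_snd].
  + apply: cmeasM.
      apply: cmeas_real; apply: measurable_funTS; apply: measurable_funM.
        exact: (measurableT_comp (measurable_logpow n) measurable_snd).
      exact: (measurableT_comp (@measurable_invr R) measurable_snd).
    apply: cmeasM; first exact: cmeas_cst.
    rewrite /= (_ : (fun _ => _) = (fun p => (Delta p.1 c)^-1 * (Delta p.1 c)^-1)); last first.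
      by apply/funext => p; rewrite -invfM expr2.
    by apply: cmeasM; apply: cmeasV; apply: cmeas_Delta; apply: measurable_funTS;
      [exact: measurable_fst|exact: measurable_cst|exact: measurable_fst|exact: measurable_cst].
  + exact: cmeas_cst.
- move=> a x; rewrite !in_itv/= => /[dup] a01 /andP[a0 a1] /[dup] x01 /andP[x0 x1].
  rewrite /G /window x1 andbT.
  case: ifPn => ax; last first.
    rewrite ComplexField.Normc.normc0; apply: mulr_ge0; first exact: mulr_ge0.
    by apply: mulr_ge0; exact: rho_ge0.
  rewrite !ComplexField.Normc.normcM normc_real.
  rewrite ger0_norm; last by apply: divr_ge0; [exact: logpow_ge0|exact: ltW].
  rewrite -[leRHS]mulrA [leLHS]mulrC; apply: ler_pM.
  + by rewrite mulr_ge0 ?normc_ge0.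
  + by apply: divr_ge0; [exact: logpow_ge0|exact: ltW].
  + rewrite /M ler_wpM2l ?normc_ge0// expr2 invfM ComplexField.Normc.normcM.
    by apply: ler_pM; rewrite ?normc_ge0// Delta_inv_bound// ?(ltW a0) ?(ltW a1) ?(ltW c0).
  + apply: (@le_trans _ _ (K * x `^ (- (1 / 4)) / x)).
      apply: ler_wpM2r; first by rewrite invr_ge0 ltW.
      by apply: HK; rewrite x0 ltW.
    rewrite -[leLHS]mulrA ler_wpM2l// [leRHS]mulrC.
    have -> : x `^ (- (1 / 4)) / x = x `^ (- (3 / 4)) * x `^ (- (1 / 2)).
      rewrite -(powR_inv1 (ltW x0)) -!powRD; try by apply/implyP => _; rewrite gt_eqF.
      by congr (_ `^ _); lra.
    apply: ler_pM; rewrite ?powR_ge0//; first by apply: rho_doml => //; lra.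
    apply: (@le_trans _ _ (a `^ (- (1 / 2)))).
      by apply: powRN_anti => //; exact: ltW.
    by apply: rho_doml => //; lra.
Qed.

(** The next steps of the recursion: dc/(c (1 - c w)) is the difference of the forms
    dc/c and dc/(c - 1/w). *)
Lemma polylogSE n (b : R) : 0 <= b <= 1 ->
  polylog n.+1 b = int01 (trunc b (fun c => polylog n c / (c%:c * (1 - c%:c * w)))).
Proof.
move=> b01; rewrite polylog_double//; apply: eq_int01 => c; rewrite in_itv/= => c01.
by rewrite /trunc; case: ifP => // _; exact: int01_logpowS_Delta.
Qed.

(** Delta a 1 = (1 - w)(1 - a), so w cancels at b = 1. *)
Lemma polylogS_at1 n : polylog n.+1 1 = int01 (fun a => (logpow n.+1 a / (1 - a))%:c).
Proof.
apply: eq_int01 => a; rewrite in_itv/= => /andP[a0 a1].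
have a1' : 1 - a%:c != 0 by rewrite -realc1 -realcB realc_eq0 subr_eq0 gt_eqF.
have := one_sub_w_neq0 => w1.
move: (logpow n.+1 a) => y.
rewrite (_ : Delta a 1 = (1 - w) * (1 - a%:c)); last by rewrite /Delta realc1; ring.
by rewrite !realcE; field; apply/andP; split.
Qed.

End polylog.

(** * The kernel summing all words in e_0 and e_1 of given content *)

Section kernel.
Variable R : realType.
Local Notation C := R[i].
Local Notation I := (`]0, 1[%classic : set R).
Local Notation normc := (@ComplexField.Normc.normc R).
Local Notation "x %:c" := (real_complex_def (Phant R) x) (at level 1, format "x %:c").

(** The derivative of [divpow], the case n = 0 included. *)
Definition ddivpow n (y : R) : R := if n is m.+1 then divpow m y else 0.

Lemma is_derive_divpow n (y : R) : is_derive y 1 (divpow n) (ddivpow n y).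
Proof.
case: n => [|n]; last exact: is_derive_divpowS.
rewrite (_ : divpow 0 = cst (1 / 0`!%:R)); first exact: is_derive_cst.
by apply/funext => x; rewrite /divpow expr0.
Qed.

Lemma ddivpow_ge0 n (y : R) : 0 <= y -> 0 <= ddivpow n y.
Proof. by case: n => // n; exact: divpow_ge0. Qed.

Lemma measurable_ddivpow n : measurable_fun [set: R] (ddivpow n).
Proof. by case: n => [|n]; [exact: measurable_cst|exact: measurable_divpow]. Qed.

Lemma ddivpow_continuous n (y : R) : {for y, continuous (ddivpow n)}.
Proof. by case: n => [|n]; [exact: cst_continuous|exact: divpow_continuous]. Qed.

Lemma ddivpow_bound n : exists2 c : R, 0 <= c & forall x : R, 0 < x <= 1 ->
  ddivpow n (- ln x) <= c * x `^ (- (1 / 4)).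
Proof.
case: n => [|n]; last exact: divpow_bound0.
by exists 0 => // x _; rewrite mul0r.
Qed.

(** ln (t/s) is the integral of dx/x from s to t, and [logratio1] below is the
    integral of dx/(1 - x). Writing both as - ln of a number in ]0, 1] lets a single
    bound on the logarithm serve for both. *)
Definition logratio0 (s t : R) : R := - ln (s / t).
Definition logratio1 (s t : R) : R := - ln ((1 - t) / (1 - s)).

Lemma ratio_itv (s t : R) : 0 < s -> s <= t -> 0 < s / t <= 1.
Proof.
move=> s0 st; have t0 := lt_le_trans s0 st.
by rewrite divr_gt0//= ler_pdivrMr// mul1r.
Qed.

Lemma ratio_onem_itv (s t : R) : s <= t -> t < 1 -> 0 < (1 - t) / (1 - s) <= 1.
Proof. by move=> st t1; apply: ratio_itv; lra. Qed.

Lemma logratio0_ge0 (s t : R) : 0 < s -> s <= t -> 0 <= logratio0 s t.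
Proof. by move=> s0 st; exact/oppr_ln_ge0/ratio_itv. Qed.

Lemma logratio1_ge0 (s t : R) : s <= t -> t < 1 -> 0 <= logratio1 s t.
Proof. by move=> s0 st; exact/oppr_ln_ge0/ratio_onem_itv. Qed.

Lemma is_derive_logratio0 (s t : R) : 0 < s -> 0 < t -> is_derive t 1 (logratio0 s) (t^-1).
Proof.
move=> s0 t0.
have dV : is_derive t 1 (fun t => s / t) (s * (- t ^- 2)).
  have dt : is_derive t 1 (fun t : R => t) 1 by exact: is_derive_id.
  have := is_deriveZ s (@is_deriveV R (fun t => t) t 1 1 (lt0r_neq0 t0) dt).
  by move=> H; apply: (@is_derive_eq _ _ _ _ _ _ _ _ H); rewrite /GRing.scale/= mulr1.
have := is_deriveN (@is_derive1_comp _ (@ln R) (fun t => s / t) t _ _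
  (is_derive1_ln (divr_gt0 s0 t0)) dV).
move=> H; apply: (@is_derive_eq _ _ _ _ _ _ _ _ H).
by field; rewrite !gt_eqF.
Qed.

Lemma is_derive_logratio1 (s t : R) : s < 1 -> t < 1 -> is_derive t 1 (logratio1 s) ((1 - t)^-1).
Proof.
move=> s1 t1; have s1' : 0 < 1 - s by lra. have t1' : 0 < 1 - t by lra.
have dV : is_derive t 1 (fun t => (1 - t) / (1 - s)) (- (1 - s)^-1).
  have d1 : is_derive t 1 (fun t : R => 1 - t) (-1).
    by apply: is_derive_eq; ring.
  have := is_deriveZ (1 - s)^-1 d1.
  rewrite (_ : (1 - s)^-1 \*: _ = (fun t => (1 - t) / (1 - s))); last first.
    by apply/funext => x; rewrite /= /GRing.scale/= mulrC.
  by move=> H; apply: (@is_derive_eq _ _ _ _ _ _ _ _ H); rewrite /GRing.scale/= mulrN1.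
have := is_deriveN (@is_derive1_comp _ (@ln R) (fun t => (1 - t) / (1 - s)) t _ _
  (is_derive1_ln (divr_gt0 t1' s1')) dV).
move=> H; apply: (@is_derive_eq _ _ _ _ _ _ _ _ H).
by field; apply/andP; rewrite !gt_eqF.
Qed.

(** By the shuffle product this is the sum, over all orders of a forms dx/x and b
    forms dx/(1 - x), of the iterated integrals between s and t. The shuffle product
    itself does not appear: the derivative [dlogkernel] already has the recursion
    of that sum. *)
Definition logkernel a b (s t : R) : R := divpow a (logratio0 s t) * divpow b (logratio1 s t).
Definition dlogkernel a b (s t : R) : R :=
  ddivpow a (logratio0 s t) * divpow b (logratio1 s t) / t + divpow a (logratio0 s t) * ddivpow b (logratio1 s t) / (1 - t).

Lemma is_derive_logkernel a b (s t : R) : 0 < s < 1 -> 0 < t < 1 ->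
  is_derive t 1 (logkernel a b s) (dlogkernel a b s t).
Proof.
move=> /andP[s0 s1] /andP[t0 t1].
have d1 := @is_derive1_comp _ (divpow a) (logratio0 s) t _ _ (is_derive_divpow a _) (is_derive_logratio0 s0 t0).
have d2 := @is_derive1_comp _ (divpow b) (logratio1 s) t _ _ (is_derive_divpow b _) (is_derive_logratio1 s1 t1).
have := is_deriveM d1 d2.
move=> H; apply: (@is_derive_eq _ _ _ _ _ _ _ _ H).
by rewrite /GRing.scale/= /dlogkernel; ring.
Qed.

Lemma divpow0 n : divpow n.+1 (0 : R) = 0.
Proof. by rewrite /divpow expr0n mul0r. Qed.

Lemma logkernel_diag a b (s : R) : 0 < s < 1 -> (0 < a + b)%N -> logkernel a b s s = 0.
Proof.
move=> /andP[s0 s1] ab; rewrite /logkernel /logratio0 /logratio1 !divff ?gt_eqF ?subr_gt0// ln1 oppr0.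
by case: a ab => [|a]; case: b => [|b] //= _; rewrite !divpow0 ?mulr0 ?mul0r.
Qed.

Lemma dlogkernel_continuous a b (s t : R) : 0 < s < 1 -> 0 < t < 1 -> {for t, continuous (dlogkernel a b s)}.
Proof.
move=> /andP[s0 s1] /andP[t0 t1].
have c0 := is_derive_continuous (is_derive_logratio0 s0 t0).
have c1 := is_derive_continuous (is_derive_logratio1 s1 t1).
apply: continuousD.
  apply: continuousM; last by apply: inv_continuous; rewrite gt_eqF.
  apply: continuousM; apply: continuous_comp => //; first exact: ddivpow_continuous.
  exact: divpow_continuous.
have c2 : {for t, continuous (fun t : R => (1 - t)^-1)}.
  have c3 : {for t, continuous (fun t : R => 1 - t)}.
    by apply: continuousB => //; exact: cst_continuous.
  apply: (continuous_comp c3); apply: inv_continuous.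
  by rewrite gt_eqF// subr_gt0.
apply: continuousM; last exact: c2.
apply: continuousM; apply: continuous_comp => //; last exact: ddivpow_continuous.
exact: divpow_continuous.
Qed.

(** The only property of [divpow] and of its derivative that matters for
    domination. *)
Definition logbound (f : R -> R) := exists2 c : R, 0 <= c &
  forall x : R, 0 < x <= 1 -> f (- ln x) <= c * x `^ (- (1 / 4)).

Lemma logbound0 f : logbound f -> exists2 c : R, 0 <= c &
  forall s t : R, 0 < s -> s <= t -> f (logratio0 s t) <= c * (s `^ (- (1 / 4)) * t `^ (1 / 4)).
Proof.
move=> [c c0 H]; exists c => // s t s0 st; have t0 := lt_le_trans s0 st.
apply: le_trans (H _ (ratio_itv s0 st)) _.
rewrite ler_wpM2l// powRM ?invr_ge0 ?(ltW s0) ?(ltW t0)//.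
rewrite -[X in _ * X `^ _ <= _]powR_inv1 ?(ltW t0)// -powRrM.
by rewrite (_ : -1 * - (1 / 4) = 1 / 4)//; lra.
Qed.

Lemma logbound1 f : logbound f -> exists2 c : R, 0 <= c &
  forall s t : R, 0 <= s -> s <= t -> t < 1 -> f (logratio1 s t) <= c * (1 - t) `^ (- (1 / 4)).
Proof.
move=> [c c0 H]; exists c => // s t s0 st t1.
apply: le_trans (H _ (ratio_onem_itv st t1)) _.
rewrite ler_wpM2l//; apply: powRN_anti; [by lra|by lra|].
have s1 : 0 < 1 - s by lra.
by rewrite ler_pdivlMr//; nra.
Qed.

Lemma logbound_divpow n : logbound (divpow n). Proof. exact: divpow_bound0. Qed.
Lemma logbound_ddivpow n : logbound (ddivpow n). Proof. exact: ddivpow_bound. Qed.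

(** The factor t^(1/4), which comes from ln (t/s) <= c (t/s)^(1/4), later weakens the
    pole 1/t to t^(-3/4). *)
Lemma logkernel_bound (f g : R -> R) : logbound f -> logbound g -> (forall y, 0 <= y -> 0 <= f y) ->
  (forall y, 0 <= y -> 0 <= g y) ->
  exists2 c : R, 0 <= c & forall s t : R, 0 < s -> s <= t -> t < 1 ->
  0 <= f (logratio0 s t) * g (logratio1 s t) <=
    c * (s `^ (- (1 / 4)) * (t `^ (1 / 4) * (1 - t) `^ (- (1 / 4)))).
Proof.
move=> /logbound0[c c0 Hc] /logbound1[e e0 He] f0 g0.
exists (c * e); first exact: mulr_ge0.
move=> s t s0 st t1; apply/andP; split.
  by apply: mulr_ge0; [exact/f0/logratio0_ge0|exact/g0/logratio1_ge0].
apply: (@le_trans _ _ ((c * (s `^ (- (1 / 4)) * t `^ (1 / 4))) * (e * (1 - t) `^ (- (1 / 4))))).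
  apply: ler_pM; [exact/f0/logratio0_ge0|exact/g0/logratio1_ge0|exact: Hc|].
  by apply: He => //; exact: ltW.
by rewrite le_eqVlt; apply/orP; left; apply/eqP; ring.
Qed.

Lemma measurable_logratio0 d (T : measurableType d) (D : set T) (f g : T -> R) :
  measurable_fun D f -> measurable_fun D g -> measurable_fun D (fun x => logratio0 (f x) (g x)).
Proof.
move=> mf mg; apply: measurableT_comp => //; apply: (measurableT_comp (@measurable_ln R)).
by apply: measurable_funM => //; exact: (measurableT_comp (@measurable_invr R)).
Qed.

Lemma measurable_logratio1 d (T : measurableType d) (D : set T) (f g : T -> R) :
  measurable_fun D f -> measurable_fun D g -> measurable_fun D (fun x => logratio1 (f x) (g x)).
Proof. by move=> mf mg; apply: measurable_logratio0; exact: measurable_funB. Qed.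

Lemma measurable_logkernel d (T : measurableType d) (D : set T) (f g : T -> R) (h k : R -> R) :
  measurable_fun [set: R] h -> measurable_fun [set: R] k ->
  measurable_fun D f -> measurable_fun D g ->
  measurable_fun D (fun x => h (logratio0 (f x) (g x)) * k (logratio1 (f x) (g x))).
Proof.
move=> mh mk mf mg; apply: measurable_funM.
  exact: (measurableT_comp mh (measurable_logratio0 mf mg)).
exact: (measurableT_comp mk (measurable_logratio1 mf mg)).
Qed.

End kernel.

(** * Integrals against the kernel *)

Section kernel_integrals.
Variable R : realType.
Local Notation C := R[i].
Local Notation I := (`]0, 1[%classic : set R).
Local Notation normc := (@ComplexField.Normc.normc R).
Local Notation "x %:c" := (real_complex_def (Phant R) x) (at level 1, format "x %:c").
Variables (g : R -> C) (G : R).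
Hypothesis cg : forall x : R, 0 < x < 1 -> ccont g x.
Hypothesis G0 : 0 <= G.
Hypothesis gG : forall x : R, 0 < x < 1 -> normc (g x) <= G.

Lemma cmeas_01 : cmeas I g.
Proof.
apply: cmeas_ccont; first exact: itv_open.
by move=> x /=; rewrite in_itv/=; exact: cg.
Qed.

Lemma cmeas_01_comp d (T : measurableType d) (D : set T) (f : T -> R) :
  (forall x, D x -> 0 < f x < 1) -> measurable_fun D f -> cmeas D (fun x => g (f x)).
Proof.
move=> Df mf; apply: (cmeas_comp (E := I) (f := g)) => //; last exact: cmeas_01.
by move=> _ [x /Df fx <-]; rewrite /= in_itv/=.
Qed.

Lemma dominated_logkernel (h k : R -> R) (t : R) : 0 < t < 1 ->
  measurable_fun [set: R] h -> measurable_fun [set: R] k ->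
  logbound h -> logbound k -> (forall y, 0 <= y -> 0 <= h y) ->
  (forall y, 0 <= y -> 0 <= k y) ->
  dominated (trunc t (fun s => (h (logratio0 s t) * k (logratio1 s t))%:c * g s)).
Proof.
move=> /andP[t0 t1] mh mk lh lk h0 k0; split.
  rewrite /trunc; apply: cmeas_if => //.
  - by apply: measurable_fun_ltr => //; exact: measurable_cst.
  - apply: cmeasM; last exact: cmeas_01.
    apply: cmeas_real; apply: measurable_logkernel => //; exact: measurable_cst.
  - exact: cmeas_cst.
have [c c0 H] := logkernel_bound lh lk h0 k0.
exists (c * (t `^ (1 / 4) * (1 - t) `^ (- (1 / 4))) * G) => s.
rewrite in_itv/= => /[dup] s01 /andP[s0 s1].
have r0 := rho_ge0 s.
have q0 : 0 <= t `^ (1 / 4) * (1 - t) `^ (- (1 / 4)) by rewrite mulr_ge0 ?powR_ge0.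
rewrite /trunc; case: ifPn => st; last first.
  rewrite ComplexField.Normc.normc0; apply: mulr_ge0 => //.
  by apply: mulr_ge0 => //; apply: mulr_ge0.
rewrite ComplexField.Normc.normcM normc_real.
have /andP[K0 KH] := H s t s0 (ltW st) t1.
rewrite ger0_norm// [leRHS]mulrAC; apply: ler_pM; rewrite ?normc_ge0//; last exact: gG.
apply: (le_trans KH); rewrite -[leRHS]mulrA; apply: ler_wpM2l => //.
rewrite mulrC; apply: ler_wpM2l => //.
by apply: rho_doml => //; lra.
Qed.

(** The integral over 0 < s < t of the kernel against g(s) ds, where g will be the
    form of the letter e_z. *)
Definition kernel_int a b (t : R) : C := int01 (trunc t (fun s => (logkernel a b s t)%:c * g s)).

(** Removal of a last letter e_0, with value 0 when there is none; [drop_one] is the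
    same for e_1. *)
Definition drop_zero a b (t : R) : C := if a is a'.+1 then kernel_int a' b t else 0.
Definition drop_one a b (t : R) : C := if b is b'.+1 then kernel_int a b' t else 0.

Lemma int01_dlogkernel (a b : nat) (t : R) : 0 < t < 1 ->
  int01 (trunc t (fun s => (dlogkernel a b s t)%:c * g s)) =
  drop_zero a b t / t%:c + drop_one a b t / (1 - t)%:c.
Proof.
move=> t01.
have d1 := dominated_logkernel t01 (@measurable_ddivpow R a) (@measurable_divpow R b) (@logbound_ddivpow R a)
  (@logbound_divpow R b) (@ddivpow_ge0 R a) (@divpow_ge0 R b).
have d2 := dominated_logkernel t01 (@measurable_divpow R a) (@measurable_ddivpow R b) (@logbound_divpow R a)
  (@logbound_ddivpow R b) (@divpow_ge0 R a) (@ddivpow_ge0 R b).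
transitivity (int01 (fun s => (t%:c)^-1 * trunc t (fun s => (ddivpow a (logratio0 s t) * divpow b (logratio1 s t))%:c * g s) s +
    ((1 - t)%:c)^-1 * trunc t (fun s => (divpow a (logratio0 s t) * ddivpow b (logratio1 s t))%:c * g s) s)).
  congr int01; apply/funext => s; rewrite /trunc; case: ifP => _; last by rewrite !mulr0 addr0.
  rewrite /dlogkernel.
  move: (ddivpow a _ * _) (divpow a _ * _) => x y.
  by rewrite realcD (realcM x) (realcM y) !realcV; ring.
rewrite int01D; [|exact: dominatedZ..]; rewrite !int01Z// ![_^-1 * _]mulrC.
congr (_ / _ + _ / _).
  case: a {d1 d2} => [|a] //=; rewrite -[RHS](@int01_0 R); congr int01; apply/funext => s.
  by rewrite /trunc mul0r realc0 mul0r; case: ifP.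
case: b {d1 d2} => [|b] //=; rewrite -[RHS](@int01_0 R); congr int01; apply/funext => s.
by rewrite /trunc mulr0 realc0 mul0r; case: ifP.
Qed.

(** The recursion on the last letter. The kernel vanishes on the diagonal, so it is
    the integral of its derivative from s to x; exchanging this integral with the one
    over s makes the integrals with one letter less appear. *)
Lemma kernel_int_rec a b (x : R) : 0 < x < 1 -> (0 < a + b)%N ->
  kernel_int a b x = int01 (trunc x (fun t => drop_zero a b t / t%:c + drop_one a b t / (1 - t)%:c)).
Proof.
move=> /andP[x0 x1] ab.
pose H s := window s x (fun t => (dlogkernel a b s t)%:c * g s).
transitivity (int01 (fun s => int01 (H s))).
  apply: eq_int01 => s; rewrite in_itv/= => /[dup] s01 /andP[s0 s1]; rewrite /trunc.
  case: ifPn => sx.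
    rewrite (@ftc_int01 _ (fun t => (logkernel a b s t)%:c * g s)) ?(ltW s0) ?(ltW sx) ?(ltW x1)//.
    - by rewrite logkernel_diag// realc0 mul0r subr0.
    - move=> t /andP[st tx].
      have t01 : 0 < t < 1 by rewrite (lt_le_trans s0)//= (le_lt_trans tx).
      apply: cder_eq; last exact: cderM (cder_real (is_derive_logkernel a b s01 t01)) (cder_cst (g s) t).
      by rewrite mulr0 addr0.
    - move=> t /andP[st tx].
      have t01 : 0 < t < 1 by rewrite (lt_le_trans s0)//= (le_lt_trans tx).
      apply: ccontM; last exact: cder_cont (cder_cst (g s) t).
      by apply: ccont_real; exact: dlogkernel_continuous.
  rewrite -[LHS](@int01_0 R); apply: eq_int01 => t _; rewrite /H /window.
  by case: ifPn => // /andP[st tx]; move: sx; rewrite (lt_trans st tx).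
have [c1 c10 H1] := logkernel_bound (@logbound_ddivpow R a) (@logbound_divpow R b) (@ddivpow_ge0 R a) (@divpow_ge0 R b).
have [c2 c20 H2] := logkernel_bound (@logbound_divpow R a) (@logbound_ddivpow R b) (@divpow_ge0 R a) (@ddivpow_ge0 R b).
have c0 : 0 <= c1 + c2 / (1 - x).
  by rewrite addr_ge0// divr_ge0// subr_ge0 ltW.
rewrite (@fubini_int01 _ H ((c1 + c2 / (1 - x)) * G)).
- apply: eq_int01 => t; rewrite in_itv/= => t01; rewrite /trunc.
  case: ifPn => tx; last first.
    by rewrite -[RHS](@int01_0 R); congr int01; apply/funext => s; rewrite /H /window (negbTE tx) andbF.
  rewrite -int01_dlogkernel//; congr int01; apply/funext => s.
  by rewrite /H /window /trunc tx andbT.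
- rewrite /H /window; apply: cmeas_if; first exact: measurable_square.
  + apply: measurable_and; apply: measurable_fun_ltr => //; apply: measurable_funTS;
      first [exact: measurable_fst|exact: measurable_snd].
  + have m1 : measurable_fun (I `*` I) (fun p : R * R => p.1).
      by apply: measurable_funTS; exact: measurable_fst.
    have m2 : measurable_fun (I `*` I) (fun p : R * R => p.2).
      by apply: measurable_funTS; exact: measurable_snd.
    apply: cmeasM; last first.
      by apply: cmeas_01_comp => // p [p1 _]; move: p1; rewrite /= in_itv.
    apply: cmeas_real; rewrite /dlogkernel; apply: measurable_funD; apply: measurable_funM.
    * by apply: measurable_logkernel => //; [exact: measurable_ddivpow|exact: measurable_divpow].
    * exact: (measurableT_comp (@measurable_invr R)).
    * by apply: measurable_logkernel => //; [exact: measurable_divpow|exact: measurable_ddivpow].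
    * apply: (measurableT_comp (@measurable_invr R)); exact: measurable_funB.
  + exact: cmeas_cst.
- move=> s t; rewrite !in_itv/= => /[dup] s01 /andP[s0 s1] /[dup] t01 /andP[t0 t1].
  have rr : 0 <= rho s * rho t by apply: mulr_ge0; exact: rho_ge0.
  rewrite /H /window; case: ifPn => [/andP[st tx]|_]; last first.
    rewrite ComplexField.Normc.normc0; apply: mulr_ge0 => //; exact: mulr_ge0.
  rewrite ComplexField.Normc.normcM normc_real [leRHS]mulrAC.
  have /andP[K1 KH1] := H1 s t s0 (ltW st) t1.
  have /andP[K2 KH2] := H2 s t s0 (ltW st) t1.
  apply: ler_pM; rewrite ?normc_ge0//; last exact: gG.
  set B := s `^ (- (1 / 4)) * (t `^ (1 / 4) * (1 - t) `^ (- (1 / 4))) in KH1 KH2.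
  have B0 : 0 <= B by rewrite mulr_ge0 ?mulr_ge0 ?powR_ge0.
  have B1 : B / t <= rho s * rho t.
    rewrite /B -[leLHS]mulrA; apply: ler_pM; first exact: powR_ge0.
    - by rewrite divr_ge0 ?(ltW t0)// mulr_ge0 ?powR_ge0.
    - by apply: rho_doml => //; lra.
    - rewrite [leLHS]mulrAC.
      rewrite (_ : t `^ (1 / 4) / t = t `^ (- (3 / 4))).
        by apply: rho_dom => //; lra.
      rewrite -(powR_inv1 (ltW t0)) -powRD; first by congr (_ `^ _); lra.
      by apply/implyP => _; rewrite gt_eqF.
  have t1' : 0 < 1 - t by rewrite subr_gt0.
  rewrite /dlogkernel ger0_norm; last first.
    by rewrite addr_ge0// divr_ge0// ltW.
  rewrite [leRHS]mulrDl; apply: lerD.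
    apply: (@le_trans _ _ (c1 * B / t)).
      by apply: ler_wpM2r => //; rewrite invr_ge0 ltW.
    by rewrite -[leLHS]mulrA; apply: ler_wpM2l.
  apply: (@le_trans _ _ (c2 * B / (1 - x))).
    apply: ler_pM => //; first by rewrite invr_ge0 ltW.
    by rewrite lef_pV2 ?posrE ?subr_gt0//; lra.
  rewrite [leLHS]mulrAC; apply: ler_wpM2l; first by rewrite divr_ge0// subr_ge0 ltW.
  apply: le_trans B1.
  by rewrite ler_peMr// invf_ge1// ltW.
Qed.

End kernel_integrals.

(** * Change of variables to the unit square *)

Section double_integral.
Variable R : realType.
Local Notation C := R[i].
Local Notation I := (`]0, 1[%classic : set R).
Local Notation normc := (@ComplexField.Normc.normc R).
Local Notation "x %:c" := (real_complex_def (Phant R) x) (at level 1, format "x %:c").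
Variables (g : R -> C) (G : R).
Hypothesis cg : forall x : R, 0 < x < 1 -> ccont g x.
Hypothesis G0 : 0 <= G.
Hypothesis gG : forall x : R, 0 < x < 1 -> normc (g x) <= G.

Variables a b : nat.

Lemma kernel_int00 (x : R) : 0 < x < 1 -> kernel_int g 0 0 x = int01 (trunc x g).
Proof.
move=> _; congr int01; apply/funext => s; rewrite /trunc; case: ifP => // _.
by rewrite /logkernel /divpow !expr0 fact0 divr1 mul1r realc1 mul1r.
Qed.

Lemma logratio0_continuous (s t : R) : 0 < s -> 0 < t -> {for s, continuous (fun s : R => logratio0 s t)}.
Proof.
move=> s0 t0.
have c1 : {for s, continuous (fun s : R => s / t)}.
  by apply: continuousM => //; exact: cst_continuous.
have c2 : {for s / t, continuous (@ln R)} by apply: continuous_ln; exact: divr_gt0.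
by apply: continuousN; exact: continuous_comp c1 c2.
Qed.

Lemma logratio1_continuous (p q : R -> R) (s : R) : {for s, continuous p} -> {for s, continuous q} ->
  p s < 1 -> q s < 1 -> {for s, continuous (fun s => logratio1 (p s) (q s))}.
Proof.
move=> cp cq p1 q1.
have c1 : {for s, continuous (fun s : R => 1 - q s)}.
  by apply: continuousB => //; exact: cst_continuous.
have c2 : {for s, continuous (fun s : R => 1 - p s)}.
  by apply: continuousB => //; exact: cst_continuous.
have c3 : {for s, continuous (fun s : R => (1 - p s)^-1)}.
  by apply: (continuous_comp c2); apply: inv_continuous; rewrite gt_eqF// subr_gt0.
have c4 : {for s, continuous (fun s : R => (1 - q s) / (1 - p s))} by exact: continuousM.
have c5 : {for (1 - q s) / (1 - p s), continuous (@ln R)}.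
  by apply: continuous_ln; rewrite divr_gt0 ?subr_gt0.
by apply: continuousN; exact: continuous_comp c4 c5.
Qed.

Lemma ccont_comp (f : R -> C) (p : R -> R) (s : R) : {for s, continuous p} ->
  ccont f (p s) -> ccont (fun s => f (p s)) s.
Proof.
move=> cp [f1 f2]; split.
  exact: (@continuous_comp _ _ _ p (@complex.Re R \o f) s cp f1).
exact: (@continuous_comp _ _ _ p (@complex.Im R \o f) s cp f2).
Qed.

(** The integrand of [kernel_int] after the substitution s = be t, which turns ln (t/s)
    into - ln be; the Jacobian t is left out because it cancels the form dt/t. *)
Definition scaled (be t : R) : C := (logpow a be * divpow b (logratio1 (be * t) t))%:c * g (be * t).

Lemma scaled_bound : exists2 c : R, 0 <= c & forall be t : R, 0 < be < 1 -> 0 < t < 1 ->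
  normc (scaled be t) <= c * (be `^ (- (1 / 4)) * (1 - t) `^ (- (1 / 4))).
Proof.
have [c c0 Hc] := @divpow_bound0 R a.
have [e e0 He] := logbound1 (@logbound_divpow R b).
exists (c * e * G); first by rewrite !mulr_ge0.
move=> be t /andP[b0 b1] /andP[t0 t1].
have bt0 : 0 < be * t by rewrite mulr_gt0.
have bt : be * t <= t by rewrite ger_pMl// ltW.
have L0 : 0 <= divpow b (logratio1 (be * t) t) by apply/divpow_ge0/logratio1_ge0.
have k0 : 0 <= logpow a be by apply: logpow_ge0; rewrite b0.
have kL0 : 0 <= logpow a be * divpow b (logratio1 (be * t) t) by exact: mulr_ge0.
rewrite /scaled ComplexField.Normc.normcM normc_real ger0_norm//.
rewrite [leRHS]mulrAC; apply: ler_pM; rewrite ?normc_ge0//.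
  rewrite [leRHS]mulrACA; apply: ler_pM => //; first by apply: Hc; rewrite b0 ltW.
  by apply: He => //; exact: ltW.
by apply: gG; rewrite bt0 (le_lt_trans bt).
Qed.

Lemma cmeas_scaled d (T : measurableType d) (D : set T) (p q : T -> R) :
  measurable_fun D p -> measurable_fun D q ->
  (forall x, D x -> 0 < p x < 1 /\ 0 < q x < 1) -> cmeas D (fun x => scaled (p x) (q x)).
Proof.
move=> mp mq pq; have mpq : measurable_fun D (fun x => p x * q x) by exact: measurable_funM.
apply: cmeasM.
  apply: cmeas_real; apply: measurable_funM.
    exact: (measurableT_comp (@measurable_logpow R a) mp).
  exact: (measurableT_comp (@measurable_divpow R b) (measurable_logratio1 mpq mq)).
apply: (cmeas_01_comp cg) => // x /pq[/andP[p0 p1] /andP[q0 q1]].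
by rewrite mulr_gt0//= mulr_ilt1// ltW.
Qed.

Lemma dominated_scaled (t : R) : 0 < t < 1 -> dominated (scaled ^~ t).
Proof.
move=> t01; split.
  apply: cmeas_scaled; [exact: measurable_id|exact: measurable_cst|].
  by move=> x /=; rewrite in_itv.
have [c c0 H] := scaled_bound; exists (c * (1 - t) `^ (- (1 / 4))) => be.
rewrite in_itv/= => be01; apply: le_trans (H be t be01 t01) _.
rewrite mulrCA mulrC; apply: ler_wpM2l; first by rewrite mulr_ge0 ?powR_ge0.
by apply: rho_doml => //; lra.
Qed.

Lemma kernel_int_scale (t : R) : 0 < t < 1 -> kernel_int g a b t = t%:c * int01 (scaled ^~ t).
Proof.
move=> /[dup] t01 /andP[t0 t1].
pose f s := (logkernel a b s t)%:c * g s.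
have PE be : 0 < be < 1 -> f (be * t) * t%:c = t%:c * scaled be t.
  move=> /andP[b0 b1]; rewrite /f /logkernel /scaled /logpow.
  have -> : logratio0 (be * t) t = - ln be by rewrite /logratio0 mulfK// gt_eqF.
  by rewrite [LHS]mulrC.
rewrite -[LHS]/(int01 (trunc t f)).
transitivity (int01 (fun be => f (be * t) * t%:c)).
  apply: esym.
  apply: (@substitution_increasing _ f (fun be => be * t) (fun=> t) t).
  - by rewrite t0 ltW.
  - exact: (dominated_logkernel cg G0 gG t01 (@measurable_divpow R a) (@measurable_divpow R b)
      (@logbound_divpow R a) (@logbound_divpow R b) (@divpow_ge0 R a) (@divpow_ge0 R b)).
  - move=> x /andP[x0 xt]; have x1 := lt_trans xt t1; apply: ccontM; last by apply: cg; rewrite x0.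
    apply: ccont_real; apply: continuousM.
      by apply: (continuous_comp (logratio0_continuous x0 t0)); exact: divpow_continuous.
    have ci : {for x, continuous (fun x : R => x)} by apply: cvg_id.
    have ct : {for x, continuous (fun _ : R => t)} by exact: cst_continuous.
    have c1 := logratio1_continuous ci ct x1 t1.
    by apply: (continuous_comp c1); exact: divpow_continuous.
  - by move=> x /andP[x0 x1]; rewrite mulr_ge0 ?(ltW t0)//= ger_pMl.
  - by move=> x /andP[x0 x1]; rewrite mulr_gt0//= gtr_pMl.
  - move=> x _; have := is_deriveM (@is_derive_id _ _ x (1 : R)) (@is_derive_cst _ _ _ t x (1 : R)).
    move=> H; apply: (@is_derive_eq _ _ _ _ _ _ _ _ H).
    by rewrite /GRing.scale/= mulr0 add0r mulr1.
  - by move=> x _; exact: cst_continuous.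
  - have [[m1 m2] [c cP]] := dominatedZ t%:c (dominated_scaled t01).
    split; last by exists c => x /[dup] xI; rewrite in_itv/= => /PE ->; exact: cP.
    split; [move: m1|move: m2]; apply: eq_measurable_fun => x /[!inE]/=;
      by rewrite in_itv/= => /PE ->.
  - by rewrite mul0r.
  - by rewrite mul1r.
rewrite -int01Z; last exact: dominated_scaled.
by apply: eq_int01 => be; rewrite in_itv/=; exact: PE.
Qed.

Lemma kernel_int_swap : int01 (fun t => kernel_int g a b t / t%:c) = int01 (fun be => int01 (scaled be)).
Proof.
transitivity (int01 (fun t => int01 (scaled ^~ t))).
  apply: eq_int01 => t; rewrite in_itv/= => /[dup] t01 /andP[t0 _].
  by rewrite kernel_int_scale// mulrC mulKf// realc_eq0 gt_eqF.
have [c c0 H] := scaled_bound.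
apply: esym; apply: (@fubini_int01 _ scaled c).
  apply: cmeas_scaled; try (apply: measurable_funTS; first [exact: measurable_fst|exact: measurable_snd]).
  by move=> x /= []; rewrite !in_itv.
move=> s t; rewrite !in_itv/= => s01 t01; apply: (le_trans (H s t s01 t01)).
apply: ler_wpM2l => //; apply: ler_pM; rewrite ?powR_ge0//.
  by apply: rho_doml => //; lra.
by apply: rho_domr => //; lra.
Qed.

(** What the inner integral over t becomes under t = (1 - al)/(1 - al be), the inverse
    of al = (1 - t)/(1 - be t): this makes the second logarithm equal to - ln al. *)
Definition square_inner (be : R) : C := int01 (fun al => (logpow b al)%:c *
  (g (be * ((1 - al) / (1 - al * be))) * ((1 - be) / (1 - al * be) ^+ 2)%:c)).

(** The substitution t = (1 - al)/(1 - al be) decreases from 1 to 0, and its derivative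
    is - (1 - be)/(1 - al be)^2; the two signs cancel. *)
Lemma int01_scaled (be : R) : 0 < be < 1 -> int01 (scaled be) = (logpow a be)%:c * square_inner be.
Proof.
move=> /[dup] be01 /andP[b0 b1].
pose f t := (divpow b (logratio1 (be * t) t))%:c * g (be * t).
pose q al := g (be * ((1 - al) / (1 - al * be))) * ((1 - be) / (1 - al * be) ^+ 2)%:c.
have ab1 (al : R) : 0 <= al <= 1 -> 0 < 1 - be <= 1 - al * be.
  by move=> /andP[al0 al1]; rewrite subr_gt0 b1/= lerD2l lerN2 ger_pMl.
have ab0 (al : R) : 0 <= al <= 1 -> 0 < 1 - al * be.
  by move=> /ab1/andP[]; exact: lt_le_trans.
have sub (al : R) : 0 < al < 1 -> 0 < (1 - al) / (1 - al * be) < 1.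
  move=> /andP[al0 al1]; have d0 : 0 < 1 - al * be by apply: ab0; rewrite !ltW.
  apply/andP; split; first by rewrite divr_gt0// subr_gt0.
  by rewrite ltr_pdivrMr// mul1r ltrD2l ltrN2 gtr_pMr.
have fE (al : R) : 0 < al < 1 ->
    f ((1 - al) / (1 - al * be)) * (- ((1 - be) / (1 - al * be) ^+ 2))%:c =
    - ((logpow b al)%:c * q al).
  move=> /[dup] al01 /andP[al0 al1].
  have d0 : 0 < 1 - al * be by apply: ab0; rewrite !ltW.
  rewrite /f /q realcN mulrN -mulrA; congr (- ((divpow b (- ln _))%:c * _)).
  field; rewrite gt_eqF//=.
  by rewrite (_ : _ - _ - _ = 1 - be) ?gt_eqF ?subr_gt0//; ring.
have mf : cmeas I f.
  apply: cmeasM.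
    apply: cmeas_real; apply: (measurableT_comp (@measurable_divpow R b)).
    by apply: measurable_logratio1 => //; exact: measurable_funM.
  apply: (cmeas_01_comp cg); last exact: measurable_funM.
  by move=> x /=; rewrite in_itv/= => /andP[x0 x1]; rewrite mulr_gt0//= mulr_ilt1// ltW.
have df : dominated f.
  split => //; have [e e0 He] := logbound1 (@logbound_divpow R b).
  exists (e * G) => t; rewrite in_itv/= => /[dup] t01 /andP[t0 t1].
  have bt0 : 0 < be * t by rewrite mulr_gt0.
  have bt : be * t <= t by rewrite ger_pMl// ltW.
  have L0 : 0 <= divpow b (logratio1 (be * t) t) by apply/divpow_ge0/logratio1_ge0.
  rewrite /f ComplexField.Normc.normcM normc_real ger0_norm// [leRHS]mulrAC.
  apply: ler_pM; rewrite ?normc_ge0//; last by apply: gG; rewrite bt0 (le_lt_trans bt).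
  apply: (le_trans (He _ _ (ltW bt0) bt t1)); apply: ler_wpM2l => //.
  by apply: rho_domr => //; lra.
have dq : dominated (fun al => (logpow b al)%:c * q al).
  have mab : measurable_fun I (fun al : R => (1 - al * be)^-1).
    apply: (measurableT_comp (@measurable_invr R)).
    by apply: measurable_funB => //; exact: measurable_funM.
  have msub : measurable_fun I (fun al : R => (1 - al) / (1 - al * be)).
    by apply: measurable_funM => //; exact: measurable_funB.
  split.
    apply: cmeasM.
      by apply: cmeas_real; apply: measurable_funTS; exact: measurable_logpow.
    apply: cmeasM.
      apply: (cmeas_01_comp cg); last exact: measurable_funM.
      move=> x /=; rewrite in_itv/= => /sub/andP[x0 x1].
      by rewrite mulr_gt0//= mulr_ilt1// ltW.
    apply: cmeas_real; apply: measurable_funM => //.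
    rewrite (_ : (fun _ => _) = (fun al => (1 - al * be)^-1 ^+ 2)).
      exact: measurable_funX.
    by apply/funext => x; rewrite exprVn.
  have [c c0 Hc] := @divpow_bound0 R b.
  exists (c * (G * (1 - be)^-1)) => al; rewrite in_itv/= => /[dup] al01 /andP[al0 al1].
  have al01' : 0 <= al <= 1 by rewrite !ltW.
  have /andP[bb0 bb1] := ab1 al al01'; have d0 := ab0 al al01'.
  have q0 : 0 <= (1 - be) / (1 - al * be) ^+ 2 by rewrite divr_ge0 ?exprn_ge0// ltW.
  rewrite !ComplexField.Normc.normcM !normc_real (ger0_norm q0) ger0_norm ?logpow_ge0//.
  rewrite [leRHS]mulrAC; apply: ler_pM; rewrite ?logpow_ge0//.
  - by rewrite mulr_ge0 ?normc_ge0.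
  - apply: (@le_trans _ _ (c * al `^ (- (1 / 4)))); first by apply: Hc; rewrite al0 ltW.
    by apply: ler_wpM2l => //; apply: rho_doml => //; lra.
  - apply: ler_pM; rewrite ?normc_ge0//.
      by apply: gG; have /andP[x0 x1] := sub al al01; rewrite mulr_gt0//= mulr_ilt1// ltW.
    rewrite -[(1 - be)^-1]mulr1 -[X in _ <= _ * X](divff (lt0r_neq0 bb0)) mulrCA.
    apply: ler_wpM2l; first exact: ltW.
    by rewrite -invfM -expr2 lef_pV2 ?posrE ?exprn_gt0// ler_pXn2r// nnegrE ltW.
transitivity (int01 (fun t => (logpow a be)%:c * f t)).
  by congr int01; apply/funext => t; rewrite /scaled /f realcM mulrA.
rewrite int01Z//; congr (_ * _).
have t1f : dominated (trunc 1 f).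
  have fe (x : R) : x < 1 -> trunc 1 f x = f x by rewrite /trunc => ->.
  have [[m1 m2] [c cP]] := df.
  split; last by exists c => x /[dup] xI; rewrite in_itv/= => /andP[_ /fe ->]; exact: cP.
  split; [move: m1|move: m2]; apply: eq_measurable_fun => x /[!inE]/=;
    by rewrite in_itv/= => /andP[_ /fe ->].
rewrite -(int01_trunc1 f); apply: oppr_inj.
transitivity (int01 (fun al => f ((1 - al) / (1 - al * be)) *
    (- ((1 - be) / (1 - al * be) ^+ 2))%:c)).
  apply: esym.
  apply: (@substitution_decreasing _ f (fun al => (1 - al) / (1 - al * be))
    (fun al => - ((1 - be) / (1 - al * be) ^+ 2)) 1).
  - by rewrite ltr01 lexx.
  - exact: t1f.
  - move=> x /andP[x0 x1]; apply: ccontM.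
      apply: ccont_real.
      have c1 := @logratio1_continuous (fun x => be * x) (fun x => x) x.
      apply: (continuous_comp (c1 _ _ _ _)) => //; last exact: divpow_continuous.
        by apply: continuousM => //; exact: cst_continuous.
      by rewrite mulr_ilt1// ltW.
    apply: ccont_comp; first by apply: continuousM => //; exact: cst_continuous.
    by apply: cg; rewrite mulr_gt0//= mulr_ilt1// ltW.
  - move=> x /[dup] x01 /andP[x0 x1]; have d0 := ab0 x x01.
    apply/andP; split; first by apply: divr_ge0; [rewrite subr_ge0|exact: ltW].
    by rewrite ler_pdivrMr// mul1r lerD2l lerN2 ler_piMr// ltW.
  - exact: sub.
  - move=> x x01; have d0 := ab0 x x01.
    have d1 : is_derive x 1 (fun x : R => 1 - x) (-1) by apply: is_derive_eq; ring.
    have d2 : is_derive x 1 (fun x : R => 1 - x * be) (- be).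
      have := is_deriveB (@is_derive_cst _ _ _ (1 : R) x (1 : R))
        (is_deriveM (@is_derive_id _ _ x (1 : R)) (@is_derive_cst _ _ _ be x (1 : R))).
      move=> H; apply: (@is_derive_eq _ _ _ _ _ _ _ _ H).
      by rewrite /GRing.scale/=; ring.
    have := is_deriveM d1 (@is_deriveV _ (fun x => 1 - x * be) x _ _ (lt0r_neq0 d0) d2).
    move=> H; apply: (@is_derive_eq _ _ _ _ _ _ _ _ H).
    by rewrite /GRing.scale/=; field; rewrite gt_eqF.
  - move=> x /andP[x0 x1]; have d0 : 0 < 1 - x * be by apply: ab0; rewrite !ltW.
    have c1 : {for x, continuous (fun x : R => (1 - x * be)^-1)}.
      have c2 : {for x, continuous (fun x : R => 1 - x * be)}.
        apply: continuousB; first exact: cst_continuous.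
        by apply: continuousM => //; exact: cst_continuous.
      by apply: (continuous_comp c2); apply: inv_continuous; rewrite gt_eqF.
    rewrite (_ : (fun _ => _) = (fun x : R => - ((1 - be) * ((1 - x * be)^-1 * (1 - x * be)^-1)))).
      apply: continuousN; apply: continuousM; first exact: cst_continuous.
      exact: continuousM.
    by apply/funext => y; rewrite -invfM expr2.
  - have [[m1 m2] [c cP]] := dominatedZ (-1) dq.
    split; last first.
      exists c => x /[dup] xI; rewrite in_itv/= => /fE ->.
      by rewrite -mulN1r; exact: cP.
    split; [move: m1|move: m2]; apply: eq_measurable_fun => x /[!inE]/=;
      by rewrite in_itv/= => /fE ->; rewrite mulN1r.
  - by rewrite subr0 mul0r subr0 divr1.
  - by rewrite subrr mul0r.
rewrite -[RHS]mulN1r /square_inner -int01Z//; apply: eq_int01 => al; rewrite in_itv/= => /fE ->.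
by rewrite mulN1r.
Qed.

Lemma kernel_int_square : int01 (fun t => kernel_int g a b t / t%:c) = int01 (fun be => (logpow a be)%:c * square_inner be).
Proof. by rewrite kernel_int_swap; apply: eq_int01 => be; rewrite in_itv/= => /int01_scaled. Qed.

End double_integral.

(** * Functions on which iterated integration acts *)

Section iterated.
Variable R : realType.
Local Notation C := R[i].
Local Notation mu := (@lebesgue_measure R).
Local Notation I := (`]0, 1[%classic : set R).
Local Notation normc := (@ComplexField.Normc.normc R).
Local Notation Re := (@complex.Re R).
Local Notation Im := (@complex.Im R).
Local Notation "x %:c" := (real_complex_def (Phant R) x) (at level 1, format "x %:c").

Lemma continuous_eq_oo (f g : R -> R) (x : R) : 0 < x < 1 ->
  (forall y : R, 0 < y < 1 -> f y = g y) -> {for x, continuous f} -> {for x, continuous g}.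
Proof.
move=> x01 fg cf; rewrite /prop_for /continuous_at -(fg _ x01).
apply: cvg_trans cf; apply: near_eq_cvg.
have := @near_in_itvoo R 0 1 x; rewrite in_itv/= => /(_ x01) H.
near=> y; rewrite /= -?fg//; last first.
  by have : y \in `]0, 1[ by near: y.
Unshelve. all: by end_near. Qed.

Lemma ccont_eq_oo (f g : R -> C) (x : R) : 0 < x < 1 ->
  (forall y : R, 0 < y < 1 -> f y = g y) -> ccont f x -> ccont g x.
Proof.
by move=> x01 fg [c1 c2]; split; [move: c1|move: c2]; apply: continuous_eq_oo => // y /fg /= ->.
Qed.

(** A class of functions stable under f -> int_0^x f(t) dt/(t - a) for every letter a.
    The zero at 0 absorbs the pole of e_0; at 1, dividing by 1 - x and integrating
    gives back the exponent -3/4, up to a constant. *)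
Definition tame (f : R -> C) := (forall x : R, 0 < x < 1 -> ccont f x) /\
  exists2 c : R, 0 <= c & forall x : R, 0 < x < 1 -> normc (f x) <= c * (x * (1 - x) `^ (- (3 / 4))).

Lemma tame_eq f g : (forall x : R, 0 < x < 1 -> f x = g x) -> tame f -> tame g.
Proof.
move=> fg [cf [c c0 fc]]; split; first by move=> x x01; apply: (ccont_eq_oo x01 fg); exact: cf.
by exists c => // x x01; rewrite -fg// fc.
Qed.

Lemma ccontD f g (x : R) : ccont f x -> ccont g x -> ccont (fun x => f x + g x : C) x.
Proof.
move=> [f1 f2] [g1 g2]; split.
  rewrite /comp (_ : (fun _ => _) = (fun x => Re (f x) + Re (g x))); first exact: continuousD.
  by apply/funext => y; rewrite cReD.
rewrite /comp (_ : (fun _ => _) = (fun x => Im (f x) + Im (g x))); first exact: continuousD.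
by apply/funext => y; rewrite cImD.
Qed.

Lemma tameD f g : tame f -> tame g -> tame (fun x => f x + g x).
Proof.
move=> [cf [c c0 fc]] [cg [e e0 ge]]; split; first by move=> x x01; apply: ccontD; [exact: cf|exact: cg].
exists (c + e); first exact: addr_ge0.
move=> x x01; rewrite mulrDl (le_trans (le_normcD _ _))//.
by rewrite lerD ?fc ?ge.
Qed.

Lemma tameZ (k : C) f : tame f -> tame (fun x => k * f x).
Proof.
move=> [cf [c c0 fc]]; split.
  by move=> x x01; apply: ccontM; [exact: cder_cont (cder_cst k x)|exact: cf].
exists (normc k * c); first by rewrite mulr_ge0 ?normc_ge0.
move=> x x01; rewrite ComplexField.Normc.normcM -mulrA.
by rewrite ler_wpM2l ?normc_ge0 ?fc.
Qed.

Lemma cmeas_ccont01 f : (forall x : R, 0 < x < 1 -> ccont f x) -> cmeas I f.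
Proof.
move=> cf; apply: cmeas_ccont; first exact: itv_open.
by move=> x /=; rewrite in_itv/=; exact: cf.
Qed.

(** The primitive of (3/4) (1 - x)^(-7/4) that vanishes at 0 is (1 - x)^(-3/4) - 1, and
    it is at most x (1 - x)^(-3/4) because (1 - x)^(1/4) <= 1. *)
Lemma tame_Cintegral (h : R -> C) (c : R) : 0 <= c ->
  (forall x : R, 0 < x < 1 -> ccont h x) ->
  (forall x : R, 0 < x < 1 -> normc (h x) <= c * (1 - x) `^ (- (3 / 4) - 1)) ->
  tame (fun x => Cintegral `]0, x[ h).
Proof.
move=> c0 ch hc.
have mh := cmeas_ccont01 ch.
pose q : R := - (3 / 4).
pose B (x : R) : R := (1 - x) `^ q - 1.
have dB (x : R) : x < 1 -> is_derive x 1 B (3 / 4 * (1 - x) `^ (q - 1)).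
  move=> x1; have x1' : 0 < 1 - x by rewrite subr_gt0.
  have d1 : is_derive x 1 (fun x : R => 1 - x) (-1) by apply: is_derive_eq; ring.
  have d2 := @is_derive1_comp _ (@powR R ^~ q) (fun x => 1 - x) x _ _ (is_derive1_powR q x1') d1.
  have := is_deriveB d2 (@is_derive_cst _ _ _ (1 : R) x (1 : R)).
  move=> H; apply: (@is_derive_eq _ _ _ _ _ _ _ _ H).
  by rewrite subr0 mulrN1 /q mulNr opprK.
have cb (x : R) : x < 1 -> {for x, continuous (fun x : R => 3 / 4 * (1 - x) `^ (q - 1))}.
  move=> x1; have x1' : 0 < 1 - x by rewrite subr_gt0.
  have c1 : {for x, continuous (fun x : R => 1 - x)}.
    by apply: continuousB => //; exact: cst_continuous.
  have c2 : {for 1 - x, continuous (@powR R ^~ (q - 1))}.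
    exact: is_derive_continuous (is_derive1_powR (q - 1) x1').
  apply: continuousM; first exact: cst_continuous.
  exact: continuous_comp c1 c2.
have Ib (x : R) : 0 < x < 1 -> mu.-integrable `]0, x[ (EFin \o (fun x => 3 / 4 * (1 - x) `^ (q - 1))).
  move=> /andP[x0 x1].
  apply: (@integrableS _ _ _ mu `[0, x]) => //; first exact: subset_itv_oo_cc.
  apply: continuous_compact_integrable; first exact: segment_compact.
  apply: continuous_in_subspaceT => y /[!inE]/=; rewrite in_itv/= => /andP[_ yx].
  by apply: cb; exact: le_lt_trans x1.
(* B is the primitive, vanishing at 0, of the majorant. *)
have intB (x : R) : 0 < x < 1 -> \int[mu]_(t in `]0, x[) (3 / 4 * (1 - t) `^ (q - 1)) = B x.
  move=> /[dup] x01 /andP[x0 x1].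
  have yx1 (y : R) : y \in `[0, x] -> y < 1.
    by rewrite in_itv/= => /andP[_]; move/le_lt_trans; apply.
  transitivity (B x - B 0); last by rewrite /B subr0 powR1 subrr subr0.
  apply: FTC_oo; [exact: ltW|exact: Ib|..].
  - by move=> y /subset_itv_oo_cc /yx1; exact: cb.
  - apply: continuous_in_subspaceT => y /[!inE]/= /yx1 /dB.
    exact: is_derive_continuous.
  - by move=> y /subset_itv_oo_cc /yx1; exact: dB.
have Bx (x : R) : 0 < x < 1 -> B x <= x * (1 - x) `^ q.
  move=> /andP[x0 x1]; have x1' : 0 < 1 - x by rewrite subr_gt0.
  suff : (1 - x) * (1 - x) `^ q <= 1 by rewrite /B; lra.
  rewrite -{1}(powRr1 (ltW x1')) -powRD; last by apply/implyP => _; rewrite gt_eqF.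
  rewrite -[leRHS](powRr0 (1 - x)); apply: ger_powR; first by apply/andP; lra.
  by rewrite /q; lra.
(* The factor 4/3 compensates the derivative 3/4 of B. *)
pose e := 4 / 3 * c.
have e0 : 0 <= e by rewrite /e; lra.
have key (k : C -> R) : (forall w, `|k w| <= normc w) -> measurable_fun I (k \o h) ->
    (forall x : R, 0 < x < 1 -> {for x, continuous (k \o h)}) ->
    [/\ forall x : R, 0 < x < 1 -> mu.-integrable `]0, x[ (EFin \o (k \o h)),
       forall x : R, 0 < x < 1 -> {for x, continuous (fun x : R => \int[mu]_(t in `]0, x[) k (h t) : R)}
     & forall x : R, 0 < x < 1 -> `|\int[mu]_(t in `]0, x[) k (h t)| <= e * (x * (1 - x) `^ q)].
  move=> kle mk ck.
  have sub (x : R) : 0 < x < 1 -> `]0, x[ `<=` I.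
    move=> /andP[_ x1] y /=; rewrite !in_itv/= => /andP[-> yx].
    exact: lt_trans x1.
  have kb (y : R) : 0 < y < 1 -> `|k (h y)| <= e * (3 / 4 * (1 - y) `^ (q - 1)).
    move=> y01; apply: (le_trans (kle _)); apply: (le_trans (hc y y01)).
    by rewrite mulrA (_ : e * (3 / 4) = c)//; rewrite /e; lra.
  have Ik (x : R) : 0 < x < 1 -> mu.-integrable `]0, x[ (EFin \o (k \o h)).
    move=> x01.
    apply: (@le_integrable _ _ _ mu _ _ _
       (EFin \o (fun y => e * (3 / 4 * (1 - y) `^ (q - 1))))) => //.
    - by apply/measurable_EFinP; apply: measurable_funS mk => //; exact: sub.
    - move=> y /(sub _ x01) /=; rewrite in_itv/= => y01.
      by rewrite lee_fin (le_trans (kb _ y01))// ler_norm.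
    - by have := integrableZl _ e (Ib _ x01); move=> H; exact: H.
  split => //.
  - move=> x /[dup] x01 /andP[x0 x1]; pose y := (x + 1) / 2.
    have xy : x < y by rewrite /y; lra.
    have y01 : 0 < y < 1 by rewrite /y; apply/andP; lra.
    have ck' : {in `]0, y[, continuous (k \o h)}.
      by move=> t /(sub _ y01); rewrite /= in_itv/=; exact: ck.
    have [_ dP _ _] := indef_integralP (ltW (lt_trans x0 xy)) (Ik _ y01) ck'.
    have /dP/is_derive_continuous : x \in `]0, y[ by rewrite in_itv/= x0.
    apply: continuous_eq_oo => // t t01.
    by rewrite -Rintegral_oo_cc//; exact: Ik.
  - move=> x x01; apply: (le_trans (le_normr_Rintegral _ (Ik _ x01))) => //.
    apply: (@le_trans _ _ (\int[mu]_(t in `]0, x[) (e * (3 / 4 * (1 - t) `^ (q - 1))))).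
      apply: le_Rintegral => //.
      + apply: (@le_integrable _ _ _ mu _ _ _ (EFin \o (k \o h))) => //; last exact: Ik.
          apply/measurable_EFinP; apply: measurableT_comp => //.
          by apply: measurable_funS mk => //; exact: sub.
        by move=> y _ /=; rewrite lee_fin normr_id.
      + by have := integrableZl _ e (Ib _ x01); move=> H; exact: H.
      + by move=> y /(sub _ x01) /=; rewrite in_itv/=; exact: kb.
    by rewrite RintegralZl ?intB//; [exact: ler_wpM2l (Bx _ x01)|exact: Ib].
have [_ c1 b1] := key Re (@normRe R) mh.1 (fun x x01 => (ch x x01).1).
have [_ c2 b2] := key Im (@normIm R) mh.2 (fun x x01 => (ch x x01).2).
split; first by move=> x x01; split; [exact: c1|exact: c2].
exists (e + e); first exact: addr_ge0.
move=> x x01; apply: (le_trans (normc_le _)); rewrite mulrDl.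
by apply: lerD; [exact: b1|exact: b2].
Qed.

End iterated.

(** * Integration against the form of a letter *)

Section operators.
Variable R : realType.
Local Notation C := R[i].
Local Notation I := (`]0, 1[%classic : set R).
Local Notation normc := (@ComplexField.Normc.normc R).
Local Notation Re := (@complex.Re R).
Local Notation Im := (@complex.Im R).
Local Notation "x %:c" := (real_complex_def (Phant R) x) (at level 1, format "x %:c").
Variable z : C.
Hypothesis hz : forall t : R, 0 <= t <= 1 -> z <> t%:c.

(** Compactness of the segment. *)
Lemma dist_segment : exists2 d : R, 0 < d & forall t : R, 0 <= t <= 1 -> d <= normc (t%:c - z).
Proof.
pose p (t : R) := (t - Re z) ^+ 2 + Im z ^+ 2.
have np (t : R) : normc (t%:c - z) = Num.sqrt (p t).
  by rewrite /p; case: z => x y /=; rewrite add0r sqrrN.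
have cp : {within `[0, 1], continuous p}.
  apply: continuous_subspaceT => t.
  have c1 : {for t, continuous (fun t : R => t - Re z)}.
    by apply: continuousB => //; exact: cst_continuous.
  have c2 : {for t, continuous (fun t : R => (t - Re z) * (t - Re z) + Im z ^+ 2)}.
    by apply: continuousD; [exact: continuousM|exact: cst_continuous].
  exact: c2.
have [c c01 cmin] := EVT_min (ler01 : 0 <= 1 :> R) cp.
exists (Num.sqrt (p c)).
  rewrite -np normc_gt0 subr_eq0 eq_sym; apply/eqP; apply: hz.
  by move: c01; rewrite in_itv.
move=> t t01; rewrite np ler_sqrt; first by apply: cmin; rewrite in_itv.
by rewrite addr_ge0 ?sqr_ge0.
Qed.

Definition lform (a : letter) (t : R) : C := (t%:c - letter_val z a)^-1.

(** One step of the iterated integral: appending the letter a to a word. *)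
Definition primitive (a : letter) (f : R -> C) (x : R) : C :=
  Cintegral `]0, x[ (fun t => f t / (t%:c - letter_val z a)).

Lemma iterint_rcons w a : iterint z (rcons w a) = primitive a (iterint z w).
Proof. by rewrite /iterint -cats1 foldl_cat. Qed.

Lemma lform_den_neq0 a (t : R) : 0 < t < 1 -> t%:c - letter_val z a != 0.
Proof.
move=> /andP[t0 t1]; rewrite subr_eq0; case: a => /=.
- by rewrite realc_eq0 gt_eqF.
- by rewrite -(realc1 R) -subr_eq0 -realcB realc_eq0 subr_eq0 lt_eqF.
- by rewrite eq_sym; apply/eqP/hz; rewrite !ltW.
Qed.

Lemma ccont_lform a (t : R) : 0 < t < 1 -> ccont (lform a) t.
Proof.
move=> t01; apply: cder_cont.
apply: (@cderV _ (fun t => t%:c - letter_val z a) _ _ (lform_den_neq0 a t01)).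
exact: cderD (cder_id t) (cder_cst _ t).
Qed.

Lemma lform_bound0 a : a != l1 -> exists2 c : R, 0 <= c & forall t : R, 0 < t < 1 ->
  normc (lform a t) <= c / t.
Proof.
move=> aP; have [d d0 dz] := dist_segment.
exists (1 + d^-1); first by rewrite addr_ge0// invr_ge0 ltW.
move=> t /[dup] t01 /andP[t0 t1]; rewrite /lform ComplexField.Normc.normcV.
case: a aP => [_|//|_]; rewrite /letter_val.
  rewrite subr0 normc_real gtr0_norm// mulrDl mul1r lerDl mulr_ge0// invr_ge0 ltW//.
apply: (@le_trans _ _ d^-1).
  rewrite lef_pV2 ?posrE// ?(lt_le_trans d0) ?dz// ?(ltW t0) ?(ltW t1)//.
rewrite mulrDl -[leLHS]add0r lerD// ?divr_ge0 ?(ltW t0)//.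
by rewrite ler_peMr ?invr_ge0 ?(ltW d0)// invf_ge1// ltW.
Qed.

Lemma lform_bound1 a : a != l0 -> exists2 c : R, 0 <= c & forall t : R, 0 < t < 1 ->
  normc (lform a t) <= c / (1 - t).
Proof.
move=> aP; have [d d0 dz] := dist_segment.
exists (1 + d^-1); first by rewrite addr_ge0// invr_ge0 ltW.
move=> t /[dup] t01 /andP[t0 t1]; rewrite /lform ComplexField.Normc.normcV.
have t1' : 0 < 1 - t by rewrite subr_gt0.
case: a aP => [//|_|_]; rewrite /letter_val.
  rewrite -(realc1 R) -realcB normc_real distrC gtr0_norm//.
  by rewrite mulrDl mul1r lerDl mulr_ge0// invr_ge0 ltW.
apply: (@le_trans _ _ d^-1).
  rewrite lef_pV2 ?posrE// ?(lt_le_trans d0) ?dz// ?(ltW t0) ?(ltW t1)//.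
rewrite mulrDl -[leLHS]add0r lerD// ?divr_ge0 ?(ltW t1')//.
by rewrite ler_peMr ?invr_ge0 ?(ltW d0)// invf_ge1//; lra.
Qed.

Lemma lform_bound a : exists2 c : R, 0 <= c & forall t : R, 0 < t < 1 ->
  normc (lform a t) <= c / (t * (1 - t)).
Proof.
have [->|a0] := eqVneq a l0.
  have [//|c c0 H] := @lform_bound0 l0; exists c => // t /[dup] t01 /andP[t0 t1].
  apply: le_trans (H t t01) _; apply: ler_wpM2l => //.
  have t1' : 0 < 1 - t by rewrite subr_gt0.
  by rewrite lef_pV2 ?posrE ?mulr_gt0// ler_piMr ?(ltW t0)//; lra.
have [c c0 H] := lform_bound1 a0; exists c => // t /[dup] t01 /andP[t0 t1].
apply: le_trans (H t t01) _; apply: ler_wpM2l => //.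
have t1' : 0 < 1 - t by rewrite subr_gt0.
by rewrite lef_pV2 ?posrE ?mulr_gt0// ler_piMl ?(ltW t1') ?(ltW t1).
Qed.

Lemma powR_onem_div (t : R) : t < 1 -> (1 - t) `^ (- (3 / 4)) / (1 - t) = (1 - t) `^ (- (3 / 4) - 1).
Proof.
move=> t1; have t1' : 0 < 1 - t by rewrite subr_gt0.
rewrite -(powR_inv1 (ltW t1')) -powRD//; apply/implyP => _; by rewrite gt_eqF.
Qed.

Lemma tame_letter a : a != l0 -> tame (primitive a (fun=> 1)).
Proof.
move=> a0; have [c c0 H] := lform_bound1 a0.
apply: (tame_Cintegral c0).
  by move=> x x01; apply: ccontM; [exact: cder_cont (cder_cst 1 x)|exact: ccont_lform].
move=> x /[dup] x01 /andP[x0 x1]; rewrite mul1r (le_trans (H x x01))// ler_wpM2l//.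
rewrite -powR_onem_div// ler_peMl//; first by rewrite invr_ge0 subr_ge0 ltW.
by apply: powRN_ge1; [lra|apply/andP; lra].
Qed.

Lemma tame_primitive a f : tame f -> tame (primitive a f).
Proof.
move=> [cf [c c0 fc]]; have [e e0 H] := lform_bound a.
apply: (@tame_Cintegral _ _ (c * e)); first exact: mulr_ge0.
  by move=> x x01; apply: ccontM; [exact: cf|exact: ccont_lform].
move=> x /[dup] x01 /andP[x0 x1]; rewrite ComplexField.Normc.normcM.
have x1' : 0 < 1 - x by rewrite subr_gt0.
apply: (@le_trans _ _ ((c * (x * (1 - x) `^ (- (3 / 4)))) * (e / (x * (1 - x))))).
  by apply: ler_pM; rewrite ?normc_ge0//; [exact: fc|exact: H].
rewrite -powR_onem_div// le_eqVlt; apply/orP; left; apply/eqP.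
by field; apply/andP; rewrite !gt_eqF.
Qed.

(** At x = 1 the pole of e_1 is not integrable against a tame function; this is the
    condition a_n <> 1 on convergent words. *)
Definition fits (a : letter) (x : R) := (0 <= x <= 1) && ((x < 1) || (a != l1)).

Lemma primitive_int01 a f x : 0 <= x <= 1 -> primitive a f x = int01 (trunc x (fun t => f t * lform a t)).
Proof. by move=> x01; rewrite /primitive Cintegral_trunc. Qed.

Lemma dominated_tame a f x : fits a x -> tame f -> dominated (trunc x (fun t => f t * lform a t)).
Proof.
move=> /andP[/andP[x0 x1] xa] [cf [c c0 fc]].
have mfk : cmeas I (fun t => f t * lform a t).
  by apply: cmeas_ccont01 => t t01; apply: ccontM; [exact: cf|exact: ccont_lform].
split.
  rewrite /trunc; apply: cmeas_if => //; last exact: cmeas_cst.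
  by apply: measurable_fun_ltr => //; exact: measurable_cst.
have [e e0 H] : exists2 e : R, 0 <= e & forall t : R, 0 < t < 1 -> t < x ->
    normc (lform a t) <= e / t.
  case/orP: xa => [x1'|a1]; last first.
    by have [e e0 H] := lform_bound0 a1; exists e => // t t01 _; exact: H.
  have [e e0 H] := lform_bound a; exists (e / (1 - x)); first by rewrite divr_ge0// subr_ge0.
  move=> t /[dup] t01 /andP[t0 t1] tx; apply: le_trans (H t t01) _.
  rewrite -mulrA; apply: ler_wpM2l => //; rewrite -invfM.
  rewrite lef_pV2 ?posrE ?mulr_gt0 ?subr_gt0// mulrC ler_wpM2l ?(ltW t0)//.
  by rewrite lerD2l lerN2 ltW.
exists (c * e) => t; rewrite in_itv/= => /[dup] t01 /andP[t0 t1]; rewrite /trunc.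
have r0 := rho_ge0 t.
case: ifPn => tx; last first.
  by rewrite ComplexField.Normc.normc0; apply: mulr_ge0 => //; exact: mulr_ge0.
rewrite ComplexField.Normc.normcM.
apply: (@le_trans _ _ ((c * (t * (1 - t) `^ (- (3 / 4)))) * (e / t))).
  by apply: ler_pM; rewrite ?normc_ge0//; [exact: fc|exact: H].
rewrite [leLHS](_ : _ = c * e * (1 - t) `^ (- (3 / 4))); last by field; rewrite gt_eqF.
by apply: ler_wpM2l; [exact: mulr_ge0|apply: rho_domr].
Qed.

Lemma eq_primitive a f g x : x <= 1 -> (forall t : R, 0 < t < 1 -> f t = g t) -> primitive a f x = primitive a g x.
Proof.
move=> x1 fg; rewrite /primitive /Cintegral; congr Complex; apply: eq_Rintegral => t;
  rewrite inE/= in_itv/= => /andP[t0 tx]; rewrite fg// t0 (lt_le_trans tx)//.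
Qed.

Lemma primitiveD a f g x : fits a x -> tame f -> tame g ->
  primitive a (fun t => f t + g t) x = primitive a f x + primitive a g x.
Proof.
move=> /[dup] fx /andP[x01 _] Ff Fg; rewrite !primitive_int01// -int01D; [|exact: dominated_tame..].
congr int01; apply/funext => t; rewrite /trunc; case: ifP => _; last by rewrite addr0.
by rewrite mulrDl.
Qed.

Lemma primitiveZ a k f x : fits a x -> tame f -> primitive a (fun t => k * f t) x = k * primitive a f x.
Proof.
move=> /[dup] fx /andP[x01 _] Ff; rewrite !primitive_int01// -int01Z; last exact: dominated_tame.
congr int01; apply/funext => t; rewrite /trunc; case: ifP => _; last by rewrite mulr0.
by rewrite mulrA.
Qed.

Lemma fits_lt a x : 0 <= x < 1 -> fits a x.
Proof. by move=> /andP[x0 x1]; rewrite /fits x0 (ltW x1) x1. Qed.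

Lemma fits1 a : a != l1 -> fits a 1.
Proof. by move=> a1; rewrite /fits ler01 lexx a1 orbT. Qed.

(** A trailing block of n + 1 letters e_0 integrates dt_0/t_0 ... dt_n/t_n over
    s < t_0 < ... < t_n < 1 in all variables but the first: this is
    (- ln s)^n / n! ds/s. *)
Lemma iter_primitive0 n f : tame f ->
  iter n.+1 (primitive l0) f 1 = int01 (fun s => (logpow n s)%:c * (f s / s%:c)).
Proof.
elim: n f => [|n IH] f Ff.
  rewrite /= primitive_int01 ?ler01 ?lexx// int01_trunc1; congr int01; apply/funext => s.
  by rewrite /logpow /divpow expr0 fact0 divr1 realc1 mul1r /lform subr0.
rewrite iterSr IH; last exact: tame_primitive.
pose G t := trunc t (fun s => (logpow n t / t)%:c * (f s / s%:c)).
transitivity (int01 (fun t => int01 (G t))).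
  apply: eq_int01 => t; rewrite in_itv/= => /[dup] t01 /andP[t0 t1].
  rewrite primitive_int01 ?(ltW t0) ?(ltW t1)//.
  transitivity ((logpow n t / t)%:c * int01 (trunc t (fun s => f s * lform l0 s))).
    by rewrite (realcM (logpow n t)) realcV -[RHS]mulrA [X in _ = _ * X]mulrC.
  rewrite -int01Z; last first.
    by apply: dominated_tame => //; apply: fits_lt; rewrite ltW.
  congr int01; apply/funext => s; rewrite /G /trunc; case: ifP => // _; last by rewrite mulr0.
  by rewrite /lform subr0.
have [cf [c c0 fc]] := Ff.
have [K K0 HK] := @divpow_bound0 R n.
have fs (s : R) : 0 < s < 1 -> normc (f s / s%:c) <= c * (1 - s) `^ (- (3 / 4)).
  move=> /[dup] s01 /andP[s0 s1]; rewrite ComplexField.Normc.normcM ComplexField.Normc.normcV.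
  rewrite normc_real gtr0_norm// ler_pdivrMr//; apply: (le_trans (fc s s01)).
  by rewrite le_eqVlt; apply/orP; left; apply/eqP; ring.
rewrite (@fubini_int01 _ G (K * c)).
- apply: eq_int01 => s; rewrite in_itv/= => /[dup] s01 /andP[s0 s1].
  rewrite (logpowS_integral _ _ s01); apply: eq_int01 => t; rewrite in_itv/= => /andP[t0 t1].
  by rewrite /G /trunc /window t1 andbT.
- rewrite /G /trunc; apply: cmeas_if; first exact: measurable_square.
  + apply: measurable_fun_ltr; apply: measurable_funTS;
      first [exact: measurable_fst|exact: measurable_snd].
  + have m1 : measurable_fun (I `*` I) (fun p : R * R => p.1).
      by apply: measurable_funTS; exact: measurable_fst.
    have m2 : measurable_fun (I `*` I) (fun p : R * R => p.2).
      by apply: measurable_funTS; exact: measurable_snd.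
    apply: cmeasM.
      apply: cmeas_real; apply: measurable_funM.
        exact: (measurableT_comp (@measurable_logpow R n) m1).
      exact: (measurableT_comp (@measurable_invr R) m1).
    apply: cmeasM; last by apply: cmeasV; exact: cmeas_real.
    apply: (cmeas_comp (E := I) (f := f)) => //; last exact: cmeas_ccont01.
    by move=> _ [p [_ p2] <-].
  + exact: cmeas_cst.
- move=> t s; rewrite !in_itv/= => /[dup] t01 /andP[t0 t1] /[dup] s01 /andP[s0 s1].
  have rr : 0 <= rho t * rho s by apply: mulr_ge0; exact: rho_ge0.
  rewrite /G /trunc; case: ifPn => st; last first.
    by rewrite ComplexField.Normc.normc0; apply: mulr_ge0 => //; exact: mulr_ge0.
  have k0 : 0 <= logpow n t / t by apply: divr_ge0; [exact: logpow_ge0|exact: ltW].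
  rewrite ComplexField.Normc.normcM normc_real ger0_norm//.
  apply: (@le_trans _ _ ((K * t `^ (- (1 / 4)) / t) * (c * (1 - s) `^ (- (3 / 4))))).
    apply: ler_pM; rewrite ?normc_ge0//; last exact: fs.
    apply: ler_wpM2r; first by rewrite invr_ge0 ltW.
    by apply: HK; rewrite t0 ltW.
  have -> : K * t `^ (- (1 / 4)) / t = K * (t `^ (- (3 / 4)) * t `^ (- (1 / 2))).
    rewrite -[LHS]mulrA -(powR_inv1 (ltW t0)) -!powRD;
      try by apply/implyP => _; rewrite gt_eqF.
    by congr (_ * _ `^ _); lra.
  rewrite [leLHS](_ : _ = K * c * (t `^ (- (3 / 4)) * (t `^ (- (1 / 2)) * (1 - s) `^ (- (3 / 4))))); last by ring.
  apply: ler_wpM2l; first exact: mulr_ge0.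
  apply: ler_pM; rewrite ?mulr_ge0 ?powR_ge0//; first exact: rho_doml.
  apply: (@le_trans _ _ (s `^ (- (1 / 2)) * (1 - s) `^ (- (3 / 4)))).
    by apply: ler_wpM2r; [exact: powR_ge0|apply: powRN_anti => //; exact: ltW].
  by apply: rho_dom => //; lra.
Qed.

End operators.

(** * Words and the functions that they realize *)

Section words.
Variable R : realType.
Local Notation C := R[i].
Variable z : C.
Hypothesis hz : forall t : R, 0 <= t <= 1 -> z <> t%:C%C.

Definition word (w : seq letter) : ncpoly := monalg.mkmalgU (monalg.FMonom w) 1.

Lemma e_word a : e_ a = word [:: a].
Proof. by rewrite /e_ /word monalg.fmuE. Qed.

Lemma word_rcons w a : word w * e_ a = word (rcons w a).
Proof.
rewrite e_word /word monalg.malgM_def monalg.fgmulUU mulr1 -cats1.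
by congr monalg.mkmalgU; rewrite /monalg.mmul/= monalg.fmmulE.
Qed.

Lemma L_additive : {morph L z : p q / p + q}.
Proof. by move=> p q; rewrite /L (@monalg.mmapD _ _ _ (ratr : {additive rat -> C})). Qed.

Lemma L_word w : L z (word w) = if convergent w then I01 z w else 0.
Proof.
rewrite /L /word (@monalg.mmapU _ _ _ (ratr : {additive rat -> C})).
have r1 : (ratr (1 : rat) : C) = 1 by exact: ratr_nat 1%N.
by rewrite /= r1 mul1r.
Qed.

Lemma L_opp p : L z (- p) = - L z p.
Proof. by rewrite /L (@monalg.mmapN _ _ _ (ratr : {additive rat -> C})). Qed.

(** Words whose integral converges up to any x < 1; only the last letter decides
    about x = 1. The empty word is left out because the constant 1 is not tame. *)
Definition left_convergent (w : seq letter) := if w is a :: _ then a != l0 else false.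

(** p realizes f if f is the linear combination of iterated integrals prescribed by p,
    on ]0, 1[. A relation spares the definition of a linear map on noncommutative
    polynomials by a formula for its coefficients; it is stable under linear
    combinations and, by [realizes_mul], under right multiplication by letters. *)
Inductive realizes : ncpoly -> (R -> C) -> Prop :=
| realizes_word w : left_convergent w -> realizes (word w) (iterint z w)
| realizesD p q f g : realizes p f -> realizes q g -> realizes (p + q) (fun x => f x + g x)
| realizesN p f : realizes p f -> realizes (- p) (fun x => (-1) * f x)
| realizes_eq p f g : realizes p f -> (forall x : R, 0 < x < 1 -> f x = g x) -> realizes p g.

Lemma realizes_tame p f : realizes p f -> tame f.
Proof.
elim=> {p f} [w|p q f g _ Ff _ Fg|p f _ Ff|p f g _ Ff fg].
- elim/last_ind: w => // w a IH; rewrite iterint_rcons.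
  case: w IH => [_|b w IH bw]; first exact: tame_letter.
  by apply: tame_primitive => //; exact: IH.
- exact: tameD.
- exact: tameZ.
- exact: tame_eq fg Ff.
Qed.

Lemma left_convergent_rcons w a : left_convergent w -> left_convergent (rcons w a).
Proof. by case: w. Qed.

Lemma realizes_mul p f a : realizes p f -> realizes (p * e_ a) (primitive z a f).
Proof.
elim=> {p f} [w gw|p q f g pf IHf qg IHg|p f pf IHf|p f g pf IHf fg].
- rewrite word_rcons -iterint_rcons; apply: realizes_word; exact: left_convergent_rcons.
- rewrite mulrDl; apply: realizes_eq (realizesD IHf IHg) _ => x /andP[x0 x1].
  by rewrite primitiveD//; [apply: fits_lt; rewrite ltW|exact: realizes_tame pf|exact: realizes_tame qg].
- rewrite mulNr; apply: realizes_eq (realizesN IHf) _ => x /andP[x0 x1].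
  by rewrite primitiveZ//; [apply: fits_lt; rewrite ltW|exact: realizes_tame pf].
- by apply: realizes_eq IHf _ => x /andP[x0 x1]; apply: eq_primitive => //; exact: ltW.
Qed.

(** The last letter brings the value at x = 1, where L is evaluated. *)
Lemma realizes_L p f a : realizes p f -> a != l1 -> L z (p * e_ a) = primitive z a f 1.
Proof.
move=> + a1; elim=> {p f} [w gw|p q f g pf IHf qg IHg|p f pf IHf|p f g pf IHf fg].
- rewrite word_rcons L_word -iterint_rcons.
  by case: w gw => //= b w b0; rewrite b0 /= last_rcons a1.
- rewrite mulrDl L_additive IHf IHg primitiveD//; [exact: fits1|exact: realizes_tame pf|exact: realizes_tame qg].
- by rewrite mulNr L_opp IHf primitiveZ ?mulN1r//; [exact: fits1|exact: realizes_tame pf].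
- by rewrite IHf; apply: eq_primitive.
Qed.

Lemma realizes_L_e0 p f n : realizes p f ->
  L z (p * e_ l0 ^+ n.+1) = int01 (fun s => (logpow n s)%:C%C * (f s / s%:C%C)).
Proof.
move=> pf; rewrite -(iter_primitive0 hz)//; last exact: realizes_tame pf.
elim: n p f pf => [|n IH] p f pf; first by rewrite expr1; exact: realizes_L.
by rewrite exprS mulrA iterSr; apply: IH; exact: realizes_mul.
Qed.

Lemma z_neq0 : z != 0.
Proof. by apply/eqP; apply: (@hz 0); rewrite lexx ler01. Qed.

Local Notation normc := (@ComplexField.Normc.normc R).

(** For w = 1/z this is the distance from z to the segment, rescaled. *)
Lemma one_sub_ge (w : C) : w = z^-1 \/ w = 0 ->
  exists2 d : R, 0 < d & forall t : R, 0 <= t <= 1 -> d <= normc (1 - t%:C%C * w).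
Proof.
case=> ->; last first.
  exists 1 => // t _; rewrite mulr0 subr0.
  by rewrite (_ : (1 : C) = (1 : R)%:C%C)// normc_real normr1.
have [d d0 dz] := dist_segment hz; have z0 := z_neq0.
have nz : 0 < normc z by rewrite normc_gt0.
exists (d / normc z); first exact: divr_gt0.
move=> t t01; rewrite ler_pdivrMr// -ComplexField.Normc.normcM.
rewrite mulrBl mul1r mulfVK// (le_trans (dz t t01))//.
by rewrite -opprB normcN.
Qed.

Local Notation "x %:c" := (real_complex_def (Phant R) x) (at level 1, format "x %:c").

(** The form of a letter placed at 1/w, that is 1/(t - 1/w), written so that it is 0
    for w = 0: the letter at infinity has no form. *)
Definition wform (w : C) (t : R) : C := - w / (1 - t%:c * w).

(** Meant for two cases: e is the letter e_z, with w = 1/z, or e = 0 and w = 0. Words in e_1 - e and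
    e_0 - e then give both terms on the right of the theorem from a single
    computation with the parameter w. *)
Definition represents (e : ncpoly) (w : C) :=
  realizes (e_ l1 - e) (fun x => int01 (trunc x (fun t => lform z l1 t - wform w t))) /\
  forall p f, realizes p f ->
    realizes (p * (e_ l0 - e)) (fun x => int01 (trunc x (fun t => f t * (lform z l0 t - wform w t)))) /\
    L z (p * (e_ l0 - e)) = int01 (fun t => f t * (lform z l0 t - wform w t)).

Lemma lform_z (t : R) : 0 < t < 1 -> lform z lz t = wform z^-1 t.
Proof.
move=> t01; have z0 := z_neq0; have := @lform_den_neq0 _ _ hz lz t t01; rewrite /lform /wform /=.
move=> tz; field; rewrite z0 /=; apply/andP; split; last exact: tz.
by rewrite -oppr_eq0 opprB; exact: tz.
Qed.

Lemma dominated_letter a x : a != l0 -> 0 < x < 1 -> dominated (trunc x (lform z a)).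
Proof.
move=> a0 /andP[x0 x1]; have [c c0 H] := lform_bound1 hz a0.
have mk : cmeas (`]0, 1[%classic : set R) (lform z a).
  by apply: cmeas_ccont01 => t t01; exact: (ccont_lform hz).
split.
  rewrite /trunc; apply: cmeas_if => //; last exact: cmeas_cst.
  by apply: measurable_fun_ltr => //; exact: measurable_cst.
exists (c / (1 - x)) => t; rewrite in_itv/= => /[dup] t01 /andP[t0 t1].
have x1' : 0 < 1 - x by rewrite subr_gt0.
have c1 : 0 <= c / (1 - x) by rewrite divr_ge0// ltW.
rewrite /trunc; case: ifPn => tx; last first.
  by rewrite ComplexField.Normc.normc0; apply: mulr_ge0 => //; exact: rho_ge0.
apply: (@le_trans _ _ (c / (1 - x))); last by rewrite ler_peMr// rho_ge1.
apply: le_trans (H t t01) _; apply: ler_wpM2l => //.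
by rewrite lef_pV2 ?posrE ?subr_gt0// lerD2l lerN2 ltW.
Qed.

Lemma iterint1 a x : 0 < x < 1 -> iterint z [:: a] x = int01 (trunc x (lform z a)).
Proof.
move=> /andP[x0 x1]; rewrite (iterint_rcons z [::] a) (@primitive_int01 _ z) ?(ltW x0) ?(ltW x1)//.
by congr int01; congr trunc; apply/funext => t; rewrite mul1r.
Qed.

Lemma represents_z : represents (e_ lz) z^-1.
Proof.
split.
  rewrite !e_word; apply: realizes_eq.
    exact: realizesD (@realizes_word [:: l1] isT) (realizesN (@realizes_word [:: lz] isT)).
  move=> x x01; transitivity (iterint z [:: l1] x + (-1) * iterint z [:: lz] x); first by [].
  rewrite !iterint1// mulN1r -int01B; [|exact: dominated_letter..].
  apply: eq_int01 => t; rewrite in_itv/= => t01; rewrite /trunc; case: ifP => _; last by rewrite subr0.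
  by rewrite lform_z.
move=> p f pf; have Ff := realizes_tame pf.
have key x : fits l0 x -> fits lz x -> 0 <= x <= 1 -> primitive z l0 f x - primitive z lz f x =
    int01 (trunc x (fun t => f t * (lform z l0 t - wform z^-1 t))).
  move=> f0 fz x01; rewrite !primitive_int01// -int01B; [|exact: dominated_tame..].
  apply: eq_int01 => t; rewrite in_itv/= => t01; rewrite /trunc; case: ifP => _; last by rewrite subr0.
  by rewrite -lform_z// mulrBr.
rewrite mulrBr; split.
  apply: realizes_eq (realizesD (realizes_mul l0 pf) (realizesN (realizes_mul lz pf))) _.
  by move=> x /andP[x0 x1]; rewrite mulN1r key// ?fits_lt ?(ltW x0) ?(ltW x1).
rewrite L_additive L_opp !(realizes_L pf)// key ?fits1 ?ler01 ?lexx//.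
exact: int01_trunc1.
Qed.

Lemma wform0 (t : R) : wform 0 t = 0.
Proof. by rewrite /wform oppr0 mul0r. Qed.

Lemma represents_0 : represents 0 0.
Proof.
split.
  rewrite subr0 e_word; apply: realizes_eq; first exact: (@realizes_word [:: l1] isT).
  move=> x x01; rewrite !iterint1//; congr int01; congr trunc; apply/funext => t.
  by rewrite wform0 subr0.
move=> p f pf; rewrite subr0; split.
  apply: realizes_eq (realizes_mul l0 pf) _ => x /andP[x0 x1].
  rewrite primitive_int01 ?(ltW x0) ?(ltW x1)//; congr int01; congr trunc; apply/funext => t.
  by rewrite wform0 subr0.
rewrite (realizes_L pf)// primitive_int01 ?ler01 ?lexx// int01_trunc1; congr int01; apply/funext => t.
by rewrite wform0 subr0.
Qed.

Section identification.
Variables (w : C) (d : R) (e : ncpoly).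
Hypothesis d0 : 0 < d.
Hypothesis hd : forall t : R, 0 <= t <= 1 -> d <= normc (1 - t%:c * w).
Hypothesis ew : represents e w.

Lemma lform1_sub (t : R) : 0 < t < 1 ->
  lform z l1 t - wform w t = - ((1 - w) / ((1 - t%:c * w) * (1 - t%:c))).
Proof.
move=> /[dup] t01 /andP[t0 t1]; have tw := one_sub_neq0_in d0 hd t01.
have t1' : 1 - t%:c != 0 by rewrite -(realc1 R) -realcB realc_eq0 subr_eq0 gt_eqF.
have t1'' : t%:c - 1 != 0 by rewrite -oppr_eq0 opprB.
by rewrite /lform /wform /=; field; rewrite t1' t1'' tw.
Qed.

Lemma lform0_sub (t : R) : 0 < t < 1 ->
  lform z l0 t - wform w t = (t%:c * (1 - t%:c * w))^-1.
Proof.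
move=> /[dup] t01 /andP[t0 t1]; have tw := one_sub_neq0_in d0 hd t01.
have t1' : t%:c != 0 by rewrite realc_eq0 gt_eqF.
by rewrite /lform /wform /= subr0; field; rewrite t1' tw.
Qed.

Lemma one_sub_inv (t : R) : 0 < t < 1 -> normc (1 - t%:c * w)^-1 <= d^-1.
Proof.
move=> /andP[t0 t1]; have h : d <= normc (1 - t%:c * w) by apply: hd; rewrite !ltW.
by rewrite ComplexField.Normc.normcV lef_pV2 ?posrE//; exact: lt_le_trans h.
Qed.

Lemma cmeas_one_sub : cmeas (`]0, 1[%classic : set R) (fun t : R => (1 - t%:c * w)^-1).
Proof.
apply: cmeasV; apply: cmeasB; first exact: cmeas_cst.
by apply: cmeasM; [exact: cmeas_real|exact: cmeas_cst].
Qed.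

Lemma dominated_trunc (x : R) f : dominated f -> dominated (trunc x f).
Proof.
move=> [mf [c fc]]; split.
  rewrite /trunc; apply: cmeas_if => //; last exact: cmeas_cst.
  by apply: measurable_fun_ltr => //; exact: measurable_cst.
exists c => t tI; rewrite /trunc; case: ifP => _; first exact: fc.
by rewrite ComplexField.Normc.normc0; apply: le_trans (fc t tI); exact: normc_ge0.
Qed.

Lemma dominated_polylog0_form (x : R) : 0 < x < 1 ->
  dominated (trunc x (fun t => (1 - w) / ((1 - t%:c * w) * (1 - t%:c)))).
Proof.
move=> /andP[x0 x1]; split.
  rewrite /trunc; apply: cmeas_if => //; last exact: cmeas_cst.
    by apply: measurable_fun_ltr => //; exact: measurable_cst.
  apply: cmeasM; first exact: cmeas_cst.
  rewrite (_ : (fun _ => _) = (fun t : R => (1 - t%:c * w)^-1 * (1 - t%:c)^-1)); last first.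
    by apply/funext => t; rewrite invfM.
  apply: cmeasM; first exact: cmeas_one_sub.
  by apply: cmeasV; apply: cmeasB; [exact: cmeas_cst|exact: cmeas_real].
have x1' : 0 < 1 - x by rewrite subr_gt0.
have c0 : 0 <= normc (1 - w) * (d^-1 * (1 - x)^-1).
  by rewrite mulr_ge0 ?normc_ge0// mulr_ge0// invr_ge0 ltW.
exists (normc (1 - w) * (d^-1 * (1 - x)^-1)) => t; rewrite in_itv/= => /[dup] t01 /andP[t0 t1].
rewrite /trunc; case: ifPn => tx; last first.
  by rewrite ComplexField.Normc.normc0; apply: mulr_ge0 => //; exact: rho_ge0.
apply: (@le_trans _ _ (normc (1 - w) * (d^-1 * (1 - x)^-1))); last by rewrite ler_peMr// rho_ge1.
rewrite ComplexField.Normc.normcM invfM ComplexField.Normc.normcM.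
apply: ler_wpM2l; first exact: normc_ge0.
apply: ler_pM; rewrite ?normc_ge0//; first exact: one_sub_inv.
rewrite ComplexField.Normc.normcV -(realc1 R) -realcB normc_real gtr0_norm ?subr_gt0//.
by rewrite lef_pV2 ?posrE ?subr_gt0// lerD2l lerN2 ltW.
Qed.

Lemma dominated_polylogS_form f : tame f ->
  dominated (fun t => f t / (t%:c * (1 - t%:c * w))).
Proof.
move=> [cf [c c0 fc]]; split.
  apply: cmeasM; first exact: cmeas_ccont01.
  rewrite (_ : (fun _ => _) = (fun t : R => (t%:c)^-1 * (1 - t%:c * w)^-1)); last first.
    by apply/funext => t; rewrite invfM.
  by apply: cmeasM; [apply: cmeasV; exact: cmeas_real|exact: cmeas_one_sub].
exists (c * d^-1) => t; rewrite in_itv/= => /[dup] t01 /andP[t0 t1].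
rewrite ComplexField.Normc.normcM invfM ComplexField.Normc.normcM.
apply: (@le_trans _ _ ((c * (t * (1 - t) `^ (- (3 / 4)))) * (t^-1 * d^-1))).
  apply: ler_pM; rewrite ?normc_ge0//; first by rewrite mulr_ge0 ?normc_ge0.
    exact: fc.
  apply: ler_pM; rewrite ?normc_ge0//; last exact: one_sub_inv.
  by rewrite ComplexField.Normc.normcV normc_real gtr0_norm.
rewrite [leLHS](_ : _ = c * d^-1 * (1 - t) `^ (- (3 / 4))); last first.
  by field; rewrite !gt_eqF.
by apply: ler_wpM2l; [rewrite mulr_ge0// invr_ge0 ltW|apply: rho_domr].
Qed.

(** Multiplying by e_0 - e on the right integrates against
    dt/t - [wform w] dt = dt/(t (1 - t w)), the form in the recursion of [polylog];
    each step keeps the sign - 1 of the first one. *)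
Lemma realizes_polylog n : realizes ((e_ l1 - e) * (e_ l0 - e) ^+ n) (fun x => (-1) * polylog w n x).
Proof.
elim: n => [|n IH].
  rewrite mulr1; apply: realizes_eq ew.1 _ => x /[dup] x01 /andP[x0 x1].
  rewrite (polylog0E d0 hd) ?(ltW x0)// -int01Z; last exact: dominated_polylog0_form.
  apply: eq_int01 => t; rewrite in_itv/= => t01; rewrite /trunc.
  by case: ifP => _; rewrite ?mulr0// lform1_sub// mulN1r.
rewrite exprSr mulrA; apply: realizes_eq (ew.2 _ _ IH).1 _ => x /[dup] x01 /andP[x0 x1].
have FN : tame (polylog w n).
  by apply: tame_eq (tameZ (-1) (realizes_tame IH)) => t _; rewrite mulrA mulrNN !mul1r.
rewrite (polylogSE d0 hd) ?(ltW x0) ?(ltW x1)// -int01Z; last exact/dominated_trunc/dominated_polylogS_form.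
apply: eq_int01 => t; rewrite in_itv/= => t01; rewrite /trunc.
by case: ifP => _; rewrite ?mulr0// lform0_sub// mulrA.
Qed.

(** The last step of the recursion may be taken at x = 1, since a factor e_0 - e has no
    pole there. *)
Lemma L_polylog n : L z ((e_ l1 - e) * (e_ l0 - e) ^+ n.+1) = (-1) * polylog w n.+1 1.
Proof.
have IH := realizes_polylog n.
have FN : tame (polylog w n).
  by apply: tame_eq (tameZ (-1) (realizes_tame IH)) => t _; rewrite mulrA mulrNN !mul1r.
rewrite exprSr mulrA (ew.2 _ _ IH).2 (polylogSE d0 hd) ?ler01 ?lexx// int01_trunc1 -int01Z; last exact: dominated_polylogS_form.
by apply: eq_int01 => t; rewrite in_itv/= => t01; rewrite lform0_sub// mulrA.
Qed.

End identification.

End words.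

(** * Sums over compositions *)

Section combinatorics.
Variables (A : nzRingType) (x0 x1 xz : A).

(** The sum of all products xz x_(i_1) ... x_(i_n) with each i_j in {0, 1} and exactly b of
    them equal to 1, split according to the last factor. *)
Fixpoint sum_words (n b : nat) : A :=
  if n is n'.+1 then sum_words n' b * x0 + (if b is b'.+1 then sum_words n' b' * x1 else 0)
  else if b is 0%N then xz else 0.

Lemma sum_words_gt n b : (n < b)%N -> sum_words n b = 0.
Proof.
elim: n b => [|n IH] [|b]//= nb.
by rewrite !IH ?mul0r ?addr0// ltnW.
Qed.

Variable k : nat.
Implicit Types (p : {poly A}).

(** Compositions are counted by coefficient extraction: a block of size j with its
    powers of x0 is a term of weight j of a polynomial. [geom] is the block
    of an arbitrary part j >= 1, and [geom2] that of the last part j >= 2. They are cut off at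
    degree k because parts are at most k. *)
Definition geom : {poly A} := \poly_(j < k.+1) (if j is j'.+1 then x0 ^+ j' else 0).
Definition geom2 : {poly A} := \poly_(j < k.+1) (if j is j'.+2 then x0 ^+ j'.+1 else 0).

(** Below the cut-off, geom = 'X (1 + geom x0). *)
Lemma coefMgeom p n : (n < k)%N -> (p * geom)`_n.+1 = p`_n + (p * geom)`_n * x0.
Proof.
move=> nk; rewrite !coefM big_ord_recr/= subnn [geom`_0]coef_poly/= mulr0 addr0.
rewrite big_ord_recr/= [X in _ = _ + X * _]big_ord_recr/= subnn subSnn.
rewrite [geom`_0]coef_poly/= mulr0 addr0 [geom`_1]coef_poly ltnS (leq_ltn_trans _ nk)// expr0 mulr1.
rewrite addrC mulr_suml; congr (_ + _); apply: eq_bigr => i _.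
have h : (n - i < k)%N := leq_ltn_trans (leq_subr _ _) nk.
rewrite subSn ?(ltnW (ltn_ord i))// -mulrA; congr (_ * _).
rewrite !coef_poly ltnS h (ltnW h : (n - i < k.+1)%N).
case E : (n - i)%N => [|j]; last by rewrite exprSr.
by move/eqP: E; rewrite subn_eq0 leqNgt ltn_ord.
Qed.

(** Below the cut-off, geom2 = 'X geom x0: a last part at least 2 is an arbitrary
    part followed by one more x0. *)
Lemma coefMgeom2 p n : (n < k)%N -> (p * geom2)`_n.+1 = (p * geom)`_n * x0.
Proof.
move=> nk; rewrite !coefM big_ord_recr/= subnn [geom2`_0]coef_poly/= mulr0 addr0 mulr_suml.
apply: eq_bigr => i _.
have h : (n - i < k)%N := leq_ltn_trans (leq_subr _ _) nk.
rewrite subSn ?(leq_ord i)// -mulrA; congr (_ * _).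
rewrite !coef_poly ltnS h (ltnW h : (n - i < k.+1)%N).
by case: (n - i)%N => [|j]; rewrite ?mul0r// exprSr.
Qed.

Definition block_gen b : {poly A} := (xz)%:P * geom * ((x1)%:P * geom) ^+ b.

Lemma block_gen_coef0 b : (block_gen b)`_0 = 0.
Proof.
elim: b => [|b IH]; first by rewrite /block_gen expr0 mulr1 coef0M [geom`_0]coef_poly mulr0.
by rewrite /block_gen exprSr mulrA coef0M -/(block_gen b) IH mul0r.
Qed.

(** Both sides satisfy the same recursion on the last letter, by [coefMgeom]. *)
Lemma block_gen_coefS n b : (n < k)%N -> (block_gen b)`_n.+1 = sum_words n b.
Proof.
elim: n b => [|n IH] b nk.
  case: b => [|b].
    by rewrite /block_gen expr0 mulr1 coefMgeom// coefC/= coef0M [geom`_0]coef_poly mulr0 mul0r addr0.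
  rewrite /block_gen exprSr !mulrA coefMgeom// -/(block_gen b) coef0M -/(block_gen b).
  have := block_gen_coef0 b; rewrite /block_gen => ->; rewrite mul0r add0r.
  by rewrite coef0M [geom`_0]coef_poly mulr0 mul0r.
have E := IH b (ltnW nk).
case: b E => [|b] E.
  rewrite /block_gen expr0 mulr1 coefMgeom// coefC/= add0r.
  by move: E; rewrite /block_gen expr0 mulr1 => ->; rewrite addr0.
have DS : block_gen b.+1 = block_gen b * x1%:P * geom by rewrite /block_gen exprSr !mulrA.
by rewrite DS coefMgeom// -DS E coefMC IH ?(ltnW nk)//= addrC.
Qed.

Lemma prod_monomials r (F : 'I_r -> A) (m : 'I_r -> nat) :
  \prod_(i < r) ((F i)%:P * 'X^(m i)) = (\prod_(i < r) F i)%:P * 'X^(\sum_(i < r) m i).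
Proof.
elim: r F m => [|r IH] F m; first by rewrite !big_ord0 expr0 mulr1 polyC1.
rewrite !big_ord_recr/= IH polyCM exprD -!mulrA; congr (_ * _).
rewrite !mulrA; congr (_ * _).
by rewrite -commr_polyXn.
Qed.

(** The parts that are not allowed contribute 0, so that the conditions in the sum over
    compositions can be moved inside a product of sums over all parts. *)
Definition block (r i j : nat) : A :=
  if (0 < j)%N && ((i.+1 == r) ==> (1 < j)%N)
  then (if i == 0%N then xz else x1) * x0 ^+ (j - 1) else 0.

Lemma sum_blocks r : \sum_(f : {ffun 'I_r -> 'I_k.+1} |
    [&& (\sum_(i < r) f i == k)%N, [forall i : 'I_r, (1 <= f i)%N]
      & [forall i : 'I_r, (i.+1 == r) ==> (2 <= f i)%N]])
    \prod_(i < r) ((if i == 0 :> nat then xz else x1) * x0 ^+ (f i - 1)) =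
  (\prod_(i < r) \sum_(j < k.+1) ((block r i j)%:P * 'X^j))`_k.
Proof.
rewrite bigA_distr_bigA/= coef_sum big_mkcond; apply: eq_bigr => f _.
rewrite prod_monomials coefCM coefXn eq_sym.
case: eqP => _ /=; last by rewrite mulr0.
rewrite mulr1; case: ifPn => [/andP[/forallP f1 /forallP f2]|].
  by apply: eq_bigr => i _; rewrite /block f1 f2.
have prod0 (F : 'I_r -> A) i : F i = 0 -> \prod_(i < r) F i = 0.
  elim: r F i {f} => [|r IH] F i; first by case: i.
  rewrite big_ord_recr/=; case: (unliftP ord_max i) => [j ->|-> ->]; last by rewrite mulr0.
  move=> Fj; rewrite (IH (fun i => F (widen_ord (leqnSn r) i)) j) ?mul0r// -Fj.
  by congr F; apply: val_inj; rewrite /= /bump leqNgt ltn_ord.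
rewrite negb_and !negb_forall => /orP[]/existsP[i fi]; apply/esym/(prod0 _ i).
  by rewrite /block (negbTE fi).
by rewrite /block (negbTE fi) andbF.
Qed.

Lemma block_sum_inner r i : (i.+1 < r)%N ->
  \sum_(j < k.+1) ((block r i j)%:P * 'X^j) = (if i == 0%N then xz else x1)%:P * geom.
Proof.
move=> ir; rewrite /geom poly_def mulr_sumr; apply: eq_bigr => -[[|j] jk] _.
  by rewrite /block/= mul0r scale0r mulr0.
by rewrite /block/= (ltn_eqF ir)/= subn1/= polyCM -mulrA -[in RHS]mul_polyC.
Qed.

Lemma block_sum_last i :
  \sum_(j < k.+1) ((block i.+1 i j)%:P * 'X^j) = (if i == 0%N then xz else x1)%:P * geom2.
Proof.
rewrite /geom2 poly_def mulr_sumr; apply: eq_bigr => -[[|[|j]] jk] _.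
- by rewrite /block/= mul0r scale0r mulr0.
- by rewrite /block/= eqxx /= mul0r scale0r mulr0.
by rewrite /block/= eqxx /= subn1/= polyCM -mulrA -[in RHS]mul_polyC.
Qed.

Lemma prod_block_gen b : \prod_(i < b.+1) ((if i == 0 :> nat then xz else x1)%:P * geom) = block_gen b.
Proof.
elim: b => [|b IH]; first by rewrite big_ord_recr big_ord0 /= mul1r /block_gen mulr1.
by rewrite big_ord_recr/= IH /block_gen exprSr !mulrA.
Qed.

(** The last part, at least 2, contributes a final x0. What precedes it is xz followed
    by an arbitrary word with b letters x1. *)
Lemma sum_compositions b : (2 <= k)%N -> \sum_(f : {ffun 'I_b.+1 -> 'I_k.+1} |
    [&& (\sum_(i < b.+1) f i == k)%N, [forall i : 'I_b.+1, (1 <= f i)%N]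
      & [forall i : 'I_b.+1, (i.+1 == b.+1) ==> (2 <= f i)%N]])
    \prod_(i < b.+1) ((if i == 0 :> nat then xz else x1) * x0 ^+ (f i - 1)) =
  sum_words (k - 2) b * x0.
Proof.
move=> k2; rewrite sum_blocks big_ord_recr/= block_sum_last.
have k1 : (k.-1 < k)%N by case: k k2.
have k0 : (k - 2 < k)%N by case: k k2 => // [[|k']] // _; rewrite subSS subSS subn0.
have kE : k = k.-1.+1 by case: k k2.
have kE' : k.-1 = (k - 2).+1 by case: k k2 => // [[|k']] // _; rewrite subSS subSS subn0.
rewrite mulrA [X in _`_X]kE coefMgeom2// kE'; congr (_ * _).
rewrite -(block_gen_coefS b k0); congr (_`_ _).
rewrite -prod_block_gen big_ord_recr/= -mulrA.
rewrite (eq_bigr (fun i : 'I_b => (if i == 0 :> nat then xz else x1)%:P * geom)) //.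
by move=> i _; rewrite block_sum_inner// ltnS.
Qed.

End combinatorics.

(** * The two sides of the identity *)

Section final.
Variable R : realType.
Local Notation C := R[i].
Local Notation I := (`]0, 1[%classic : set R).
Local Notation normc := (@ComplexField.Normc.normc R).
Local Notation "x %:c" := (real_complex_def (Phant R) x) (at level 1, format "x %:c").
Variable z : C.
Hypothesis hz : forall t : R, 0 <= t <= 1 -> z <> t%:c.

Local Notation g := (lform z lz).
Local Notation words := (sum_words (e_ l0) (e_ l1) (e_ lz)).

Lemma lform_z_bounded : exists2 G : R, 0 <= G & forall x : R, 0 < x < 1 -> normc (g x) <= G.
Proof.
have [d d0 dz] := dist_segment hz; exists d^-1; first by rewrite invr_ge0 ltW.
move=> x /andP[x0 x1]; have h : d <= normc (x%:c - z) by apply: dz; rewrite !ltW.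
by rewrite /lform /letter_val ComplexField.Normc.normcV lef_pV2 ?posrE//; exact: lt_le_trans h.
Qed.

Lemma realizes0 : realizes z 0 (fun=> 0).
Proof.
have w1 := @realizes_word _ z [:: l1] isT.
rewrite -(subrr (word [:: l1])); apply: realizes_eq (realizesD w1 (realizesN w1)) _.
by move=> x _; rewrite mulN1r subrr.
Qed.

(** The form of e_1 is - dt/(1 - t), so the b letters e_1 produce (-1)^b. *)
Definition signed_kernel_int n b (x : R) : C :=
  if (b <= n)%N then (-1) ^+ b * kernel_int g (n - b) b x else 0.

Lemma signed_kernel_int_gt n b : (n < b)%N -> signed_kernel_int n b = fun=> 0.
Proof. by move=> nb; apply/funext => x; rewrite /signed_kernel_int leqNgt nb. Qed.

(** The sum over words and the integral against the kernel have the same recursion on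
    the last letter. *)
Lemma realizes_sum_words n b : realizes z (words n b) (signed_kernel_int n b).
Proof.
have [G G0 gG] := lform_z_bounded; have cg := @ccont_lform _ _ hz lz.
elim: n b => [|n IH] b.
  case: b => [|b] /=; last by rewrite signed_kernel_int_gt//; exact: realizes0.
  rewrite e_word; apply: realizes_eq (@realizes_word _ z [:: lz] isT) _ => x x01.
  by rewrite iterint1// /signed_kernel_int subnn expr0 mul1r kernel_int00.
pose h b' (t : R) : C := if b' is b''.+1 then signed_kernel_int n b'' t else 0.
have r1 : realizes z (if b is b'.+1 then words n b' * e_ l1 else 0) (primitive z l1 (h b)).
  case: b => [|b] /=; last exact: realizes_mul.
  apply: realizes_eq realizes0 _ => x /andP[x0 x1].
  rewrite primitive_int01 ?(ltW x0) ?(ltW x1)//.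
  by rewrite -[LHS](int01_0 R); congr int01; apply/funext => t; rewrite /trunc mul0r; case: ifP.
have F0 := realizes_tame hz (IH b).
have Fh : tame (h b).
  have Fh0 : tame (h 0%N) := realizes_tame hz realizes0.
  have FhS b' : tame (h b'.+1) := realizes_tame hz (IH b').
  by case: b {r1 F0}.
rewrite [words n.+1 b]/=; apply: realizes_eq (realizesD (realizes_mul hz l0 (IH b)) r1) _.
move=> x /[dup] x01 /andP[x0 x1].
have fx a : fits a x by apply: fits_lt; rewrite ltW.
rewrite !primitive_int01 ?(ltW x0) ?(ltW x1)// -int01D; [|exact: dominated_tame..].
have dd := dominatedD (dominated_tame hz (fx l0) F0) (dominated_tame hz (fx l1) Fh).
rewrite [RHS]/signed_kernel_int; case: ifPn => nb; last first.
  rewrite -[RHS](int01_0 R); congr int01; apply/funext => t; rewrite -ltnNge in nb.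
  rewrite signed_kernel_int_gt ?(ltnW nb)//; case: b nb {IH r1 F0 Fh dd} => // b nb.
  by rewrite /h signed_kernel_int_gt// /trunc !mul0r; case: ifP; rewrite addr0.
have sgn2 : (-1) ^+ b * (-1) ^+ b = 1 :> C by rewrite -exprD addnn -mul2n exprM sqrrN expr1n expr1n.
rewrite -[LHS]mul1r -{1}sgn2 -[LHS]mulrA; congr (_ * _).
rewrite (kernel_int_rec cg G0 gG x01); last by rewrite subnK.
rewrite -int01Z//; apply: eq_int01 => t; rewrite in_itv/= => /[dup] t01 /andP[t0 t1].
rewrite /trunc; case: ifP => _; last by rewrite addr0 mulr0.
rewrite mulrDr; congr (_ + _).
  rewrite /lform /letter_val subr0 mulrA; congr (_ / _).
  rewrite /signed_kernel_int; case: ifPn => [bn|]; first by rewrite subSn// mulrA sgn2 mul1r.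
  rewrite -ltnNge => nb'; rewrite mulr0.
  by have -> : (n.+1 - b = 0)%N by apply/eqP; rewrite subn_eq0.
have k1 : lform z l1 t = - (1 - t)%:c^-1.
  by rewrite /lform /letter_val -(realc1 R) -realcB -invrN -realcN opprB.
rewrite k1 !mulrA mulrN -mulNr; congr (_ / _).
case: b nb sgn2 {IH r1 F0 Fh dd} => [|b] nb sgn2 /=; first by rewrite mulr0 oppr0.
rewrite /signed_kernel_int (_ : (b <= n)%N = true)// subSS mulrA exprS mulN1r !mulNr opprK.
by rewrite -exprD addnn -mul2n exprM sqrrN expr1n expr1n mul1r.
Qed.

Lemma dominated_logpow n f : tame f -> dominated (fun s : R => (logpow n s)%:c * (f s / s%:c)).
Proof.
move=> [cf [c c0 fc]]; split.
  apply: cmeasM.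
    by apply: cmeas_real; apply: measurable_funTS; exact: measurable_logpow.
  by apply: cmeasM; [exact: cmeas_ccont01|apply: cmeasV; exact: cmeas_real].
have [K K0 HK] := @divpow_bound0 R n.
exists (K * c) => s; rewrite in_itv/= => /[dup] s01 /andP[s0 s1].
rewrite ComplexField.Normc.normcM normc_real ger0_norm ?logpow_ge0//.
apply: (@le_trans _ _ ((K * s `^ (- (1 / 4))) * (c * (1 - s) `^ (- (3 / 4))))).
  apply: ler_pM; rewrite ?normc_ge0 ?logpow_ge0//; first by apply: HK; rewrite s0 ltW.
  rewrite ComplexField.Normc.normcM ComplexField.Normc.normcV normc_real gtr0_norm//.
  rewrite ler_pdivrMr//; apply: (le_trans (fc s s01)).
  by rewrite le_eqVlt; apply/orP; left; apply/eqP; ring.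
rewrite [leLHS]mulrACA; apply: ler_wpM2l; first exact: mulr_ge0.
by apply: rho_dom => //; lra.
Qed.

(** Partial fractions, with w = 1/z: this is where the integrand splits into a part
    that depends on z and a part that does not. *)
Lemma square_inner_polylog b (be : R) : 0 < be < 1 -> be%:c * square_inner g b be = polylog z^-1 b be - polylog 0 b be.
Proof.
move=> /[dup] be01 /andP[be0 be1]; have z0 := z_neq0 hz.
have [d d0 hd] := one_sub_ge hz (or_introl erefl : z^-1 = z^-1 \/ z^-1 = 0).
have [d' d0' hd'] := one_sub_ge hz (or_intror erefl : (0 : C) = z^-1 \/ (0 : C) = 0).
have b01 : 0 <= be < 1 by rewrite ltW.
have dN1 := dominated_polylog d0 hd b b01.
have dN2 := dominated_polylog d0' hd' b b01.
rewrite /polylog -int01B//.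
have bn0 : be%:c != 0 by rewrite realc_eq0 gt_eqF.
have E (al : R) : 0 < al < 1 ->
   (logpow b al)%:c * (be%:c * (1 - z^-1) / Delta z^-1 al be) -
   (logpow b al)%:c * (be%:c * (1 - 0) / Delta 0 al be) =
   be%:c * ((logpow b al)%:c * (g (be * ((1 - al) / (1 - al * be))) *
     ((1 - be) / (1 - al * be) ^+ 2)%:c)).
  move=> /[dup] al01 /andP[al0 al1].
  have Dz : Delta z^-1 al be != 0.
    by apply: (Delta_unit d0 hd (x := 1)) => //; rewrite (ltW al0) (ltW al1).
  have abc : 1 - al * be != 0 by rewrite gt_eqF// subr_gt0 mulr_ilt1// ltW.
  have abc' : 1 - al%:c * be%:c != 0 by rewrite -(realc1 R) -realcM -realcB realc_eq0.
  have s01 : 0 < be * ((1 - al) / (1 - al * be)) < 1.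
    have ab0 : 0 < 1 - al * be by rewrite subr_gt0 mulr_ilt1// ltW.
    rewrite mulrA; apply/andP; split; first by rewrite divr_gt0// mulr_gt0// subr_gt0.
    by rewrite ltr_pdivrMr// mul1r; nra.
  have sz := @lform_den_neq0 _ _ hz lz _ s01.
  move: Dz sz; rewrite /lform /letter_val /Delta !mulr0 !subr0.
  move: (logpow b al) => y; rewrite !realcE !mulr1 => Dz sz.
  move: (al%:c) (be%:c) abc' Dz sz => A B AB0 Dz sz.
  have D1 : B * (1 - A) + - z * (1 - A * B) != 0.
    rewrite (_ : _ + _ = (B * ((1 - A) / (1 - A * B)) - z) * (1 - A * B)); last by field.
    exact: mulf_neq0.
  have D2 : z - B - A * B * (z - 1) != 0.
    rewrite (_ : _ - _ = (1 - B / z - A * B * (1 - z^-1)) * z); last by field.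
    exact: mulf_neq0.
  by field; apply/and4P; split.
rewrite /square_inner (@eq_int01 _ _ (fun al => (be%:c)^-1 *
   ((logpow b al)%:c * (be%:c * (1 - z^-1) / Delta z^-1 al be) -
   (logpow b al)%:c * (be%:c * (1 - 0) / Delta 0 al be)))); last first.
  by move=> al; rewrite in_itv/= => /E ->; rewrite mulKf.
by rewrite int01Z ?mulVKf//; exact: dominatedB.
Qed.

Lemma int01_kernel_int a b : int01 (fun t => kernel_int g a b t / t%:c) =
  int01 (fun s => (logpow a s)%:c * ((-1) * polylog 0 b s / s%:c)) -
  int01 (fun s => (logpow a s)%:c * ((-1) * polylog z^-1 b s / s%:c)).
Proof.
have [G G0 gG] := lform_z_bounded; have cg := @ccont_lform _ _ hz lz.
have [d d0 hd] := one_sub_ge hz (or_introl erefl : z^-1 = z^-1 \/ z^-1 = 0).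
have [d' d0' hd'] := one_sub_ge hz (or_intror erefl : (0 : C) = z^-1 \/ (0 : C) = 0).
have F1 := realizes_tame hz (realizes_polylog hz d0 hd (represents_z hz) b).
have F2 := realizes_tame hz (realizes_polylog hz d0' hd' (represents_0 hz) b).
rewrite (kernel_int_square cg G0 gG) -int01B; [|exact: dominated_logpow..].
apply: eq_int01 => s; rewrite in_itv/= => /[dup] s01 /andP[s0 s1].
have sn0 : s%:c != 0 by rewrite realc_eq0 gt_eqF.
have <- : s%:c^-1 * (polylog z^-1 b s - polylog 0 b s) = square_inner g b s by rewrite -square_inner_polylog// mulKf.
by move: (logpow a s) => y; field.
Qed.

Lemma L_sum_words a b : L z (words (a + b) b * e_ l0) = (-1) ^+ b * int01 (fun t => kernel_int g a b t / t%:c).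
Proof.
have rS := realizes_sum_words (a + b) b; have FS := realizes_tame hz rS.
have E (t : R) : signed_kernel_int (a + b) b t = (-1) ^+ b * kernel_int g a b t.
  by rewrite /signed_kernel_int leq_addl addnK.
have := realizes_L_e0 hz 0 rS; rewrite expr1 => ->.
have sgn2 : (-1) ^+ b * (-1) ^+ b = 1 :> C by rewrite -exprD addnn -mul2n exprM sqrrN expr1n expr1n.
have dd := dominated_logpow 0 FS.
have E' (s : R) : (logpow 0 s)%:c * (signed_kernel_int (a + b) b s / s%:c) =
    (-1) ^+ b * (kernel_int g a b s / s%:c).
  by rewrite E /logpow /divpow expr0 fact0 divr1 realc1 mul1r mulrA.
rewrite (eq_int01 (g := fun s => (-1) ^+ b * (kernel_int g a b s / s%:c))) => [|s _]; last exact: E'.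
rewrite int01Z//; have := dominatedZ ((-1) ^+ b) dd; congr dominated.
by apply/funext => s; rewrite E' mulrA sgn2 mul1r.
Qed.

End final.

Lemma L0 (R : realType) (z : R[i]) : L z 0 = 0.
Proof. by rewrite -(subrr (e_ l0)) L_additive L_opp subrr. Qed.

Lemma L_sum (R : realType) (z : R[i]) (T : finType) (P : pred T) (F : T -> ncpoly) :
  L z (\sum_(i | P i) F i) = \sum_(i | P i) L z (F i).
Proof.
exact: (@big_morph _ _ (L z) 0 +%R 0 +%R (@L_additive R z) (L0 z)).
Qed.

(** The admissible compositions of k into b + 1 parts enumerate the words e_z W e_0 in
    which W has k - 2 letters, of which b are e_1. *)
Lemma sum_zword (k b : nat) : (2 <= k)%N ->
  \sum_(k_ : {ffun 'I_b.+1 -> 'I_k.+1} | admissible k_) zword k_ =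
  sum_words (e_ l0) (e_ l1) (e_ lz) (k - 2) b * e_ l0.
Proof.
move=> k2; rewrite -(@sum_compositions _ (e_ l0) (e_ l1) (e_ lz) k b k2).
apply: eq_bigr => f _; apply: eq_bigr => i _.
by case: ifP.
Qed.

Lemma subr0_word (A : nzRingType) (p q : A) n : (p - 0) * (q - 0) ^+ n = p * q ^+ n.
Proof. by rewrite !subr0. Qed.

Lemma mulr_exprD (A : nzRingType) (p q : A) a b : p * q ^+ b * q ^+ a = p * q ^+ (a + b).
Proof. by rewrite -mulrA -exprD addnC. Qed.

Theorem theorem1p2 (R : realType) (z : R[i])
    (hz : forall t : R, 0 <= t <= 1 -> z <> t%:C%C)
    (k r : nat) (hk : (2 <= k)%N) (hr : (1 <= r <= k)%N) :
  (-1) ^+ r * \sum_(k_ : {ffun 'I_r -> 'I_k.+1} | admissible k_)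
                L z (zword k_)
  = - L z (e_ l1 * e_ l0 ^+ (k - 1))
    + L z ((e_ l1 - e_ lz) * (e_ l0 - e_ lz) ^+ (r - 1) * e_ l0 ^+ (k - r)).
Proof.
case: r hr => [//|b] /= bk.
have [d d0 hd] := one_sub_ge hz (or_introl erefl : z^-1 = z^-1 \/ z^-1 = 0).
have [d' d0' hd'] := one_sub_ge hz (or_intror erefl : (0 : R[i]) = z^-1 \/ (0 : R[i]) = 0).
have rz := represents_z hz; have r0 := represents_0 hz.
have Lsum : \sum_(k_ : {ffun 'I_b.+1 -> 'I_k.+1} | admissible k_) L z (zword k_) =
    L z (sum_words (e_ l0) (e_ l1) (e_ lz) (k - 2) b * e_ l0).
  by rewrite -L_sum (sum_zword b hk).
rewrite Lsum.
have [a [E|E]] : exists a, k = b.+1 \/ k = (a + b).+2.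
  exists (k - b.+2)%N; move: bk; rewrite leq_eqVlt => /predU1P[<-|bk]; first by left.
  by right; rewrite -addnS -addnS subnK.
- have -> : sum_words (e_ l0) (e_ l1) (e_ lz) (k - 2) b = 0.
    by apply: sum_words_gt; move: hk; rewrite E; case: (b) => [//|b'] _; rewrite !subSS subn0.
  rewrite mul0r L0 mulr0.
  rewrite E subnn expr0 mulr1 !subn1 /=.
  case: b E {bk Lsum} => [|b] E; first by rewrite E in hk.
  have e0 : L z (e_ l1 * e_ l0 ^+ b.+1) = (-1) * polylog 0 b.+1 1.
    by rewrite -subr0_word; have := L_polylog hz d0' hd' r0 b.
  have ez := L_polylog hz d0 hd rz b.
  (* Here k = r: the left-hand side is an empty sum, and the words on the right take
     the values of polylogarithms at 1, from which w disappears. *)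
  have cancel (X Y p q : R[i]) : X = (-1) * p -> Y = (-1) * q -> p = q -> 0 = - X + Y.
    by move=> -> -> ->; rewrite addNr.
  by apply: cancel e0 ez _; rewrite (polylogS_at1 d0 hd) (polylogS_at1 d0' hd').
have kb : (k - b.+1 = a.+1)%N by rewrite E subSS -addSn addnK.
have eS := etrans (L_sum_words hz a b) (congr1 ( *%R ((-1) ^+ b)) (int01_kernel_int hz a b)).
have ez := realizes_L_e0 hz a (realizes_polylog hz d0 hd rz b).
have e0 := realizes_L_e0 hz a (realizes_polylog hz d0' hd' r0 b).
rewrite (subr0_word (e_ l1) (e_ l0) b) (mulr_exprD (e_ l1) (e_ l0)) in e0.
have k2 : (k - 2 = a + b)%N by rewrite E !subSS subn0.
have k1 : (k - 1 = a.+1 + b)%N by rewrite E subn1.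
have conclude (U X Y p q : R[i]) : U = (-1) ^+ b * (p - q) -> X = p -> Y = q ->
    (-1) ^+ b.+1 * U = - X + Y.
  move=> -> -> ->; rewrite mulrA -exprD addSn exprS addnn -mul2n exprM sqrrN.
  by rewrite !expr1n mulr1 mulN1r opprB addrC.
rewrite kb k1 k2 subn1; exact: conclude eS e0 ez.
Qed.
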